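(* Let $1\le p<\infty$ and $\frac1p+\frac1{p'}=1$. Then for every positive integer $n$, $$\mathcal{N}(\mathbb{S}^d;n)_p=\operatorname{dist}(G_n,\mathcal{P}_{n,p'}^{\bot})_{L^{p'}(w_d)}.$$ Moreover, there exists a minimizer $F_\ast\in\mathcal{P}_{n,p'}^{\bot}$ of the form $$F_\ast=G_n-\frac{P^{*}(1)\,|P^{*}|^{p-1}\operatorname{sign}P^{*}}{\|P^\ast\|_{L^p(w_d)}^p}$$ such that $\|G_n-F_\ast\|_{L^{p'}(w_d)}=\operatorname{dist}(G_n,\mathcal{P}_{n,p'}^{\bot})_{L^{p'}(w_d)}$, where $P^\ast$ denotes the unique monic algebraic polynomial of degree $n$ such that $$\|P^\ast\|_{L^p(w_d^\ast)}=\operatorname{dist}(x^n,\mathcal{P}_{n-1})_{L^p(w_d^\ast)},\qquad w_d^\ast(t)=w_d(t)(1-t).$$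
   Context: All functions are real-valued and $d\in\mathbb{N}$. $\mathbb{S}^d=\{x\in\mathbb{R}^{d+1}:|x|=1\}$ carries the surface Lebesgue measure $d\sigma$ normalized by $\int_{\mathbb{S}^d}d\sigma=1$, used to define $L^p(\mathbb{S}^d)$. $\Pi_n^d$ is the space of restrictions to $\mathbb{S}^d$ of algebraic polynomials in $d+1$ variables of total degree at most $n$, and $$\mathcal{N}(\mathbb{S}^d;n)_p:=\sup\{\|f\|_{L^\infty(\mathbb{S}^d)}: f\in\Pi_n^d,\ \|f\|_{L^p(\mathbb{S}^d)}=1\}.$$ $w_d(t)=c_d(1-t^2)^{d/2-1}$ on $[-1,1]$, where $c_d>0$ is such that $\int_{-1}^1w_d(t)\,dt=1$. For a weight $w$, $L^p(w)$ is the Lebesgue space on $[-1,1]$ with respect to the measure $w(t)\,dt$ (for $p=\infty$, the essential supremum norm). $\mathcal{P}_n$ is the space of univariate algebraic polynomials of degree at most $n$; $$\mathcal{P}_n^{\bot}=\Bigl\{F\in L^1(w_d):\int_{-1}^1F(t)t^jw_d(t)\,dt=0,\ j=0,1,\dots,n\Bigr\},\qquad \mathcal{P}_{n,p'}^{\bot}=\mathcal{P}_n^{\bot}\cap L^{p'}(w_d).$$ For a normed space $X$, $E\subset X$ and $x\in X$, $\operatorname{dist}(x,E)_X=\inf_{y\in E}\|x-y\|_X$. $G_n(t)=(\dim\Pi_n^d)\,R_n^{(\frac d2,\frac{d-2}2)}(t)$, where $R_n^{(\alpha,\beta)}(t)=P_n^{(\alpha,\beta)}(t)/P_n^{(\alpha,\beta)}(1)$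 is the normalized Jacobi polynomial; equivalently $G_n(x\cdot y)$, $x,y\in\mathbb{S}^d$, is the reproducing kernel of $\Pi_n^d$ in $L^2(\mathbb{S}^d,d\sigma)$, i.e. $f(x)=\int_{\mathbb{S}^d}f(y)G_n(x\cdot y)\,d\sigma(y)$ for $f\in\Pi_n^d$. *)

(* Defs.v *)
From HB Require Import structures.
From mathcomp Require Import all_boot all_order all_algebra.
From mathcomp Require Import all_classical all_reals all_analysis.
From mathcomp Require Import measurable_realfun.
From mathcomp Require Import (canonicals, coercions) mpoly.

Set Implicit Arguments.
Unset Strict Implicit.
Unset Printing Implicit Defensive.

Import Order.TTheory GRing.Theory Num.Theory.
Import numFieldTopology.Exports numFieldNormedType.Exports.

Local Open Scope classical_set_scope.
Local Open Scope ring_scope.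

Section distance.
Context {disp : measure_display} {T : measurableType disp} {R : realType}.

Definition Ldist (mu : {measure set T -> \bar R}) (p : \bar R)
    (f : T -> R) (E : set (T -> R)) : \bar R :=
  ereal_inf [set ('N[mu]_p[EFin \o (f \- g)%R])%E | g in E].

End distance.

Section dimension.
Context {T : Type} {R : realType}.

Definition is_basis (V : set (T -> R)) (k : nat) (e : 'I_k -> T -> R) : Prop :=
  (forall c : 'I_k -> R,
     (forall x, \sum_(i < k) c i * e i x = 0) -> forall i, c i = 0) /\
  V = [set f | exists c : 'I_k -> R, f = fun x => \sum_(i < k) c i * e i x].

(* Takes the junk value 0 on infinite-dimensional spaces. *)
Definition fdim (V : set (T -> R)) : nat :=
  xget 0%N [set k | exists e : 'I_k -> T -> R, is_basis V e].

End dimension.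

Section lebesgue_tuple.
Context {R : realType}.

Definition consT (n : nat) (x : R * n.-tuple R) : n.+1.-tuple R :=
  [tuple of x.1 :: x.2].

Lemma measurable_consT n : measurable_fun [set: R * n.-tuple R] (@consT n).
Proof. exact: measurable_cons. Qed.

Section step.
Variables (n : nat) (m : {sigma_finite_measure set (n.-tuple R) -> \bar R}).

Definition lebesgue_step : set (n.+1.-tuple R) -> \bar R :=
  pushforward (lebesgue_measure \x m)%E (@consT n).

Let mc := @measurable_consT n.

Let lebesgue_step0 : lebesgue_step set0 = 0%E.
Proof. by rewrite /lebesgue_step /pushforward preimage_set0 measure0. Qed.

Let lebesgue_step_ge0 A : (0 <= lebesgue_step A)%E.
Proof. exact: measure_ge0. Qed.

Let lebesgue_step_sigma_additive : semi_sigma_additive lebesgue_step.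
Proof.
exact: (@measure_semi_sigma_additive _ _ _
  (measure_function_pushforward__canonical__measure_function_Measure
    (lebesgue_measure \x m)%E mc)).
Qed.

HB.instance Definition _ := isMeasure.Build _ _ _ lebesgue_step
  lebesgue_step0 lebesgue_step_ge0 lebesgue_step_sigma_additive.

Let lebesgue_step_sigma_finite : sigma_finite setT lebesgue_step.
Proof.
have /sigma_finiteP[F [FT ndF Foo]] := sigma_finiteT (@lebesgue_measure R).
have /sigma_finiteP[G [GT ndG Goo]] := sigma_finiteT m.
pose uncons (x : n.+1.-tuple R) : R * n.-tuple R :=
  (thead x, [tuple of behead x]).
have consK : cancel (@consT n) uncons.
  by move=> [x y]; congr pair; apply/val_inj.
have muncons : measurable_fun setT uncons.
  apply: measurable_fun_pair => /=; first exact: measurable_tnth.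
  exact: measurable_behead.
exists (fun i => uncons @^-1` (F i `*` G i)).
  apply/esym/seteqP; split => // x _.
  have [i _ Fi] : (\bigcup_i F i) (uncons x).1 by rewrite -FT.
  have [j _ Gj] : (\bigcup_i G i) (uncons x).2 by rewrite -GT.
  exists (maxn i j) => //; split.
    by move: Fi; exact/subsetPset/ndF/leq_maxl.
  by move: Gj; exact/subsetPset/ndG/leq_maxr.
move=> i; have [mF Fi] := Foo i; have [mG Gi] := Goo i; split.
  by rewrite -[X in measurable X]setTI; apply: muncons => //; exact: measurableX.
rewrite /lebesgue_step /pushforward -comp_preimage.
rewrite (_ : uncons \o _ = id); last by apply/funext => x /=; exact: consK.
by rewrite preimage_id product_measure1E// lte_mul_pinfty// ge0_fin_numE.
Qed.

HB.instance Definition _ := Measure_isSigmaFinite.Build _ _ _ lebesgue_step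
  lebesgue_step_sigma_finite.

End step.

(* The Lebesgue measure of R^n: the image of lambda_1 \x lambda_(n-1) under
   (x, y) |-> x :: y. *)
Fixpoint lebesgue_tuple (n : nat) :
    {sigma_finite_measure set (n.-tuple R) -> \bar R} :=
  match n with
  | 0 => \d_([tuple] : 0.-tuple R)
  | m.+1 => lebesgue_step (lebesgue_tuple m)
  end.

End lebesgue_tuple.

Section sphere.
Context {R : realType}.

Definition enorm (n : nat) (x : n.-tuple R) : R :=
  Num.sqrt (\sum_(i < n) tnth x i ^+ 2).

Lemma measurable_enorm n : measurable_fun setT (@enorm n).
Proof.
rewrite (_ : @enorm n =
    Num.sqrt \o (fun x : n.-tuple R => \sum_(i < n) tnth x i ^+ 2)) //.
apply: measurableT_comp.
  by apply: continuous_measurable_fun; exact: sqrt_continuous.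
apply: measurable_sum => i.
by apply: measurable_funX; exact: measurable_tnth.
Qed.

(* Points x of R^(d+1), hence the sphere of dimension d. *)
Definition sphere (d : nat) : set (d.+1.-tuple R) := [set x | enorm x = 1].
Arguments sphere d _ : clear implicits.

Definition unit_ball (n : nat) : set (n.-tuple R) := [set x | enorm x <= 1].
Arguments unit_ball n _ : clear implicits.

Lemma measurable_unit_ball n : measurable (unit_ball n).
Proof.
rewrite (_ : unit_ball n = setT `&` (@enorm n @^-1` `]-oo, 1])).
  exact: measurable_enorm.
by rewrite setTI; apply/seteqP; split => x /=; rewrite /unit_ball/= in_itv.
Qed.

(* The origin, which has no direction, is sent to itself. *)
Definition direction (n : nat) (x : n.-tuple R) : n.-tuple R :=
  [tuple tnth x i / enorm x | i < n].

Lemma measurable_direction n : measurable_fun setT (@direction n).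
Proof.
apply/measurable_fun_tnthP => i.
rewrite (_ : _ \o _ = (fun x => tnth x i * enorm x `^ (-1))); last first.
  apply/funext => x /=.
  by rewrite tnth_mktuple powR_inv1// sqrtr_ge0.
apply: measurable_funM; first exact: measurable_tnth.
exact: (measurableT_comp (measurable_powR (-1)) (@measurable_enorm n)).
Qed.

(* Normalized surface measure, carried by the sphere and defined by means of
   cones: sigma(A) = |{t x : 0 < t <= 1, x in A}| / |{|x| <= 1}| for Borel
   subsets A of the sphere, where |.| is the Lebesgue measure of R^(d+1). *)
Definition surface (d : nat) (A : set (d.+1.-tuple R)) : \bar R :=
  (lebesgue_tuple d.+1 (@direction d.+1 @^-1` A `&` unit_ball d.+1) *
   (fine (lebesgue_tuple d.+1 (unit_ball d.+1)))^-1%:E)%E.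

Section surface_measure.
Variable d : nat.

Let surface0 : @surface d set0 = 0%E.
Proof. by rewrite /surface preimage_set0 set0I measure0 mul0e. Qed.

Let surface_ge0 A : (0 <= @surface d A)%E.
Proof. by rewrite /surface mule_ge0// lee_fin invr_ge0 fine_ge0. Qed.

Let surface_sigma_additive : semi_sigma_additive (@surface d).
Proof.
pose m := mrestr (lebesgue_tuple d.+1) (@measurable_unit_ball d.+1).
have mD := @measurable_direction d.+1.
have := @measure_semi_sigma_additive _ _ _
  (measure_function_pushforward__canonical__measure_function_Measure m mD).
move=> sm F mF tF mUF.
rewrite /surface.
under eq_fun do rewrite -ge0_sume_distrl//.
by apply: cvgeZr => //; exact: sm.
Qed.

HB.instance Definition _ := isMeasure.Build _ _ _ (@surface d)
  surface0 surface_ge0 surface_sigma_additive.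

End surface_measure.

(* Pi_n^d; restrictions to the sphere are extended by 0 to R^(d+1). *)
Definition sphere_poly (d n : nat) : set (d.+1.-tuple R -> R) :=
  [set f | exists P : mpoly.mpoly d.+1 R,
     (mpoly.mmeasure mpoly.mdeg P <= n.+1)%N /\
     f = patch (cst 0) (sphere d) (fun x => mpoly.meval (tnth x) P)].

Definition nikolskii (d n : nat) (p : \bar R) : \bar R :=
  ereal_sup [set ('N[@surface d]_(+oo)[EFin \o f])%E | f in
    [set f | sphere_poly n f /\ ('N[@surface d]_p[EFin \o f] = 1)%E]].

End sphere.

Section weights.
Context {R : realType}.

Definition wintegral (w : R -> R) (A : set R) : \bar R :=
  (\int[lebesgue_measure]_(t in A `&` `[(-1)%R, 1%R]) (w t)%:E)%E.

Section wintegral_measure.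
Variables (w : R -> R).
Hypothesis mw : measurable_fun setT w.
Hypothesis w_ge0 : forall t, t \in `[-1, 1] -> 0 <= w t.

Lemma wintegral0 : wintegral w set0 = 0%E.
Proof. by rewrite /wintegral set0I integral_set0. Qed.

Lemma wintegral_ge0 A : (0 <= wintegral w A)%E.
Proof. by apply: integral_ge0 => t [_ /= t1]; rewrite lee_fin w_ge0. Qed.

Lemma wintegral_sigma_additive : semi_sigma_additive (wintegral w).
Proof.
move=> F mF tF mUF; rewrite /wintegral setI_bigcupl ge0_integral_bigcup//=.
- apply: is_cvg_ereal_nneg_natsum_cond => n _ _; exact: wintegral_ge0.
- by move=> k; apply: measurableI; [exact: mF|exact: measurable_itv].
- by apply: measurable_funTS; exact/measurable_EFinP.
- by move=> t [k _ [_ t1]]; rewrite lee_fin w_ge0.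
- exact: trivIset_setIr.
Qed.

End wintegral_measure.

Definition wd_const (d : nat) : R :=
  (\int[lebesgue_measure]_(t in `[-1, 1]) ((1 - t ^+ 2) `^ (d%:R / 2 - 1)))^-1.

Definition wd (d : nat) (t : R) : R :=
  wd_const d * (1 - t ^+ 2) `^ (d%:R / 2 - 1).

Definition wd_star (d : nat) (t : R) : R := wd d t * (1 - t).

Lemma measurable_wd d : measurable_fun setT (wd d).
Proof.
apply: measurable_funM => //.
apply: (@measurableT_comp _ _ _ _ _ _ (@powR R ^~ _)) => /=.
  exact: measurable_powR.
by apply: measurable_funB => //; exact: measurable_funX.
Qed.

Lemma wd_ge0 d t : 0 <= wd d t.
Proof.
apply: mulr_ge0; last exact: powR_ge0.
by rewrite invr_ge0 Rintegral_ge0// => x _; exact: powR_ge0.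
Qed.

Lemma measurable_wd_star d : measurable_fun setT (wd_star d).
Proof.
by apply: measurable_funM; [exact: measurable_wd|exact: measurable_funB].
Qed.

Lemma wd_star_ge0 d t : t \in `[-1, 1] -> 0 <= wd_star d t.
Proof.
by rewrite in_itv/= => /andP[_ t1]; rewrite mulr_ge0 ?wd_ge0// subr_ge0.
Qed.

(* The measures w_d(t) dt and w_d^*(t) dt on [-1, 1], extended by 0 to R. *)
Definition wdm (d : nat) : set R -> \bar R := wintegral (wd d).

HB.instance Definition _ (d : nat) := isMeasure.Build _ _ _ (wdm d)
  (@wintegral0 _) (wintegral_ge0 (fun t _ => wd_ge0 d t))
  (wintegral_sigma_additive (@measurable_wd d) (fun t _ => wd_ge0 d t)).

Definition wdm_star (d : nat) : set R -> \bar R := wintegral (wd_star d).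

HB.instance Definition _ (d : nat) := isMeasure.Build _ _ _ (wdm_star d)
  (@wintegral0 _) (wintegral_ge0 (@wd_star_ge0 d))
  (wintegral_sigma_additive (@measurable_wd_star d) (@wd_star_ge0 d)).

End weights.

Section univariate.
Context {R : realType}.

Definition polys (n : nat) : set (R -> R) :=
  [set f | exists Q : {poly R}, (size Q <= n.+1)%N /\ f = horner Q].

Definition perp (d n : nat) : set (R -> R) :=
  [set F | F \in Lfun (wdm d) 1%:E /\
     forall j, (j <= n)%N -> (\int[wdm d]_t (F t * t ^+ j)%:E = 0)%E].

Definition perp_in (d n : nat) (q : \bar R) : set (R -> R) :=
  @perp d n `&` [set F | F \in Lfun (wdm d) q].

(* Szego, Orthogonal polynomials, (4.21.2): P_n^(a, b)(t) is
   1/n! * sum_k C(n, k) (n+a+b+1)...(n+a+b+k) (a+k+1)...(a+n) ((t-1)/2)^k. *)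
Definition jacobi (a b : R) (n : nat) : {poly R} :=
  (n`!%:R)^-1 *: \sum_(k < n.+1)
    ('C(n, k)%:R * \prod_(i < k) (n%:R + a + b + i.+1%:R)
       * \prod_(k.+1 <= i < n.+1) (a + i%:R)) *:
    (2^-1 *: ('X - 1)) ^+ k.

Definition njacobi (a b : R) (n : nat) : {poly R} :=
  (jacobi a b n).[1]^-1 *: jacobi a b n.

Definition Gpoly (d n : nat) : {poly R} :=
  (fdim (@sphere_poly R d n))%:R *: njacobi (d%:R / 2) ((d%:R - 2) / 2) n.

Definition least_deviating (d n : nat) (p : \bar R) (P : {poly R}) : Prop :=
  [/\ P \is monic, size P = n.+1 &
      ('N[wdm_star d]_p[EFin \o horner P])%E
        = Ldist (wdm_star d) p (fun t => t ^+ n) (polys n.-1)].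

Definition Fstar (d n : nat) (p : R) (P : {poly R}) (t : R) : R :=
  (Gpoly d n).[t] -
  P.[1] * `|P.[t]| `^ (p - 1) * Num.sg P.[t]
    / fine ('N[wdm d]_(p%:E)[EFin \o horner P])%E `^ p.

End univariate.

(* Main.v *)
(** Averaging a polynomial [f] of degree [n] over the rotations that fix [x] gives a
    polynomial [Q] of degree [n] with [Q(1) = f(x)], and integrals of [f(y) g(x.y)] over the
    sphere become integrals of [Q g] against [w_d]. Hence [f(x)] is the integral of
    [f(y) (G_n - F)(x.y)] for every [F] orthogonal to [P_n], and Hoelder's inequality bounds
    the Nikolskii constant by the distance.

    For the converse let [P] be the extremal polynomial. Its first variation says that
    [psi(P) = |P|^(p-1) sign P] is orthogonal to polynomials of degree [< n] for the weight
    [(1 - t) w_d]; therefore [Phi = P(1) psi(P) / ||P||^p] satisfies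
    [\int Phi Q w_d = Q(1) = \int G_n Q w_d] for all [Q] of degree [n], so that [G_n - Phi]
    is orthogonal to [P_n]. The norm of [Phi] is [|P(1)| / ||P||], which the function
    [P(x_0) / ||P||] on the sphere shows to be a lower bound of the Nikolskii constant.

    The minimizer is unique even when [p = 1]: equality in the convexity inequality makes
    two minimizers vanish at the zeros of their midpoint, which is again a minimizer and so,
    by orthogonality, changes sign at least [n] times. *)

Require Import Defs.
From HB Require Import structures.
From mathcomp Require Import all_boot all_order all_algebra.
From mathcomp Require Import all_classical all_reals all_analysis.
From mathcomp Require Import measurable_realfun ess_sup_inf.
From mathcomp Require Import (canonicals, coercions) mpoly.
From mathcomp Require Import ring lra zify.

Set Implicit Arguments.
Unset Strict Implicit.
Unset Printing Implicit Defensive.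
Import Order.TTheory GRing.Theory Num.Theory.
Import numFieldTopology.Exports numFieldNormedType.Exports.

Local Open Scope classical_set_scope.
Local Open Scope ring_scope.

(** * Image measures and densities *)

(** The surface measure is given by cones in R^(d+1), so every fact about it is read off from
    Lebesgue measure: invariance from involutive linear maps preserving the ball, and the slice
    formula from three elementary substitutions, without angles. Constants are not evaluated: total
    mass 1 yields both the integrability of [w_d], which is unbounded for [d = 1], and its
    normalization. One Householder reflection moves [x] to the pole, so only averages over the
    parallels of the pole are needed. They are polynomial by parity: odd powers of [sqrt (1 - t^2)]
    are killed by the symmetry [xi -> - xi] of directions.

    Likewise the dimension of [Pi_n^d] is never computed. Orthogonality makes integration against
    the normalized Jacobi polynomial a multiple of evaluation at 1, and the trace of the resulting
    kernel shows this multiple to be the reciprocal of the dimension.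

    The obstacle is [p = 1], where [psi] is the discontinuous sign function and the norm is not
    strictly convex. The first variation is therefore an inequality of tangents along [P + e r],
    followed by a limit off the finite zero set of [P]. *)

Section transfer.
Import HBNNSimple.
Local Open Scope ereal_scope.
Context d1 d2 (X : measurableType d1) (Y : measurableType d2) (R : realType).
Variables (mu : {measure set X -> \bar R}) (nu : {measure set Y -> \bar R}).
Variables (phi : X -> Y) (k : X -> R).
Hypothesis mphi : measurable_fun setT phi.
Hypothesis mk : measurable_fun setT k.
Hypothesis k_ge0 : forall x, (0 <= k x)%R.
Hypothesis nuE : forall A, measurable A ->
  nu A = \int[mu]_x ((\1_A (phi x))%:E * (k x)%:E).

Let nnsfun_transfer (h : {nnsfun Y >-> R}) :
  \int[nu]_y (h y)%:E = \int[mu]_x ((h (phi x))%:E * (k x)%:E).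
Proof.
under eq_integral do rewrite fimfunE -fsumEFin//.
rewrite ge0_integral_fsum//; last 2 first.
- by move=> r; exact/measurable_EFinP/measurable_funM.
- by move=> r y _; rewrite nnfun_muleindic_ge0.
under [RHS]eq_integral do
  (rewrite fimfunE -fsumEFin// ge0_mule_fsuml; last by move=> r; exact: nnfun_muleindic_ge0).
rewrite ge0_integral_fsum//; last 2 first.
- move=> r; apply: emeasurable_funM; last exact/measurable_EFinP.
  apply/measurable_EFinP/measurable_funM => //.
  by apply: (measurableT_comp _ mphi); exact: measurable_indic.
- by move=> r x _; rewrite mule_ge0 ?lee_fin// -lee_fin nnfun_muleindic_ge0.
apply: eq_fsbigr => r /set_mem[y _ <-]; rewrite integralZl_indic_nnsfun//.
rewrite integral_indic// setIT nuE//.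
under [RHS]eq_integral do rewrite EFinM -muleA.
rewrite ge0_integralZl ?lee_fin//.
- apply: emeasurable_funM; last exact/measurable_EFinP.
  apply/measurable_EFinP.
  by apply: (measurableT_comp _ mphi); exact: measurable_indic.
- by move=> x _; rewrite mule_ge0 ?lee_fin.
Qed.

(** One hypothesis covers image measures ([k = 1]), densities ([phi = id]) and their combination,
    which the slice formula needs. The proof passes from simple functions to the limit on both sides
    by monotone convergence. *)
Lemma ge0_integral_transfer (f : Y -> \bar R) :
  measurable_fun setT f -> (forall y, 0 <= f y) ->
  \int[nu]_y f y = \int[mu]_x (f (phi x) * (k x)%:E).
Proof.
move=> mf f0; pose f_ := nnsfun_approx measurableT mf.
transitivity (limn (fun n => \int[nu]_y (f_ n y)%:E)).
  rewrite -monotone_convergence//=.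
  - apply: eq_integral => y _; apply/esym/cvg_lim => //.
    exact: cvg_nnsfun_approx.
  - by move=> n; exact/measurable_EFinP.
  - by move=> n y _; rewrite lee_fin.
  - by move=> y _ m n mn; rewrite lee_fin; exact/lefP/nd_nnsfun_approx.
under eq_fun do rewrite nnsfun_transfer.
rewrite -monotone_convergence//=.
- apply: eq_integral => x _; apply/cvg_lim => //.
  apply: cvgeZr => //; exact: cvg_nnsfun_approx.
- move=> n; apply: emeasurable_funM; last exact/measurable_EFinP.
  by apply/measurable_EFinP; exact: measurableT_comp.
- by move=> n x _; rewrite mule_ge0 ?lee_fin.
- move=> x _ m n mn; rewrite lee_wpmul2r ?lee_fin//.
  exact/lefP/nd_nnsfun_approx.
Qed.

(** Multiplication by the nonnegative [k] commutes with positive and negative parts, so both sides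
    split in the same way and integrability need not be assumed. *)
Lemma integral_transfer (f : Y -> \bar R) : measurable_fun setT f ->
  \int[nu]_y f y = \int[mu]_x (f (phi x) * (k x)%:E).
Proof.
move=> mf; rewrite integralE [RHS]integralE; congr (_ - _).
  rewrite ge0_integral_transfer//; last exact: measurable_funepos.
  apply: eq_integral => x _; rewrite !funeposE maxe_pMl ?mul0e//.
  by rewrite lee_fin.
rewrite ge0_integral_transfer//; last exact: measurable_funeneg.
apply: eq_integral => x _; rewrite !funenegE maxe_pMl ?mul0e ?mulNe//.
by rewrite lee_fin.
Qed.

End transfer.

Section pullback.
Local Open Scope ereal_scope.
Context d1 d2 (X : measurableType d1) (Y : measurableType d2) (R : realType).
Variables (mu : {measure set X -> \bar R}) (nu : {measure set Y -> \bar R}).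
Variable phi : X -> Y.
Hypothesis mphi : measurable_fun setT phi.
Hypothesis nuE : forall A, measurable A -> nu A = mu (phi @^-1` A).

Lemma integral_pullback (f : Y -> \bar R) : measurable_fun setT f ->
  \int[nu]_y f y = \int[mu]_x f (phi x).
Proof.
move=> mf; rewrite (@integral_transfer _ _ _ _ _ mu nu phi (cst 1%R))//.
  by apply: eq_integral => x _; rewrite mule1.
move=> A mA; rewrite nuE//.
under eq_integral do rewrite mule1.
have mpA : measurable (phi @^-1` A) by rewrite -[X in measurable X]setTI; exact: mphi.
by rewrite -[in LHS](setIT (phi @^-1` A)) -integral_indic.
Qed.

(** For [q = +oo] the norm is an infimum over the levels whose superlevel set is null, and preimages
    have the same measure. *)
Lemma Lnorm_pullback (q : \bar R) (f : Y -> R) : measurable_fun setT f ->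
  q != -oo -> 'N[nu]_q[EFin \o f] = 'N[mu]_q[EFin \o (f \o phi)].
Proof.
move=> mf; have mf' : measurable_fun setT (EFin \o f) by exact/measurable_EFinP.
rewrite unlock; case: q => [r| |]//= _.
  congr (_ `^ _); rewrite (@integral_pullback (fun y => `|(f y)%:E| `^ r)%E)//.
  apply: (@measurableT_comp _ _ _ _ _ _ (fun x : \bar R => x `^ r)).
    exact: measurable_poweR.
  exact: measurableT_comp.
rewrite nuE//= preimage_setT; case: ifPn => // _.
have ma : measurable_fun setT (abse \o (EFin \o f)) by exact: measurableT_comp.
rewrite !ess_supEmu0//; last exact: (measurableT_comp ma).
congr ereal_inf; apply/seteqP; split => y /=.
- rewrite nuE// -[X in measurable X]setTI; apply: ma => //.
  exact: emeasurable_itv.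
- rewrite nuE// -[X in measurable X]setTI; apply: ma => //.
  exact: emeasurable_itv.
Qed.

End pullback.

(** * Invariance of the Lebesgue measure *)

Section affine.
Context {R : realType}.
Local Notation leb := (@lebesgue_measure R).

(** Uniqueness of Lebesgue measure, tested on intervals ]x, y]. A positive slope pulls these back to
    intervals of the same type; a negative one would exchange the open and the closed end, hence the
    separate treatment of signs. *)
Let affine_pos (a b : R)
    (mf : measurable_fun setT
      ((fun x => a * x + b) : measurableTypeR R -> measurableTypeR R)) (A : set R) :
  0 < a -> measurable A ->
  leb A = (a%:E * leb ((fun x => a * x + b)%R @^-1` A))%E.
Proof.
move=> a0 mA.
pose m : {measure set (measurableTypeR R) -> \bar R} :=
  mscale (NngNum (ltW a0))
    (measure_function_pushforward__canonical__measure_function_Measure leb mf).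
rewrite (@lebesgue_measure_unique R m)//= => _ [[x y]] _ <-.
rewrite /m /mscale/= /pushforward.
rewrite (_ : _ @^-1` _ = `](x - b) / a, (y - b) / a]%classic).
  rewrite !lebesgue_measure_itv/= !lte_fin ltr_pM2r ?invr_gt0// ltrD2r.
  case: ifPn => _; last by rewrite mule0.
  rewrite -!EFinB -EFinM; congr EFin; field; exact: lt0r_neq0.
apply/seteqP; split => z /=; rewrite !in_itv/= ltr_pdivrMr// ler_pdivlMr//;
  rewrite ltrBlDr lerBrDr (mulrC z)//.
Qed.

Lemma lebesgue_measure_affine (a b : R) (A : set R) : a != 0 -> measurable A ->
  leb A = (`|a|%:E * leb ((fun x => a * x + b)%R @^-1` A))%E.
Proof.
have maff (c e : R) : measurable_fun setT (fun x : R => c * x + e).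
  by apply: measurable_funD => //; exact: measurable_funM.
rewrite neq_lt => /orP[a0|a0] mA; last by rewrite gtr0_norm//; exact: (affine_pos (maff a b)).
rewrite ltr0_norm// (affine_pos (maff (- a) b))// ?oppr_gt0//; congr (_ * _)%E.
rewrite -[LHS]lebesgue_measureN /pushforward.
  by congr (leb _); apply/seteqP; split => x /=; rewrite mulrN mulNr opprK.
by rewrite -[X in measurable X]setTI; exact: maff.
Qed.

Lemma ge0_integral_affine (a b : R) (f : R -> \bar R) : a != 0 ->
  measurable_fun setT f -> (forall x, 0 <= f x)%E ->
  (\int[leb]_x (f (a * x + b)%R * `|a|%:E) = \int[leb]_x f x)%E.
Proof.
move=> a0 mf f0.
have maff : measurable_fun setT (fun x : R => a * x + b).
  by apply: measurable_funD => //; exact: measurable_funM.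
rewrite [RHS](@ge0_integral_transfer _ _ _ _ _ leb leb (fun x => a * x + b) (cst `|a|))//.
move=> A mA; transitivity (`|a|%:E * leb ((fun x => a * x + b)%R @^-1` A))%E.
  exact: lebesgue_measure_affine.
rewrite /cst ge0_integralZr//; last first.
  by apply/measurable_EFinP; apply: (measurableT_comp _ maff); exact: measurable_indic.
have mpA : measurable ((fun x => a * x + b) @^-1` A).
  by rewrite -[X in measurable X]setTI; exact: maff.
have -> := @integral_indic _ _ _ leb setT measurableT _ mpA.
by rewrite setIT muleC.
Qed.

End affine.

(** * Affine substitutions in R^n *)

Section lebesgue_tuple_theory.
Context {R : realType}.
Local Notation leb := (@lebesgue_measure R).
Local Notation L := (@lebesgue_tuple R).

Lemma lebesgue_tupleS n (A : set (n.+1.-tuple R)) :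
  L n.+1 A = (leb \x L n)%E (@consT R n @^-1` A).
Proof. by []. Qed.

Lemma ge0_integral_lebesgue_tupleS n (f : n.+1.-tuple R -> \bar R) :
  measurable_fun setT f -> (forall x, 0 <= f x)%E ->
  (\int[L n.+1]_z f z = \int[leb]_x \int[L n]_y f (consT (x, y)))%E.
Proof.
move=> mf f0.
rewrite (@integral_pullback _ _ _ _ _ (leb \x L n)%E (L n.+1) (@consT R n) (@measurable_consT R n))//.
rewrite fubini_tonelli1//.
exact: (measurableT_comp mf (@measurable_consT R n)).
Qed.

Definition tcomb n (a : R) (u : n.-tuple R) (b : R) (v : n.-tuple R) :=
  [tuple a * tnth u i + b * tnth v i | i < n].

Lemma tnth_tcomb n a u b v i :
  tnth (@tcomb n a u b v) i = a * tnth u i + b * tnth v i.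
Proof. exact: tnth_mktuple. Qed.

Lemma measurable_tcomb d (T : measurableType d) n a b (f g : T -> n.-tuple R) :
  measurable_fun setT f -> measurable_fun setT g ->
  measurable_fun setT (fun x => tcomb a (f x) b (g x)).
Proof.
move=> mf mg; apply/measurable_fun_tnthP => i.
rewrite (_ : _ \o _ = fun x => a * tnth (f x) i + b * tnth (g x) i); last first.
  by apply/funext => x /=; rewrite tnth_tcomb.
by apply: measurable_funD; apply: measurable_funM => //;
  apply: (measurableT_comp (measurable_tnth _)).
Qed.

Lemma tcomb_consT n a u b x (v : n.-tuple R) :
  tcomb a u b (consT (x, v)) =
  consT (b * x + a * thead u, tcomb a [tuple of behead u] b v).
Proof.
apply: eq_from_tnth => i; rewrite tnth_tcomb; case: (unliftP ord0 i) => [j|] ->.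
  rewrite !tnthS tnth_tcomb; congr (_ * _ + _).
  by rewrite (tuple_eta u) tnthS; congr tnth; apply: val_inj.
by rewrite !tnth0 addrC.
Qed.

(** Induction on the dimension by Tonelli, each coordinate contributing one factor [|c|].
    Translation, scaling and the point reflection [c = -1] are treated together because the
    invariance argument below uses translations combined with [c = -1]. *)
Lemma ge0_integral_tcomb n (a : R) u (c : R) (f : n.-tuple R -> \bar R) : c != 0 ->
  measurable_fun setT f -> (forall x, 0 <= f x)%E ->
  (\int[L n]_z (f (tcomb a u c z) * (`|c| ^+ n)%:E) = \int[L n]_z f z)%E.
Proof.
move=> c0; elim: n u f => [u f mf f0|n IH u f mf f0].
  apply: eq_integral => z _; rewrite expr0 mule1; congr f.
  by rewrite [LHS]tuple0 [RHS]tuple0.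
have mcons := @measurable_consT R n.
rewrite [RHS](ge0_integral_lebesgue_tupleS mf f0) ge0_integral_lebesgue_tupleS; first last.
- by move=> z; rewrite mule_ge0// lee_fin exprn_ge0.
- apply: emeasurable_funM => //; apply: (measurableT_comp mf).
  exact: measurable_tcomb.
rewrite -[RHS](@ge0_integral_affine _ c (a * thead u))//; last 2 first.
- apply: (measurable_fun_fubini_tonelli_F (f \o @consT R n)) => //.
  exact: measurableT_comp.
  by move=> x; exact: f0.
- by move=> x; exact: integral_ge0.
apply: eq_integral => x _.
under eq_integral do rewrite tcomb_consT exprSr EFinM muleA.
have mfc y : measurable_fun setT (fun z : n.-tuple R => f (consT (y, z))).
  apply: (measurableT_comp mf); apply: (measurableT_comp mcons).
  exact: pair1_measurable.
rewrite ge0_integralZr ?lee_fin//; last 2 first.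
- apply: emeasurable_funM => //; apply: (measurableT_comp (mfc _)).
  exact: measurable_tcomb.
- by move=> z _; rewrite mule_ge0// lee_fin exprn_ge0.
by congr (_ * _)%E; rewrite (IH _ (fun z => f (consT (_, z)))).
Qed.

Lemma ge0_integral_scale n c (f : n.-tuple R -> \bar R) : 0 < c ->
  measurable_fun setT f -> (forall x, 0 <= f x)%E ->
  (\int[L n]_z (f [tuple (c * tnth z i)%R | i < n] * (c ^+ n)%:E) = \int[L n]_z f z)%E.
Proof.
move=> c0 mf f0; rewrite -[RHS](@ge0_integral_tcomb n 0 [tuple 0 | i < n] c)//.
  rewrite gtr0_norm//; apply: eq_integral => z _; congr (f _ * _)%E.
  by apply: eq_from_tnth => i; rewrite tnth_tcomb !tnth_mktuple mul0r add0r.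
exact: lt0r_neq0.
Qed.

End lebesgue_tuple_theory.

(** * Linear involutions preserving the unit ball *)

Section invariance.
Context {R : realType}.
Local Notation leb := (@lebesgue_measure R).
Local Notation L := (@lebesgue_tuple R).

Definition cube n (r : R) : set (n.-tuple R) := [set x | forall i, `|tnth x i| <= r].

Lemma measurable_cube n r : measurable (@cube n r).
Proof.
rewrite (_ : @cube n r = \bigcap_(i in [set: 'I_n]) ((fun x => `|tnth x i|) @^-1` `]-oo, r])).
  apply: fin_bigcap_measurable => // i _; rewrite -[X in measurable X]setTI.
  apply: (measurableT_comp (@normr_measurable R setT)) => //.
  exact: measurable_tnth.
apply/seteqP; split => x /=; first by move=> xr i _ /=; rewrite in_itv/= xr.
by move=> xr i; have := xr i I; rewrite /= in_itv.
Qed.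

Lemma lebesgue_tuple_cube n (r : R) : 0 <= r -> L n (cube r) = ((2 * r) ^+ n)%:E.
Proof.
move=> r0; have lebr : leb `[- r, r]%classic = (2 * r)%:E.
  rewrite lebesgue_measure_itv/= lte_fin; case: ifPn => [_|].
    by rewrite -EFinB; congr EFin; ring.
  by rewrite -leNgt => rr; congr EFin; lra.
elim: n => [|n IH].
  rewrite expr0 /= diracE mem_set//= => i; by case: i.
rewrite lebesgue_tupleS (_ : _ @^-1` _ = `[- r, r]%classic `*` @cube n r).
  rewrite product_measure1E//; last exact: measurable_cube.
  by rewrite [X in (X * _)%E]lebr [X in (_ * X)%E]IH -EFinM exprS.
apply/seteqP; split => [[x y]/= xy|[x y] [/= xr yr] i].
  split; first by have := xy ord0; rewrite tnth0 /= in_itv/= ler_norml.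
  by move=> i; have := xy (lift ord0 i); rewrite tnthS.
case: (unliftP ord0 i) => [j|] ->; rewrite ?tnth0 ?tnthS//.
by move: xr; rewrite in_itv/= ler_norml.
Qed.

Lemma unit_ball_sub_cube n : @unit_ball R n `<=` cube 1.
Proof.
move=> x /=; rewrite /unit_ball /enorm /= => x1 i.
have x1' : \sum_(i < n) tnth x i ^+ 2 <= 1.
  rewrite -[leLHS]sqr_sqrtr; last by apply: sumr_ge0 => j _; exact: sqr_ge0.
  by rewrite -[leRHS](expr1n _ 2) ler_pXn2r ?nnegrE ?sqrtr_ge0.
rewrite -(@ler_pXn2r _ 2)// ?nnegrE// expr1n real_normK ?num_real//.
apply: le_trans x1'; rewrite (bigD1 i)//= lerDl.
by apply: sumr_ge0 => j _; exact: sqr_ge0.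
Qed.

(** Each of the [n] squares is at most [n.+1%:R^-1]. Using [n.+1] instead of [n] keeps the cube
    nondegenerate for [n = 0]. *)
Lemma cube_sub_unit_ball n : cube (n.+1%:R^-1) `<=` @unit_ball R n.
Proof.
move=> x xn; rewrite /unit_ball/= /enorm -[leRHS]sqrtr1.
rewrite ler_sqrt//; apply: (@le_trans _ _ (\sum_(i < n) n.+1%:R^-1)).
  apply: ler_sum => i _; rewrite -real_normK ?num_real//.
  apply: (@le_trans _ _ (n.+1%:R^-1 ^+ 2)).
    by rewrite ler_pXn2r ?nnegrE//; exact: xn.
  rewrite expr2 ler_piMl ?invr_ge0// invf_le1 ?ltr0n// ler1n//.
rewrite sumr_const card_ord -[leLHS]mulr_natr mulrC ler_pdivrMr ?ltr0n// mul1r ler_nat.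
exact: leqnSn.
Qed.

Lemma lebesgue_unit_ball_lty n : (L n (@unit_ball R n) < +oo)%E.
Proof.
apply: (@le_lt_trans _ _ (L n (cube 1))).
  apply: le_measure; rewrite ?inE; [exact: measurable_unit_ball|exact: measurable_cube|].
  exact: unit_ball_sub_cube.
by rewrite lebesgue_tuple_cube// ltry.
Qed.

Lemma lebesgue_unit_ball_gt0 n : (0 < L n (@unit_ball R n))%E.
Proof.
apply: (@lt_le_trans _ _ (L n (@cube n n.+1%:R^-1))).
  by rewrite lebesgue_tuple_cube// lte_fin exprn_gt0// mulr_gt0// invr_gt0 ltr0n.
apply: le_measure; rewrite ?inE; [exact: measurable_cube|exact: measurable_unit_ball|].
exact: cube_sub_unit_ball.
Qed.

(* Evaluating [\int \int 1_A(O x + y) 1_B(y) dy dx] in both orders gives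
   [L (O^-1 A) L B = L A L B]. *)
Lemma lebesgue_tuple_invariant n (O : n.-tuple R -> n.-tuple R) (A : set (n.-tuple R)) :
  measurable_fun setT O -> involutive O ->
  (forall a u b v, O (tcomb a u b v) = tcomb a (O u) b (O v)) ->
  O @^-1` (@unit_ball R n) = @unit_ball R n -> measurable A ->
  L n (O @^-1` A) = L n A.
Proof.
move=> mO OK Olin OB mA; set B := @unit_ball R n.
have mB : measurable B by exact: measurable_unit_ball.
have L0 : (0 < L n B)%E := lebesgue_unit_ball_gt0 n.
have Loo : (L n B < +oo)%E := lebesgue_unit_ball_lty n.
pose F (z : n.-tuple R * n.-tuple R) : \bar R :=
  ((\1_A (tcomb 1 (O z.1) 1 z.2))%:E * (\1_B z.2)%:E)%E.
have mind (C : set (n.-tuple R)) d (T : measurableType d) (f : T -> n.-tuple R) :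
    measurable C -> measurable_fun setT f -> measurable_fun setT (fun x => (\1_C (f x))%:E : \bar R).
  move=> mC mf; apply/measurable_EFinP; apply: (measurableT_comp _ mf).
  exact: measurable_indic.
have mO1 : measurable_fun setT (fun z : n.-tuple R * n.-tuple R => O z.1).
  exact: measurableT_comp.
have mO2 : measurable_fun setT (fun z : n.-tuple R * n.-tuple R => O z.2).
  exact: measurableT_comp.
have mF : measurable_fun setT F.
  apply: emeasurable_funM; last exact: mind.
  by apply: mind => //; exact: measurable_tcomb.
have F0 z : (0 <= F z)%E by rewrite mule_ge0// lee_fin.
have mOA : measurable (O @^-1` A) by rewrite -[X in measurable X]setTI; exact: mO.
have ind_int (C : set (n.-tuple R)) : measurable C -> (\int[L n]_x (\1_C x)%:E = L n C)%E.
  by move=> mC; rewrite integral_indic// setIT.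
have I1 : (\int[L n]_x \int[L n]_y F (x, y) = L n (O @^-1` A) * L n B)%E.
  rewrite fubini_tonelli// -(ind_int B)//.
  rewrite -ge0_integralZl//; last by apply: mind.
  apply: eq_integral => y _; rewrite /F/= ge0_integralZr//; last first.
    by apply: mind => //; apply: measurable_tcomb.
  congr (_ * _)%E.
  under eq_integral => x _.
    rewrite (_ : (\1_A _)%:E = (\1_(O @^-1` A) (tcomb 1 (O y) 1 x))%:E * (`|1| ^+ n)%:E)%E; last first.
      rewrite normr1 expr1n mule1 !indicE; congr ((nat_of_bool _)%:R%:E); apply/idP/idP;
        rewrite !inE/= Olin OK;
        rewrite (_ : tcomb 1 (O x) 1 y = tcomb 1 y 1 (O x))//;
        by apply: eq_from_tnth => i; rewrite !tnth_tcomb addrC.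
    over.
  rewrite (@ge0_integral_tcomb _ n 1 (O y) 1 (fun z => (\1_(O @^-1` A) z)%:E))//.
  - exact: ind_int.
  - exact: mind.
have I2 : (\int[L n]_x \int[L n]_y F (x, y) = L n A * L n B)%E.
  (* The translation of [y] by [O x] turns [G] into [F]: it frees the argument of [1_A] and moves
     [O x] into the indicator of the ball. *)
  pose G (z : n.-tuple R * n.-tuple R) : \bar R :=
    ((\1_A z.2)%:E * (\1_B (tcomb 1 z.2 (-1) (O z.1)))%:E)%E.
  have mG : measurable_fun setT G.
    apply: emeasurable_funM; first exact: mind.
    by apply: mind => //; exact: measurable_tcomb.
  have G0 z : (0 <= G z)%E by rewrite mule_ge0// lee_fin.
  transitivity (\int[L n]_x \int[L n]_y G (x, y))%E.
    apply: eq_integral => x _.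
    rewrite -[RHS](@ge0_integral_tcomb _ n 1 (O x) 1)//.
    - apply: eq_integral => y _; rewrite normr1 expr1n mule1 /F /G/=.
      congr (_ * (\1_B _)%:E)%E.
      by apply: eq_from_tnth => i; rewrite !tnth_tcomb; ring.
    - by apply: (measurableT_comp mG); exact: pair1_measurable.
  rewrite fubini_tonelli// -(ind_int A)//.
  rewrite -ge0_integralZr//; last by apply: mind.
  apply: eq_integral => y _; rewrite /G/= ge0_integralZl//; last first.
    by apply: mind => //; exact: measurable_tcomb.
  congr (_ * _)%E.
  (* The ball is invariant under [O], so [y - O x] may be replaced by its image [O y - x], which is
     affine in [x] with slope -1. *)
  under eq_integral => x _.
    rewrite (_ : (\1_B _)%:E = (\1_B (tcomb 1 (O y) (-1) x))%:E * (`|-1| ^+ n)%:E)%E; last first.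
      rewrite normrN normr1 expr1n mule1 !indicE; congr ((nat_of_bool _)%:R%:E).
      apply/idP/idP; rewrite !inE/=.
        by rewrite -[X in X _ -> _]OB /= Olin OK.
      by rewrite -[X in X _ -> _]OB /= Olin OK.
    over.
  rewrite (@ge0_integral_tcomb _ n 1 (O y) (-1) (fun z => (\1_B z)%:E))//.
  - exact: ind_int.
  - exact: mind.
move: I1; rewrite I2; rewrite -(@fineK _ (L n B)) ?ge0_fin_numE//.
move=> /(congr1 (fun x => x * ((fine (L n B))^-1)%:E))%E.
have fB : (fine (L n B) != 0)%R by rewrite gt_eqF// fine_gt0// L0 Loo.
by rewrite -!muleA -EFinM divff// !mule1.
Qed.

End invariance.

(** * A stereographic substitution *)

Section calculus.
Context {R : realType}.
Local Notation leb := (@lebesgue_measure R).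

Lemma integral_derive (F f : R -> R) (a b : R) : a < b ->
  {in `[a, b], forall x, is_derive (x : R) (1 : R) F (f x)} ->
  {in `[a, b], forall x : R, {for x, continuous f}} ->
  (\int[leb]_(x in `[a, b]) (f x)%:E = (F b - F a)%:E)%E.
Proof.
move=> ab dF cf.
have cF : {in `[a, b], continuous F}.
  move=> x xab; apply: differentiable_continuous; apply/derivable1_diffP.
  by have [] := dF x xab.
rewrite (@continuous_FTC2 _ f F)//.
- by apply: continuous_in_subspaceT => x /set_mem; exact: cf.
- split.
  + by move=> x xab; have [] := dF x (subset_itv_oo_cc xab).
  + by apply: cvg_at_right_filter; apply: cF; rewrite in_itv/= lexx ltW.
  + by apply: cvg_at_left_filter; apply: cF; rewrite in_itv/= lexx ltW.
- move=> x xab; rewrite derive1E; apply: derive_val.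
  exact: dF (subset_itv_oo_cc xab).
Qed.

(** The ratio of height to horizontal radius for a point at height [t] of the unit sphere; the
    inverse map is [a / sqrt (1 + a^2)]. *)
Definition stereo (t : R) := t / Num.sqrt (1 - t ^+ 2).

Lemma is_derive_sqrt1B (t : R) : -1 < t < 1 ->
  is_derive t 1 (fun x : R => Num.sqrt (1 - x ^+ 2)) (- t / Num.sqrt (1 - t ^+ 2)).
Proof.
move=> t1; have v0 : 0 < 1 - t ^+ 2 by nra.
have s0 : Num.sqrt (1 - t ^+ 2) != 0 by rewrite sqrtr_eq0 -ltNge.
have ds := is_derive1_sqrt v0.
have dv : is_derive t 1 (fun x : R => 1 - x ^+ 2) (- (2 * t)).
  by apply: is_derive_eq; rewrite /GRing.scale/=; ring.
have := @is_derive1_comp _ Num.sqrt (fun x : R => 1 - x ^+ 2) t _ _ ds dv.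
by move=> h; apply: (is_derive_eq h); field; exact: s0.
Qed.

Lemma is_derive_stereo (t : R) : -1 < t < 1 ->
  is_derive t 1 stereo ((Num.sqrt (1 - t ^+ 2))^-1 ^+ 3).
Proof.
move=> t1; have v0 : 0 < 1 - t ^+ 2 by nra.
have s0 : Num.sqrt (1 - t ^+ 2) != 0 by rewrite sqrtr_eq0 -ltNge.
have dc := is_derive_sqrt1B t1.
have dV : is_derive t 1 (fun x : R => (Num.sqrt (1 - x ^+ 2))^-1) (t * (Num.sqrt (1 - t ^+ 2))^-1 ^+ 3).
  have h := @is_deriveV _ (fun x : R => Num.sqrt (1 - x ^+ 2)) t _ 1 s0 dc.
  apply: (is_derive_eq h); rewrite /GRing.scale/=; field; exact: s0.
have h := @is_deriveM _ _ _ _ _ _ _ _ (is_derive_id t 1) dV.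
apply: (is_derive_eq h); rewrite /GRing.scale/=.
have s2 : Num.sqrt (1 - t ^+ 2) ^+ 2 = 1 - t ^+ 2 by rewrite sqr_sqrtr// ltW.
have -> : (t * (t * (Num.sqrt (1 - t ^+ 2))^-1 ^+ 3)) + (Num.sqrt (1 - t ^+ 2))^-1 * 1 =
  (t ^+ 2 + Num.sqrt (1 - t ^+ 2) ^+ 2) * (Num.sqrt (1 - t ^+ 2))^-1 ^+ 3.
  by field; exact: s0.
by rewrite s2; ring.
Qed.

End calculus.

Section stereo_substitution.
Context {R : realType}.
Local Notation leb := (@lebesgue_measure R).

(** Monotonicity and the inverse in one statement, in the form that computes preimages of
    half-lines. *)
Lemma stereo_gt (a t : R) : -1 < t < 1 ->
  (a < stereo t) = (a / Num.sqrt (1 + a ^+ 2) < t).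
Proof.
move=> t1; have v0 : 0 < 1 - t ^+ 2 by nra.
have s0 : 0 < Num.sqrt (1 - t ^+ 2) by rewrite sqrtr_gt0.
have w0 : 0 < 1 + a ^+ 2 by nra.
have c0 : 0 < Num.sqrt (1 + a ^+ 2) by rewrite sqrtr_gt0.
have := sqr_sqrtr (ltW v0); have := sqr_sqrtr (ltW w0).
rewrite /stereo ltr_pdivlMr//.
set c := Num.sqrt (1 + _) in c0 *; set s := Num.sqrt (1 - _) in s0 * => c2 s2.
(* After clearing denominators the claim compares [a * s < t] with [a < t * c]; the two differences
   of squares agree, and only the signs remain to be sorted out. *)
have E : a ^+ 2 - (t * c) ^+ 2 = (a * s) ^+ 2 - t ^+ 2.
  by rewrite !exprMn c2 s2; ring.
have lt_sqr (x y : R) : 0 <= x -> 0 <= y -> (x < y) = (x ^+ 2 < y ^+ 2).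
  by move=> x0 y0; rewrite ltr_pXn2r// nnegrE.
have [a0|a0] := ltP a 0; have [t0|t0] := ltP t 0.
- have tc0 : t * c < 0 by rewrite nmulr_rlt0.
  have as0 : a * s < 0 by rewrite nmulr_rlt0.
  have N (x y : R) : x < 0 -> y < 0 -> (x < y) = (y ^+ 2 < x ^+ 2).
    by move=> x0 y0; rewrite -[LHS]ltrN2 [LHS]lt_sqr ?sqrrN// oppr_ge0 ltW.
  by rewrite ltr_pdivrMr// [LHS]N// [RHS]N//; apply/idP/idP => h; lra.
- have as0 : a * s < 0 by rewrite nmulr_rlt0.
  have tc0 : 0 <= t * c by rewrite mulr_ge0// ltW.
  by rewrite ltr_pdivrMr// !(lt_le_trans _ t0)// (lt_le_trans a0 tc0).
- have tc0 : t * c < 0 by rewrite nmulr_rlt0.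
  have as0 : 0 <= a * s by rewrite mulr_ge0// ltW.
  by rewrite ltr_pdivrMr//; apply/idP/idP => h; lra.
- have as0 : 0 <= a * s by rewrite mulr_ge0// ltW.
  have tc0 : 0 <= t * c by rewrite mulr_ge0// ltW.
  rewrite ltr_pdivrMr// [LHS]lt_sqr// [RHS]lt_sqr//.
  by apply/idP/idP => h; lra.
Qed.

Definition dstereo (t : R) := (Num.sqrt (1 - t ^+ 2))^-1 ^+ 3.

Lemma dstereo_ge0 t : 0 <= dstereo t.
Proof. by rewrite exprn_ge0// invr_ge0 sqrtr_ge0. Qed.

Let measurable_isqrt : measurable_fun setT (fun t : R => (Num.sqrt (1 - t ^+ 2))^-1).
Proof.
rewrite (_ : (fun t => _) = fun t => (Num.sqrt (1 - t ^+ 2)) `^ (-1)); last first.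
  by apply/funext => t; rewrite powR_inv1// sqrtr_ge0.
apply: (measurableT_comp (measurable_powR (-1))).
apply: (@measurableT_comp _ _ _ _ _ _ (@Num.sqrt R)).
  by apply: continuous_measurable_fun; exact: sqrt_continuous.
by apply: measurable_funB => //; exact: measurable_funX.
Qed.

Lemma measurable_stereo : measurable_fun setT (@stereo R).
Proof. by apply: measurable_funM => //. Qed.

Lemma measurable_dstereo : measurable_fun setT dstereo.
Proof. exact: measurable_funX. Qed.

(** The root of a nonpositive number is 0 and so is its inverse. These default values make [dstereo]
    vanish off ]-1, 1[, so integrals over the whole line need no restriction. *)
Lemma dstereo_out t : ~~ (-1 < t < 1) -> dstereo t = 0.
Proof.
move=> t1; rewrite /dstereo ler0_sqrtr ?invr0 ?expr0n//.
by rewrite subr_le0; move: t1; rewrite negb_and -!leNgt => /orP[] t1; nra.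
Qed.

Lemma continuous_dstereo t : -1 < t < 1 -> {for t, continuous dstereo}.
Proof.
move=> t1; have v0 : 0 < 1 - t ^+ 2 by nra.
rewrite /dstereo; apply: (@cvg_comp _ _ _ (fun x => (Num.sqrt (1 - x ^+ 2))^-1) (fun y => y ^+ 3));
  last exact: exprn_continuous.
apply: cvgV; first by rewrite sqrtr_eq0 -ltNge.
apply: (@cvg_comp _ _ _ (fun x : R => 1 - x ^+ 2)); last exact: sqrt_continuous.
by apply: cvgB; [exact: cvg_cst|exact: exprn_continuous].
Qed.

Let ratio_itv (a : R) : -1 < a / Num.sqrt (1 + a ^+ 2) < 1.
Proof.
have w0 : 0 < 1 + a ^+ 2 by nra.
have c0 : 0 < Num.sqrt (1 + a ^+ 2) by rewrite sqrtr_gt0.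
have := sqr_sqrtr (ltW w0); move: c0; set c := Num.sqrt _ => c0 c2.
rewrite ltr_pdivlMr// ltr_pdivrMr// mulN1r mul1r.
by apply/andP; split; nra.
Qed.

Let stereoK (a : R) : stereo (a / Num.sqrt (1 + a ^+ 2)) = a.
Proof.
have := ratio_itv a; set t := a / _ => t1; apply/eqP; rewrite eq_le.
rewrite !leNgt stereo_gt// ltxx/=.
have w0 : 0 < 1 + a ^+ 2 by nra.
have c0 : 0 < Num.sqrt (1 + a ^+ 2) by rewrite sqrtr_gt0.
have s1 : Num.sqrt (1 - t ^+ 2) = (Num.sqrt (1 + a ^+ 2))^-1.
  rewrite (_ : 1 - t ^+ 2 = (Num.sqrt (1 + a ^+ 2))^-1 ^+ 2); last first.
    rewrite /t exprMn exprVn sqr_sqrtr ?ltW//; field; exact: lt0r_neq0.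
  by rewrite sqrtr_sqr ger0_norm// invr_ge0 ltW.
by rewrite /stereo s1 invrK /t mulfVK ?ltxx// lt0r_neq0.
Qed.

(** By uniqueness it suffices to test ]a, b]. Its preimage within ]-1, 1[ is ]al, be], on which the
    fundamental theorem of calculus gives [stereo be - stereo al = b - a]. *)
Lemma lebesgue_measure_stereo (A : set R) : measurable A ->
  leb A = (\int[leb]_t ((\1_A (stereo t))%:E * (dstereo t)%:E))%E.
Proof.
move=> mA; have d0 t : t \in `[-1, 1] -> 0 <= dstereo t by move=> _; exact: dstereo_ge0.
pose m : {measure set R -> \bar R} := HB.pack (wintegral dstereo)
  (isMeasure.Build _ _ _ (wintegral dstereo) (wintegral0 dstereo) (wintegral_ge0 d0)
     (wintegral_sigma_additive measurable_dstereo d0)).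
have ms : measurable_fun setT ((@stereo R) : R -> measurableTypeR R).
  exact: measurable_stereo.
pose nu : {measure set (measurableTypeR R) -> \bar R} :=
  measure_function_pushforward__canonical__measure_function_Measure m ms.
have nuE (B : set R) : measurable B ->
    nu B = (\int[leb]_t ((\1_B (stereo t))%:E * (dstereo t)%:E))%E.
  move=> mB; rewrite /nu/= /pushforward /m/= /wintegral integral_mkcond.
  apply: eq_integral => t _; rewrite patchE indicE; case: ifPn => [/set_mem[/= Bt _]|].
    by rewrite mem_set// mul1e.
  move=> /negP h; have [Bt|] := boolP (_ \in B); last by rewrite mul0e.
  rewrite mul1e dstereo_out//; apply/negP => /andP[t1 t2]; apply: h.
  by rewrite inE; split; [exact: set_mem|rewrite /= in_itv/= !ltW].
transitivity (nu A); last exact: nuE.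
apply: lebesgue_measure_unique => //= _ [[a b]] _ <- /=.
rewrite lebesgue_measure_itv/= lte_fin; case: ifPn => ab; last first.
  by rewrite set_itv_ge ?bnd_simp//; exact/esym/(measure0 nu).
rewrite -[RHS]/(nu `]a, b]%classic) nuE//.
set al := a / Num.sqrt (1 + a ^+ 2); set be := b / Num.sqrt (1 + b ^+ 2).
have al1 : -1 < al < 1 := ratio_itv a.
have be1 : -1 < be < 1 := ratio_itv b.
have abe : al < be by rewrite -stereo_gt// /be stereoK.
transitivity (\int[leb]_(t in `[al, be]) (dstereo t)%:E)%E.
  rewrite (@integral_derive _ (@stereo R))//.
  - by rewrite !stereoK.
  - by move=> x; rewrite in_itv/= => /andP[x1 x2]; apply: is_derive_stereo; lra.
  - by move=> x; rewrite in_itv/= => /andP[x1 x2]; apply: continuous_dstereo; lra.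
rewrite -integral_itv_obnd_cbnd; last first.
  by apply/measurable_EFinP; apply: measurable_funTS; exact: measurable_dstereo.
rewrite integral_mkcond; apply: eq_integral => t _.
rewrite patchE indicE mem_setE in_itv/=.
have [t1|t1] := boolP (-1 < t < 1); last first.
  by rewrite dstereo_out// mule0; case: ifP.
have -> : (stereo t \in `]a, b]%classic) = (al < t <= be).
  by rewrite mem_setE in_itv/= stereo_gt// leNgt stereo_gt// -leNgt.
by case: ifP; rewrite ?mul1e ?mul0e.
Qed.

Lemma ge0_integral_stereo (f : R -> \bar R) :
  measurable_fun setT f -> (forall x, 0 <= f x)%E ->
  (\int[leb]_x f x = \int[leb]_t (f (stereo t) * (dstereo t)%:E))%E.
Proof.
move=> mf f0; apply: ge0_integral_transfer => //.
- exact: measurable_stereo.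
- exact: measurable_dstereo.
- exact: dstereo_ge0.
- exact: lebesgue_measure_stereo.
Qed.

End stereo_substitution.

(** * Householder reflections *)

Section householder.
Context {R : realType}.

Definition dot n (u v : n.-tuple R) := \sum_(i < n) tnth u i * tnth v i.

Lemma dotC n (u v : n.-tuple R) : dot u v = dot v u.
Proof. by apply: eq_bigr => i _; rewrite mulrC. Qed.

Lemma dot_tcombl n a b (u v w : n.-tuple R) :
  dot (tcomb a u b v) w = a * dot u w + b * dot v w.
Proof.
rewrite !mulr_sumr -big_split/=; apply: eq_bigr => i _.
by rewrite tnth_tcomb mulrDl !mulrA.
Qed.

Lemma dot_tcombr n a b (u v w : n.-tuple R) :
  dot w (tcomb a u b v) = a * dot w u + b * dot w v.
Proof. by rewrite dotC dot_tcombl !(dotC w). Qed.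

Lemma dot_ge0 n (u : n.-tuple R) : 0 <= dot u u.
Proof. by apply: sumr_ge0 => i _; rewrite -expr2 sqr_ge0. Qed.

Lemma dot_eq0 n (u : n.-tuple R) : dot u u = 0 -> forall i, tnth u i = 0.
Proof.
move=> /eqP; rewrite psumr_eq0 => [/allP u0 i|i _]; last by rewrite -expr2 sqr_ge0.
have := u0 i (mem_index_enum i); by rewrite /= mulf_eq0 orbb => /eqP.
Qed.

Lemma dot0 n (u : n.-tuple R) : dot u u = 0 -> forall v, dot v u = 0.
Proof.
by move=> /dot_eq0 u0 v; apply: big1 => i _; rewrite u0 mulr0.
Qed.

Lemma enormE n (u : n.-tuple R) : enorm u = Num.sqrt (dot u u).
Proof. by congr Num.sqrt; apply: eq_bigr => i _; rewrite expr2. Qed.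

Definition north n : n.+1.-tuple R := [tuple (i == ord0)%:R | i < n.+1].

Lemma tnth_north0 n : tnth (north n) ord0 = 1.
Proof. by rewrite tnth_mktuple eqxx. Qed.

Lemma dot_north n (u : n.+1.-tuple R) : dot u (north n) = tnth u ord0.
Proof.
rewrite /dot (bigD1 ord0)//= tnth_mktuple eqxx mulr1 big1 ?addr0// => i /negPf i0.
by rewrite tnth_mktuple i0 mulr0.
Qed.

Lemma sphere_dot d (x : d.+1.-tuple R) : sphere x <-> dot x x = 1.
Proof.
rewrite /sphere/= enormE; split => [x1|->]; last by rewrite sqrtr1.
by rewrite -[LHS]sqr_sqrtr ?dot_ge0// x1 expr1n.
Qed.

(* The reflection exchanging [x] and the north pole; the identity if they
   coincide, since then [dot v v = 0] and [_ / 0 = 0]. *)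
Definition house d (x y : d.+1.-tuple R) :=
  let v := tcomb 1 x (-1) (north d) in
  tcomb 1 y (- (2 * dot y v / dot v v)) v.

Section house_theory.
Variables (d : nat) (x : d.+1.-tuple R).
Let v := tcomb 1 x (-1) (north d).
Let k y := 2 * dot y v / dot v v.

Let houseE y : house x y = tcomb 1 y (- k y) v.
Proof. by []. Qed.

(** In this multiplied form the relation survives [v = 0], where both sides vanish; [houseK],
    [house_dot] and [house_tnth0] then need no case distinction. *)
Let kv y : k y * dot v v = 2 * dot y v.
Proof.
have [v0|v0] := eqVneq (dot v v) 0; last by rewrite /k mulfVK.
by rewrite v0 mulr0 (dot0 v0) mulr0.
Qed.

Lemma house_lin a u b w : house x (tcomb a u b w) = tcomb a (house x u) b (house x w).
Proof.
by rewrite !houseE /k; apply: eq_from_tnth => i; rewrite !tnth_tcomb dot_tcombl; ring.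
Qed.

Lemma houseK : involutive (house x).
Proof.
move=> y; rewrite [LHS]houseE; have -> : k (house x y) = - k y.
  rewrite {1}/k houseE dot_tcombl mul1r mulNr kv.
  have -> : 2 * (dot y v - 2 * dot y v) = - (2 * dot y v) by ring.
  by rewrite mulNr.
rewrite houseE; apply: eq_from_tnth => i; rewrite !tnth_tcomb; ring.
Qed.

Lemma house_dot y : dot (house x y) (house x y) = dot y y.
Proof.
rewrite houseE (dot_tcombl 1 (- k y) y v) (dot_tcombr 1 (- k y) y v y).
rewrite (dot_tcombr 1 (- k y) y v v) (dotC v y).
set a := dot y v; set b := dot v v.
have -> : 1 * (1 * dot y y + - k y * a) + - k y * (1 * a + - k y * b) =
  dot y y - 2 * k y * a + k y * (k y * b) by ring.
rewrite kv -/a; ring.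
Qed.

Lemma enorm_house y : enorm (house x y) = enorm y.
Proof. by rewrite !enormE house_dot. Qed.

(** The reflection is symmetric and sends the pole to [x]. This reduces functions of [dot x y] to
    functions of the height. *)
Lemma house_tnth0 y : sphere x -> tnth (house x y) ord0 = dot x y.
Proof.
move=> /sphere_dot x1; rewrite -dot_north houseE dot_tcombl.
have vv : dot v v = 2 - 2 * tnth x ord0.
  rewrite /v !(dot_tcombl, dot_tcombr) x1 (dotC (north d) x) !dot_north tnth_north0; ring.
have -> : dot v (north d) = - (dot v v / 2).
  by rewrite vv dot_tcombl !dot_north tnth_north0; field.
have -> : - k y * - (dot v v / 2) = k y * dot v v / 2 by ring.
by rewrite kv /v dot_tcombr (dotC y x); field.
Qed.

Lemma house_north : sphere x -> house x (north d) = x.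
Proof.
move=> xS; have /sphere_dot x1 := xS.
have vv : dot v v = 2 - 2 * tnth x ord0.
  rewrite /v !(dot_tcombl, dot_tcombr) x1 (dotC (north d) x) !dot_north tnth_north0; ring.
have nv : dot (north d) v = - (dot v v / 2).
  by rewrite vv dotC dot_tcombl !dot_north tnth_north0; field.
have [v0|v0] := eqVneq (dot v v) 0.
  apply: eq_from_tnth => i; have := dot_eq0 v0 i.
  rewrite houseE !tnth_tcomb => e; rewrite e; lra.
have k1 : k (north d) = -1 by rewrite /k nv; field.
by rewrite houseE k1; apply: eq_from_tnth => i; rewrite !tnth_tcomb; ring.
Qed.

Lemma measurable_house : measurable_fun setT (house x).
Proof.
apply/measurable_fun_tnthP => i.
rewrite (_ : _ \o _ =
  fun y => tnth y i - 2 * (\sum_(j < d.+1) tnth y j * tnth v j) / dot v v * tnth v i); last first.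
  by apply/funext => y /=; rewrite houseE tnth_tcomb mul1r mulNr.
apply: measurable_funB; first exact: measurable_tnth.
do 3 apply: measurable_funM => //.
apply: measurable_sum => j; apply: measurable_funM => //.
exact: measurable_tnth.
Qed.

End house_theory.

Lemma direction_house d (x y : d.+1.-tuple R) :
  direction (house x y) = house x (direction y).
Proof.
have E (z : d.+1.-tuple R) : direction z = tcomb (enorm z)^-1 z 0 z.
  by apply: eq_from_tnth => i; rewrite tnth_tcomb tnth_mktuple mul0r addr0 mulrC.
by rewrite !E enorm_house house_lin.
Qed.

Lemma surface_house d (x : d.+1.-tuple R) A : measurable A ->
  @surface R d (house x @^-1` A) = surface A.
Proof.
move=> mA; rewrite /surface; congr (_ * _)%E.
rewrite -[RHS](@lebesgue_tuple_invariant _ _ (house x)).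
- congr (lebesgue_tuple _ _); apply/seteqP; split => y /=;
    by rewrite /unit_ball/= enorm_house direction_house.
- exact: measurable_house.
- exact: houseK.
- exact: house_lin.
- by apply/seteqP; split => y; rewrite /unit_ball/= enorm_house.
- apply: measurableI; last exact: measurable_unit_ball.
  by rewrite -[X in measurable X]setTI; exact: measurable_direction.
Qed.

End householder.

(** * Slicing the unit ball and the sphere *)

Section polar.
Context {R : realType}.
Local Notation leb := (@lebesgue_measure R).
Local Notation L := (@lebesgue_tuple R).
Local Notation dir := (@direction R _).

Lemma enorm_ge0 n (x : n.-tuple R) : 0 <= enorm x.
Proof. exact: sqrtr_ge0. Qed.

Lemma sqr_enorm n (x : n.-tuple R) : enorm x ^+ 2 = \sum_(i < n) tnth x i ^+ 2.
Proof. by rewrite sqr_sqrtr// sumr_ge0// => i _; rewrite sqr_ge0. Qed.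

Lemma enorm_consT n s (y : n.-tuple R) :
  enorm (consT (s, y)) = Num.sqrt (s ^+ 2 + enorm y ^+ 2).
Proof.
rewrite sqr_enorm /enorm big_ord_recl tnth0; congr (Num.sqrt (_ + _)).
by apply: eq_bigr => i _; rewrite tnthS.
Qed.

Lemma enorm_scale n (c : R) (x : n.-tuple R) : 0 <= c ->
  enorm [tuple c * tnth x i | i < n] = c * enorm x.
Proof.
move=> c0; rewrite /enorm.
under eq_bigr do rewrite tnth_mktuple exprMn.
by rewrite -mulr_sumr sqrtrM ?sqr_ge0// sqrtr_sqr ger0_norm.
Qed.

Lemma direction_scale n (c : R) (x : n.-tuple R) : 0 < c ->
  dir [tuple c * tnth x i | i < n] = dir x.
Proof.
move=> c0; apply: eq_from_tnth => i; rewrite !tnth_mktuple enorm_scale ?ltW//.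
by rewrite -mulf_div divff ?mul1r// lt0r_neq0.
Qed.

Lemma enorm_eq0 n (x : n.-tuple R) : enorm x = 0 -> cube 0 x.
Proof.
rewrite enormE => /eqP; rewrite sqrtr_eq0 => x0 i.
by rewrite (@dot_eq0 _ _ x) ?normr0//; apply/eqP; rewrite eq_le x0 dot_ge0.
Qed.

Lemma measurable_enormV n : measurable_fun setT (fun x : n.-tuple R => (enorm x)^-1).
Proof.
rewrite (_ : (fun x => _) = fun x => enorm x `^ (-1)); last first.
  by apply/funext => x; rewrite (powR_inv1 (enorm_ge0 _)).
exact: (measurableT_comp (measurable_powR (-1)) (@measurable_enorm R n)).
Qed.

Variable d : nat.
Hypothesis d_gt0 : (0 < d)%N.
Variable F : R * d.-tuple R -> \bar R.
Hypothesis mF : measurable_fun setT F.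
Hypothesis F_ge0 : forall z, (0 <= F z)%E.

Let c (u : R) := (Num.sqrt (1 + u ^+ 2))^-1.

Let c_gt0 u : 0 < c u.
Proof. by rewrite invr_gt0 sqrtr_gt0; nra. Qed.

Let sqr_c u : c u ^+ 2 = (1 + u ^+ 2)^-1.
Proof. by rewrite exprVn sqr_sqrtr//; nra. Qed.

Let measurable_c : measurable_fun setT c.
Proof.
rewrite (_ : c = fun t => (Num.sqrt (1 + t ^+ 2)) `^ (-1)); last first.
  by apply/funext => t; rewrite powR_inv1// sqrtr_ge0.
apply: (measurableT_comp (measurable_powR (-1))).
apply: (@measurableT_comp _ _ _ _ _ _ (@Num.sqrt R)).
  by apply: continuous_measurable_fun; exact: sqrt_continuous.
by apply: measurable_funD => //; exact: measurable_funX.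
Qed.

(** The integrand in three systems of coordinates. Writing [s = |y| u] makes [s / |x|] depend on [u]
    alone and brings the Jacobian [|y|]. Then [y = c u * z] gives the cone point the norm [|z|], so
    the ball condition no longer involves [u]; this costs [c u ^+ d], and one more [c u] comes from
    [|y|]. *)
Let G1 (p : R * d.-tuple R) : \bar R :=
  (F ((p.1 / enorm (consT p))%R, dir p.2) * (\1_(@unit_ball R d.+1) (consT p))%:E)%E.
Let G2 (p : R * d.-tuple R) : \bar R :=
  (F ((p.1 * c p.1)%R, dir p.2) *
   (\1_(@unit_ball R d.+1) (consT ((enorm p.2 * p.1)%R, p.2)) * enorm p.2)%:E)%E.
Let G3 (p : R * d.-tuple R) : \bar R :=
  (F ((p.1 * c p.1)%R, dir p.2) *
   (\1_(@unit_ball R d) p.2 * enorm p.2 * c p.1 ^+ d.+1)%:E)%E.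

Let G2E u y : (G2 (u, y) = F (u * c u, dir y)%R *
  (\1_(@unit_ball R d.+1) (consT (enorm y * u, y)%R) * enorm y)%:E)%E.
Proof. by []. Qed.

Let G3E u y : (G3 (u, y) = F (u * c u, dir y)%R *
  (\1_(@unit_ball R d) y * enorm y * c u ^+ d.+1)%:E)%E.
Proof. by []. Qed.

Let measurable_ind_ball n e (T : measurableType e) (f : T -> n.-tuple R) :
  measurable_fun setT f ->
  measurable_fun setT (fun p => \1_(@unit_ball R n) (f p) : R).
Proof.
move=> mf; apply: (measurableT_comp _ mf); apply: measurable_indic.
exact: measurable_unit_ball.
Qed.

Let measurable_dir2 : measurable_fun setT (fun p : R * d.-tuple R => dir p.2).
Proof. exact: (measurableT_comp (@measurable_direction R d)). Qed.

Let measurable_enorm2 : measurable_fun setT (fun p : R * d.-tuple R => enorm p.2).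
Proof. exact: (measurableT_comp (@measurable_enorm R d)). Qed.

Let measurable_c1 : measurable_fun setT (fun p : R * d.-tuple R => c p.1).
Proof. exact: (measurableT_comp measurable_c). Qed.

Let mG1 : measurable_fun setT G1.
Proof.
apply: emeasurable_funM; last first.
  by apply/measurable_EFinP/measurable_ind_ball; exact: measurable_consT.
apply: (measurableT_comp mF); apply: measurable_fun_pair => //.
apply: measurable_funM => //.
exact: (measurableT_comp (@measurable_enormV d.+1) (@measurable_consT R d)).
Qed.

Let mFc : measurable_fun setT (fun p : R * d.-tuple R => F ((p.1 * c p.1)%R, dir p.2)).
Proof.
apply: (measurableT_comp mF); apply: measurable_fun_pair => //.
exact: measurable_funM.
Qed.

Let mG2 : measurable_fun setT G2.
Proof.
apply: emeasurable_funM => //; apply/measurable_EFinP/measurable_funM => //.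
apply: measurable_ind_ball; apply: (measurableT_comp (@measurable_consT R d)).
by apply: measurable_fun_pair => //; exact: measurable_funM.
Qed.

Let mG3 : measurable_fun setT G3.
Proof.
apply: emeasurable_funM => //; apply/measurable_EFinP/measurable_funM => //.
  by apply: measurable_funM => //; exact: measurable_ind_ball.
exact: measurable_funX.
Qed.

Let G1_ge0 p : (0 <= G1 p)%E. Proof. by rewrite mule_ge0// lee_fin. Qed.
Let G2_ge0 p : (0 <= G2 p)%E.
Proof. by rewrite mule_ge0// lee_fin mulr_ge0// enorm_ge0. Qed.
Let G3_ge0 p : (0 <= G3 p)%E.
Proof. by rewrite mule_ge0// lee_fin !mulr_ge0 ?enorm_ge0// exprn_ge0// ltW. Qed.

Let ballE n (x : n.-tuple R) : (x \in @unit_ball R n) = (enorm x <= 1).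
Proof. by apply/idP/idP => [/set_mem//|h]; rewrite inE. Qed.

Let enorm_cone u (y : d.-tuple R) : enorm (consT (enorm y * u, y)) = enorm y / c u.
Proof.
rewrite enorm_consT exprMn -[X in _ + X]mulr1 -mulrDr sqrtrM ?sqr_ge0//.
by rewrite sqrtr_sqr ger0_norm ?enorm_ge0// /c invrK addrC.
Qed.

Let step2 : (\int[L d]_y \int[leb]_s G1 (s, y) = \int[L d]_y \int[leb]_u G2 (u, y))%E.
Proof.
apply: ge0_ae_eq_integral => //.
- exact: measurable_fun_fubini_tonelli_G.
- exact: measurable_fun_fubini_tonelli_G.
- by move=> y _; exact: integral_ge0.
- by move=> y _; exact: integral_ge0.
(* The substitution [s = |y| u] degenerates at [y = 0]; the origin is a null set because [0 < d]. *)
exists (@cube R d 0); split; first exact: measurable_cube.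
  by apply: eq_trans (lebesgue_tuple_cube _ (lexx 0)) _; rewrite mulr0 expr0n gtn_eqF.
move=> y; apply: contra_notP => /= y0 _.
have Ny : enorm y != 0 by apply/eqP => /enorm_eq0.
have Ny0 : 0 < enorm y by rewrite lt_def Ny enorm_ge0.
rewrite -(@ge0_integral_affine _ (enorm y) 0)//; last first.
  by apply: (measurableT_comp mG1); exact: pair2_measurable.
apply: eq_integral => u _; rewrite addr0 /G1 /G2/= gtr0_norm// EFinM muleA.
congr (F (_, _) * _ * _)%E; rewrite enorm_cone; field.
by rewrite Ny (lt0r_neq0 (c_gt0 u)).
Qed.

Let step3 u : (\int[L d]_y G2 (u, y) = \int[L d]_z G3 (u, z))%E.
Proof.
have mG2u : measurable_fun setT (fun y => G2 (u, y)).
  by apply: (measurableT_comp mG2); exact: pair1_measurable.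
rewrite -[LHS](ge0_integral_scale (c_gt0 u) mG2u (fun y => G2_ge0 (u, y))).
have c0 := ltW (c_gt0 u).
apply: eq_integral => z _; rewrite G2E G3E (direction_scale _ (c_gt0 u)).
rewrite -muleA -EFinM; congr (_ * _%:E)%E; rewrite !indicE !ballE.
have e : c u * enorm z / c u = enorm z by field; exact: lt0r_neq0.
by rewrite enorm_cone (enorm_scale _ c0) e exprS; ring.
Qed.

Let c_stereo t : -1 < t < 1 -> c (stereo t) = Num.sqrt (1 - t ^+ 2).
Proof.
move=> t1; have v0 : 0 < 1 - t ^+ 2 by nra.
have s0 : 0 < Num.sqrt (1 - t ^+ 2) by rewrite sqrtr_gt0.
have v1 := ltW v0; have c1 := ltW (c_gt0 (stereo t)); have s1 := ltW s0.
apply/eqP; rewrite -(eqrXn2 (ltn0Sn 1) c1 s1) sqr_c /stereo exprMn exprVn.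
rewrite (sqr_sqrtr v1); apply/eqP; field.
by rewrite subrK oner_neq0 andbT lt0r_neq0.
Qed.

Let step4 z : (\int[leb]_u G3 (u, z) =
  \int[leb]_t (F (t, dir z) * (\1_(@unit_ball R d) z * enorm z *
    (Num.sqrt (1 - t ^+ 2) ^+ d.+1 * dstereo t))%:E))%E.
Proof.
have mG3z : measurable_fun setT (fun u => G3 (u, z)).
  by apply: (measurableT_comp mG3); exact: pair2_measurable.
rewrite [LHS](ge0_integral_stereo mG3z (fun u => G3_ge0 (u, z))).
apply: eq_integral => t _; rewrite G3E.
have [t1|t1] := boolP (-1 < t < 1); last first.
  have -> : dstereo t = 0 by exact: dstereo_out.
  by rewrite mule0 2!mulr0 mule0.
have s0 : Num.sqrt (1 - t ^+ 2) != 0.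
  by rewrite sqrtr_eq0 -ltNge; have v0 : 0 < 1 - t ^+ 2 by nra.
rewrite (c_stereo t1) -muleA -EFinM; congr (F (_, _) * _%:E)%E.
  exact: mulfVK.
exact/esym/mulrA.
Qed.

(** The last substitution is [u = stereo t]. The factor in [t] is the weight in disguise:
    [sqrt (1 - t^2)] to the power [d + 1 - 3], that is [(1 - t^2)] to the power [d / 2 - 1]. *)
Lemma integral_ball_polar :
  (\int[L d.+1]_x (F ((tnth x ord0 / enorm x)%R, dir [tuple of behead x]) *
     (\1_(@unit_ball R d.+1) x)%:E) =
   \int[L d]_z \int[leb]_t (F (t, dir z) * (\1_(@unit_ball R d) z * enorm z *
      (Num.sqrt (1 - t ^+ 2) ^+ d.+1 * dstereo t))%:E))%E.
Proof.
have step (p : R * d.-tuple R -> \bar R) (mp : measurable_fun setT p) (p0 : forall z, (0 <= p z)%E) :=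
  @fubini_tonelli _ _ _ _ R leb (L d) p mp p0.
transitivity (\int[L d]_z \int[leb]_u G3 (u, z))%E; last first.
  by apply: eq_integral => z _; exact: step4.
transitivity (\int[leb]_s \int[L d]_y G1 (s, y))%E; last first.
  rewrite (step _ mG1 G1_ge0) step2 -(step _ mG2 G2_ge0) -(step _ mG3 G3_ge0).
  by apply: eq_integral => u _; exact: step3.
pose H (x : d.+1.-tuple R) : \bar R :=
  (F ((tnth x ord0 / enorm x)%R, dir [tuple of behead x]) *
   (\1_(@unit_ball R d.+1) x)%:E)%E.
have mH : measurable_fun setT H.
  apply: emeasurable_funM; last by apply/measurable_EFinP/measurable_ind_ball.
  apply: (measurableT_comp mF); apply: measurable_fun_pair => /=.
    apply: measurable_funM; first exact: measurable_tnth.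
    exact: measurable_enormV.
  apply: (measurableT_comp (@measurable_direction R d)).
  exact: measurable_behead.
have H0 x : (0 <= H x)%E by rewrite mule_ge0// lee_fin.
rewrite [LHS](ge0_integral_lebesgue_tupleS mH H0).
apply: eq_integral => s _; apply: eq_integral => y _; rewrite /H tnth0.
by congr (F (_, dir _) * _)%E; exact: val_inj.
Qed.

End polar.

(** * The surface measure in coordinates of height and direction *)

Section surface_theory.
Context {R : realType}.
Local Notation leb := (@lebesgue_measure R).
Local Notation L := (@lebesgue_tuple R).
Local Notation dir := (@direction R _).
Variable d : nat.

Definition cone_const : R := (fine (L d.+1 (@unit_ball R d.+1)))^-1.

Lemma cone_const_gt0 : 0 < cone_const.
Proof.
by rewrite invr_gt0 fine_gt0// lebesgue_unit_ball_gt0 lebesgue_unit_ball_lty.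
Qed.

Lemma measurable_ind_ball n :
  measurable_fun setT (\1_(@unit_ball R n) : n.-tuple R -> R).
Proof. by apply: measurable_indic; exact: measurable_unit_ball. Qed.

Lemma integral_surface (H : d.+1.-tuple R -> \bar R) : measurable_fun setT H ->
  (\int[@surface R d]_x H x =
   \int[L d.+1]_x (H (dir x) * (\1_(@unit_ball R d.+1) x * cone_const)%:E))%E.
Proof.
move=> mH; have c0 := cone_const_gt0; have mB := @measurable_unit_ball R d.+1.
have m1B := @measurable_ind_ball d.+1.
apply: integral_transfer => //.
- exact: measurable_direction.
- exact: measurable_funM.
- by move=> x; rewrite mulr_ge0// ltW.
move=> A mA; rewrite /surface -/cone_const.
have mdA : measurable (dir @^-1` A).
  by rewrite -[X in measurable X]setTI; exact: measurable_direction.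
have mI : measurable (dir @^-1` A `&` @unit_ball R d.+1) by exact: measurableI.
transitivity (\int[L d.+1]_x
    ((\1_(dir @^-1` A `&` @unit_ball R d.+1) x)%:E * cone_const%:E))%E; last first.
  apply: eq_integral => x _; rewrite EFinM muleA -EFinM indicI.
  by rewrite !indicE.
rewrite ge0_integralZr//; last 2 first.
- by apply/measurable_EFinP; exact: measurable_indic.
- by rewrite lee_fin ltW.
by rewrite integral_indic// setIT.
Qed.

Lemma surface_setT : @surface R d setT = 1%E.
Proof.
rewrite /surface preimage_setT setTI -/cone_const.
have := lebesgue_unit_ball_gt0 (R := R) d.+1; have := lebesgue_unit_ball_lty (R := R) d.+1.
rewrite /cone_const; case: (L d.+1 _) => //= r _ r0.
by rewrite -EFinM divff// lt0r_neq0.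
Qed.

Lemma direction_sphere (x : d.+1.-tuple R) : enorm x != 0 -> sphere (dir x).
Proof.
move=> x0; have xp : 0 < enorm x by rewrite lt_def x0 enorm_ge0.
rewrite /sphere/= (_ : dir x = [tuple (enorm x)^-1 * tnth x i | i < d.+1]); last first.
  by apply: eq_from_tnth => i; rewrite !tnth_mktuple mulrC.
by rewrite enorm_scale ?invr_ge0 ?enorm_ge0// mulVf.
Qed.

Lemma measurable_sphere : measurable (@sphere R d).
Proof.
rewrite (_ : @sphere R d = @enorm R d.+1 @^-1` [set 1])//.
by rewrite -[X in measurable X]setTI; exact: measurable_enorm.
Qed.

Lemma ae_surface_sphere : {ae @surface R d, forall x, sphere x}.
Proof.
exists (~` @sphere R d); split => //; first (by apply: measurableC; exact: measurable_sphere).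
rewrite /= /surface (_ : L d.+1 _ = 0%E) ?mul0e//.
have cube0 : L d.+1 (cube 0) = 0%E.
  by apply: eq_trans (lebesgue_tuple_cube _ (lexx 0)) _; rewrite mulr0 expr0n.
apply/eqP; rewrite -measure_le0 -[leRHS]cube0; apply: le_measure; rewrite ?inE.
- apply: measurableI; last exact: measurable_unit_ball.
  rewrite -[X in measurable X]setTI; apply: measurable_direction => //.
  by apply: measurableC; exact: measurable_sphere.
- exact: measurable_cube.
- move=> x [+ _]; apply: contra_notP => x0; apply: direction_sphere.
  by apply/eqP => /enorm_eq0.
Qed.

Hypothesis d_gt0 : (0 < d)%N.

Let w0 (t : R) := Num.sqrt (1 - t ^+ 2) ^+ d.+1 * dstereo t.

Let w0_ge0 t : 0 <= w0 t.
Proof. by rewrite mulr_ge0 ?dstereo_ge0// exprn_ge0// sqrtr_ge0. Qed.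

Let w0E t : -1 < t < 1 -> w0 t = (1 - t ^+ 2) `^ (d%:R / 2 - 1).
Proof.
move=> t1; have v0 : 0 < 1 - t ^+ 2 by nra.
rewrite /w0 /dstereo -powR12_sqrt ?ltW//; move: (1 - _) v0 => v v0.
rewrite -(powR_inv1 (powR_ge0 _ _)) -!powR_mulrn ?powR_ge0// -!powRrM -powRD.
  by congr (_ `^ _); rewrite -natr1; field.
by rewrite (gt_eqF v0) implybT.
Qed.

Let w0_out t : ~~ (-1 < t < 1) -> w0 t = 0.
Proof. by move=> /dstereo_out; rewrite /w0 => ->; rewrite mulr0. Qed.

Let measurable_w0 : measurable_fun setT w0.
Proof.
apply: measurable_funM; last exact: measurable_dstereo.
apply: measurable_funX; apply: (@measurableT_comp _ _ _ _ _ _ (@Num.sqrt R)).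
  by apply: continuous_measurable_fun; exact: sqrt_continuous.
by apply: measurable_funB => //; exact: measurable_funX.
Qed.

Let rad (z : d.-tuple R) := \1_(@unit_ball R d) z * enorm z.

Let rad_ge0 z : 0 <= rad z.
Proof. by rewrite mulr_ge0 ?enorm_ge0. Qed.

Let measurable_rad : measurable_fun setT rad.
Proof.
by apply: measurable_funM; [exact: measurable_ind_ball|exact: measurable_enorm].
Qed.

Let direction_behead (x : d.+1.-tuple R) :
  dir [tuple of behead (dir x)] = dir [tuple of behead x].
Proof.
have E i : tnth [tuple of behead (dir x)] i = (enorm x)^-1 * tnth [tuple of behead x] i.
  by rewrite !tnth_behead tnth_mktuple mulrC.
have [x0|x0] := eqVneq (enorm x) 0.
  have b0 i : tnth [tuple of behead x] i = 0.
    have := enorm_eq0 x0 (inord i.+1); rewrite tnth_behead => h.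
    by apply/eqP; rewrite -normr_le0.
  by apply: eq_from_tnth => i; rewrite !tnth_mktuple E b0 mulr0 !mul0r.
rewrite -[RHS](@direction_scale _ _ (enorm x)^-1); last first.
  by rewrite invr_gt0 lt_def x0 enorm_ge0.
by congr direction; apply: eq_from_tnth => i; rewrite E tnth_mktuple.
Qed.

Let slice_ge0 (F : R * d.-tuple R -> \bar R) : measurable_fun setT F ->
  (forall z, (0 <= F z)%E) ->
  (\int[@surface R d]_x F (tnth x ord0, dir [tuple of behead x]) =
   cone_const%:E * \int[L d]_z \int[leb]_t (F (t, dir z) * (rad z * w0 t)%:E))%E.
Proof.
move=> mF F0; have c0 := cone_const_gt0.
have mdb : measurable_fun setT (fun x : d.+1.-tuple R => dir [tuple of behead x]).
  apply: (measurableT_comp (@measurable_direction R d)); exact: measurable_behead.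
rewrite integral_surface; last first.
  apply: (measurableT_comp mF); apply: measurable_fun_pair => //.
  exact: measurable_tnth.
rewrite -(integral_ball_polar d_gt0 mF F0) -ge0_integralZl.
- apply: eq_integral => x _; rewrite direction_behead tnth_mktuple.
  by rewrite EFinM muleA muleC.
- exact: measurableT.
- apply: emeasurable_funM; last by apply/measurable_EFinP; exact: measurable_ind_ball.
  apply: (measurableT_comp mF); apply: measurable_fun_pair => //.
  apply: measurable_funM; last exact: measurable_enormV.
  exact: measurable_tnth.
- by move=> x _; rewrite mule_ge0// lee_fin.
- by rewrite lee_fin ltW.
Qed.

Let M := (\int[L d]_z (rad z)%:E)%E.
Let J := (\int[leb]_t (w0 t)%:E)%E.

Let massE : (cone_const%:E * (M * J) = 1)%E.
Proof.
have := @slice_ge0 (cst 1%E) (measurable_cst _) (fun _ => lee01).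
have -> : (\int[@surface R d]_x (cst 1 (tnth x ord0, dir [tuple of behead x])) = 1)%E.
  by rewrite (integral_cst _ measurableT 1%E) mul1e; exact: surface_setT.
move=> ->; congr (_ * _)%E.
rewrite -ge0_integralZr//; last 3 first.
- exact/measurable_EFinP.
- by move=> z _; rewrite lee_fin.
- by apply: integral_ge0 => t _; rewrite lee_fin.
apply: eq_integral => z _; rewrite -ge0_integralZl//.
- by apply: eq_integral => t _; rewrite mul1e EFinM.
- exact/measurable_EFinP.
- by move=> t _; rewrite lee_fin.
- by rewrite lee_fin.
Qed.

Let J0 : (0 <= J)%E. Proof. by apply: integral_ge0 => t _; rewrite lee_fin. Qed.
Let M0 : (0 <= M)%E. Proof. by apply: integral_ge0 => t _; rewrite lee_fin. Qed.

(** Nonnegative extended reals whose product is 1 are finite and positive. Integrability of the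
    weight and of the radial factor thus follows from the total mass, without estimating either
    integral. *)
Let MJ : exists2 m : R, 0 < m & M = m%:E /\ exists2 j : R, 0 < j & J = j%:E /\ cone_const * (m * j) = 1.
Proof.
have c0 := cone_const_gt0; move: massE J0 M0.
case: M => [m| |]//; case: J => [j| |]//.
- rewrite -!EFinM !lee_fin => -[e] j0 m0; exists m.
    by rewrite lt_def m0 andbT; apply/eqP => m00; move: e; rewrite m00 mul0r mulr0 => /eqP;
      rewrite eq_sym oner_eq0.
  split => //; exists j => //.
  by rewrite lt_def j0 andbT; apply/eqP => j00; move: e; rewrite j00 !mulr0 => /eqP;
    rewrite eq_sym oner_eq0.
- move=> e _; rewrite lee_fin le_eqVlt => /predU1P[m0|m0]; move: e.
    by rewrite -m0 mul0e mule0 => /eqP; rewrite eqe eq_sym oner_eq0.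
  by rewrite gt0_muley ?lte_fin// gt0_muley ?lte_fin.
- move=> e j0 _; move: j0 e; rewrite lee_fin le_eqVlt => /predU1P[j0|j0].
    by rewrite -j0 mule0 mule0 => /eqP; rewrite eqe eq_sym oner_eq0.
  by rewrite gt0_mulye ?lte_fin// gt0_muley ?lte_fin.
- by rewrite mulyy gt0_muley ?lte_fin.
Qed.

Let Jf := fine J.

Let Jf_gt0 : 0 < Jf.
Proof. by have [m m0 [_ [j j0 [Jj _]]]] := MJ; rewrite /Jf Jj. Qed.

Let wd_constE : wd_const d = Jf^-1 :> R.
Proof.
rewrite /wd_const /Jf /Rintegral; congr (fine _)^-1.
have mpow : measurable_fun setT (fun x : R => (1 - x ^+ 2) `^ (d%:R / 2 - 1)).
  apply: (@measurableT_comp _ _ _ _ _ _ (@powR R ^~ _)) => /=.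
    exact: measurable_powR.
  by apply: measurable_funB => //; exact: measurable_funX.
rewrite integral_itv_bndoo; last first.
  by apply/measurable_EFinP; exact: measurable_funTS.
rewrite integral_mkcond; apply: eq_integral => t _; rewrite patchE mem_setE in_itv/=.
by case: ifPn => [/w0E->//|/w0_out->].
Qed.

(** Outside ]-1, 1[ [wd] is a real power of a nonpositive base, with values of no meaning. Cut off
    there, it is a density of [wdm] on the whole line, the endpoints being null. *)
Definition wdo (t : R) := if -1 < t < 1 then wd d t else 0.

Let wdoE t : wdo t = Jf^-1 * w0 t.
Proof.
rewrite /wdo; case: ifPn => [t1|/w0_out->]; last by rewrite mulr0.
by rewrite /wd wd_constE w0E.
Qed.

Lemma wdo_sqrt t :
  wdo t = wd_const d * (Num.sqrt (1 - t ^+ 2) ^+ d.+1 * dstereo t).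
Proof. by rewrite wdoE wd_constE. Qed.

Lemma wdo_ge0 t : 0 <= wdo t.
Proof. by rewrite wdoE mulr_ge0// invr_ge0 ltW. Qed.

Lemma wd_const_gt0 : 0 < wd_const d :> R.
Proof. by rewrite wd_constE invr_gt0. Qed.

Lemma measurable_wdo : measurable_fun setT wdo.
Proof.
rewrite (_ : wdo = fun t => Jf^-1 * w0 t); last exact/funext/wdoE.
exact: measurable_funM.
Qed.

Lemma integral_wdm (f : R -> \bar R) : measurable_fun setT f ->
  (\int[wdm d]_t f t = \int[leb]_t (f t * (wdo t)%:E))%E.
Proof.
move=> mf; have mwdo := measurable_wdo; have wdo0 := wdo_ge0.
apply: (@integral_transfer _ _ _ _ _ leb (wdm d) id wdo) => //.
move=> A mA; rewrite -[LHS]/(wintegral (wd d) A) /wintegral.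
have mw := @measurable_wd R d.
rewrite setIC integral_mkcondr integral_itv_bndoo; last first.
  apply: (measurable_funS measurableT) => //.
  apply/(measurable_restrictT _ _).1 => //.
  by apply: measurable_funTS; exact/measurable_EFinP.
rewrite [LHS]integral_mkcond; apply: eq_integral => t _; rewrite !patchE indicE.
rewrite mem_setE in_itv/= /wdo; case: ifPn => _; last by rewrite mule0.
by case: ifPn => _; rewrite ?mul1e ?mul0e.
Qed.

(** A radial density on R^d whose image under [dir] is the uniform probability on directions. It
    plays the role of the surface measure one dimension lower and also serves [d = 1], where there
    are only two directions. The factor [|z|] is the Jacobian from the slicing, and the constant
    makes the mass 1. *)
Definition slice_kernel (z : d.-tuple R) : R :=
  \1_(@unit_ball R d) z * enorm z * (cone_const * Jf).

Lemma slice_kernel_ge0 z : 0 <= slice_kernel z.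
Proof. by rewrite !mulr_ge0 ?enorm_ge0// ltW// cone_const_gt0. Qed.

Lemma measurable_slice_kernel : measurable_fun setT slice_kernel.
Proof. exact: measurable_funM. Qed.

Lemma slice_kernelN z : slice_kernel [tuple - tnth z i | i < d] = slice_kernel z.
Proof.
have E : enorm [tuple - tnth z i | i < d] = enorm z.
  by rewrite /enorm; under eq_bigr do rewrite tnth_mktuple sqrrN.
rewrite /slice_kernel E; congr (_ * _ * _); rewrite !indicE; congr (nat_of_bool _)%:R.
by apply/idP/idP; rewrite !inE /unit_ball/= E.
Qed.

Lemma integral_slice_kernel : (\int[L d]_z (slice_kernel z)%:E = 1)%E.
Proof.
have cJ : 0 <= cone_const * Jf by rewrite mulr_ge0 ?ltW// cone_const_gt0.
under eq_integral do rewrite EFinM.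
rewrite (@ge0_integralZr _ _ _ (L d) _ measurableT (fun z => (rad z)%:E)).
- have [m _ [Mm [j _ [Jj <-]]]] := MJ.
  by rewrite -[X in (X * _)%E]/M Mm /Jf Jj -EFinM mulrCA.
- exact/measurable_EFinP.
- by move=> z _; rewrite lee_fin.
- by [].
Qed.

(* In the coordinates [x = (t, sqrt (1 - t ^+ 2) xi)] the surface measure is the
   product of [w_d(t) dt] and a probability measure on the directions [xi]. *)
Lemma integral_slice (F : R * d.-tuple R -> \bar R) : measurable_fun setT F ->
  (\int[@surface R d]_x F (tnth x ord0, dir [tuple of behead x]) =
   \int[leb \x L d]_p (F (p.1, dir p.2) * (wdo p.1 * slice_kernel p.2)%:E))%E.
Proof.
move=> mF; pose psi (x : d.+1.-tuple R) := (tnth x ord0, dir [tuple of behead x]).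
have mpsi : measurable_fun setT psi.
  apply: measurable_fun_pair; first exact: measurable_tnth.
  apply: (measurableT_comp (@measurable_direction R d)); exact: measurable_behead.
have mpre A : measurable A -> measurable (psi @^-1` A).
  by move=> mA; rewrite -[X in measurable X]setTI; exact: mpsi.
pose nu := measure_function_pushforward__canonical__measure_function_Measure (@surface R d) mpsi.
rewrite -[LHS](@integral_pullback _ _ _ _ _ (@surface R d) nu psi mpsi (fun A _ => erefl) F mF).
have mk2 : measurable_fun setT (fun p : R * d.-tuple R => slice_kernel p.2).
  exact: (measurableT_comp measurable_slice_kernel).
have mk1 : measurable_fun setT (fun p : R * d.-tuple R => wdo p.1).
  exact: (measurableT_comp measurable_wdo).
have mk : measurable_fun setT (fun p : R * d.-tuple R => wdo p.1 * slice_kernel p.2).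
  exact: measurable_funM.
have mphi : measurable_fun setT (fun p : R * d.-tuple R => (p.1, dir p.2)).
  apply: measurable_fun_pair => //.
  exact: (measurableT_comp (@measurable_direction R d)).
have k0 (p : R * d.-tuple R) : 0 <= wdo p.1 * slice_kernel p.2.
  by rewrite mulr_ge0 ?wdo_ge0 ?slice_kernel_ge0.
apply: (@integral_transfer _ _ _ _ _ (leb \x L d)%E nu (fun p => (p.1, dir p.2))) => //.
move=> A mA.
have m1A : measurable_fun setT (fun p : R * d.-tuple R => (\1_A p)%:E : \bar R).
  by apply/measurable_EFinP; exact: measurable_indic.
transitivity (\int[@surface R d]_x (\1_A (psi x))%:E)%E.
  have := integral_indic (@surface R d) measurableT (mpre A mA).
  by rewrite setIT => /esym.
rewrite (slice_ge0 m1A); last by move=> z; rewrite lee_fin.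
have c0 := cone_const_gt0.
pose K (p : R * d.-tuple R) : \bar R := ((\1_A (p.1, dir p.2))%:E * (wdo p.1 * slice_kernel p.2)%:E)%E.
have mK : measurable_fun setT K.
  apply: emeasurable_funM; first exact: (measurableT_comp m1A mphi).
  exact/measurable_EFinP.
have K0 p : (0 <= K p)%E by rewrite mule_ge0 ?lee_fin.
rewrite (@fubini_tonelli2 _ _ _ _ _ leb (L d) K mK K0) -ge0_integralZl.
- apply: eq_integral => z _; rewrite -ge0_integralZl.
  + apply: eq_integral => t _; rewrite /K/= muleCA -!EFinM wdoE /slice_kernel /rad.
    by congr EFin; field; exact: lt0r_neq0.
  + exact: measurableT.
  + apply: emeasurable_funM; last by apply/measurable_EFinP; exact: measurable_funM.
    apply: (measurableT_comp m1A); exact: measurable_fun_pair.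
  + by move=> t _; rewrite mule_ge0// lee_fin// mulr_ge0.
  + by rewrite lee_fin ltW.
- exact: measurableT.
- apply: (@measurable_fun_fubini_tonelli_G _ _ _ _ _ leb
    (fun p => ((\1_A (p.1, dir p.2))%:E * (rad p.2 * w0 p.1)%:E)%E)).
  + apply: emeasurable_funM; first exact: (measurableT_comp m1A mphi).
    apply/measurable_EFinP/measurable_funM.
      exact: (measurableT_comp measurable_rad).
    exact: (measurableT_comp measurable_w0).
  + by move=> p; rewrite mule_ge0// lee_fin// mulr_ge0.
- by move=> z _; apply: integral_ge0 => t _; rewrite mule_ge0// lee_fin// mulr_ge0.
- by rewrite lee_fin ltW.
Qed.

(** The slice formula for a function of the height alone. It identifies the [L^r] norms of a
    function of one coordinate on the sphere with its [L^r(w_d)] norms. *)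
Lemma surface_height (A : set R) : measurable A ->
  @surface R d ((fun x => tnth x ord0) @^-1` A) = wdm d A.
Proof.
move=> mA; have m1A : measurable_fun setT (fun p : R => (\1_A p)%:E : \bar R).
  by apply/measurable_EFinP; exact: measurable_indic.
have mh : measurable_fun setT (fun x : d.+1.-tuple R => tnth x ord0) by exact: measurable_tnth.
have mhA : measurable ((fun x : d.+1.-tuple R => tnth x ord0) @^-1` A).
  by rewrite -[X in measurable X]setTI; exact: mh.
transitivity (\int[@surface R d]_x (\1_A (tnth x ord0))%:E)%E.
  have := integral_indic (@surface R d) measurableT mhA.
  by rewrite setIT => /esym.
transitivity (\int[wdm d]_t (\1_A t)%:E)%E; last first.
  by rewrite (integral_indic (wdm d) measurableT mA) setIT.
rewrite integral_wdm//.
have mF : measurable_fun setT (fun p : R * d.-tuple R => (\1_A p.1)%:E : \bar R).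
  exact: (measurableT_comp m1A).
rewrite (integral_slice mF).
pose K (p : R * d.-tuple R) : \bar R := ((\1_A p.1)%:E * (wdo p.1 * slice_kernel p.2)%:E)%E.
have mK : measurable_fun setT K.
  apply: emeasurable_funM => //; apply/measurable_EFinP/measurable_funM.
    exact: (measurableT_comp measurable_wdo).
  exact: (measurableT_comp measurable_slice_kernel).
have K0 p : (0 <= K p)%E.
  apply: mule_ge0; rewrite lee_fin; first by rewrite indicE ler0n.
  by apply: mulr_ge0; [exact: wdo_ge0|exact: slice_kernel_ge0].
rewrite (@fubini_tonelli1 _ _ _ _ _ leb (L d) K mK K0).
apply: eq_integral => t _; rewrite /fubini_F /K/=.
under eq_integral do rewrite EFinM muleA.
rewrite ge0_integralZl.
- by rewrite integral_slice_kernel mule1.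
- exact: measurableT.
- by apply/measurable_EFinP; exact: measurable_slice_kernel.
- by move=> z _; rewrite lee_fin slice_kernel_ge0.
- by rewrite mule_ge0 ?lee_fin ?wdo_ge0.
Qed.

Lemma wdm_setT : wdm d setT = 1%E :> \bar R.
Proof. by rewrite -surface_height// preimage_setT surface_setT. Qed.

Lemma surface_dot (x : d.+1.-tuple R) (A : set R) : sphere x -> measurable A ->
  @surface R d (dot x @^-1` A) = wdm d A.
Proof.
move=> xS mA; rewrite -surface_height// -[RHS](surface_house x).
  by congr surface; apply/funext => y; rewrite /preimage /mkset house_tnth0.
rewrite -[X in measurable X]setTI; apply: (measurable_tnth _) => //.
Qed.

End surface_theory.

(** * Polynomial functions and their averages over parallels *)

Section polyfun.
Context {R : realType}.

(** Polynomial functions of degree at most [n], generated coordinate by coordinate so that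
    substitutions, bounds and averages are handled by induction on three cases. [polyfun_meval] and
    [polyfun_mpoly] connect them with [sphere_poly]. *)
Inductive polyfun (N : nat) : nat -> (N.-tuple R -> R) -> Prop :=
| polyfun_cst n c : polyfun n (fun=> c)
| polyfun_add n f g : polyfun n f -> polyfun n g -> polyfun n (fun x => f x + g x)
| polyfun_mul n i f : polyfun n f -> polyfun n.+1 (fun x => tnth x i * f x).

Lemma eq_polyfun N n (f g : N.-tuple R -> R) : f =1 g -> polyfun n f -> polyfun n g.
Proof. by move=> /funext ->. Qed.

Lemma polyfun_le N n m (f : N.-tuple R -> R) : (n <= m)%N -> polyfun n f -> polyfun m f.
Proof.
move=> + pf; elim: pf m => [{}n c m _|{}n {}f g _ IHf _ IHg m nm|{}n i {}f _ IH [//|m] nm].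
- exact: polyfun_cst.
- by apply: polyfun_add; [exact: IHf|exact: IHg].
- by apply: polyfun_mul; exact: IH.
Qed.

Lemma polyfun_scale N n (c : R) (f : N.-tuple R -> R) :
  polyfun n f -> polyfun n (fun x => c * f x).
Proof.
elim=> [m e|m g h _ IHg _ IHh|m i g _ IH].
- exact: polyfun_cst.
- by apply: (eq_polyfun _ (polyfun_add IHg IHh)) => x; rewrite mulrDr.
- by apply: (eq_polyfun _ (polyfun_mul i IH)) => x; rewrite mulrCA.
Qed.

Lemma polyfun_sum N n (I : Type) (s : seq I) (f : I -> N.-tuple R -> R) :
  (forall i, polyfun n (f i)) -> polyfun n (fun x => \sum_(i <- s) f i x).
Proof.
move=> pf; elim: s => [|i s IH].
  by apply: (eq_polyfun _ (polyfun_cst _ n 0)) => x; rewrite big_nil.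
by apply: (eq_polyfun _ (polyfun_add (pf i) IH)) => x; rewrite big_cons.
Qed.

Lemma polyfunM N n m (f g : N.-tuple R -> R) :
  polyfun n f -> polyfun m g -> polyfun (n + m) (fun x => f x * g x).
Proof.
move=> + pg; elim=> [k c|k f1 f2 _ IH1 _ IH2|k i f1 _ IH].
- by apply: (polyfun_le (leq_addl k m)); exact: polyfun_scale.
- by apply: (eq_polyfun _ (polyfun_add IH1 IH2)) => x; rewrite mulrDl.
- by rewrite addSn; apply: (eq_polyfun _ (polyfun_mul i IH)) => x; rewrite mulrA.
Qed.

Lemma polyfun_comp N n (f : N.-tuple R -> R) (O : N.-tuple R -> N.-tuple R)
    (a : 'I_N -> 'I_N -> R) :
  (forall x i, tnth (O x) i = \sum_j a i j * tnth x j) ->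
  polyfun n f -> polyfun n (f \o O).
Proof.
move=> OE; elim=> [m e|m g h _ IHg _ IHh|m i g _ IH].
- exact: polyfun_cst.
- exact: polyfun_add.
- apply: (@eq_polyfun _ _ (fun x => \sum_j a i j * (tnth x j * g (O x)))).
    by move=> x; rewrite /= OE mulr_suml; apply: eq_bigr => j _; rewrite mulrA.
  by apply: polyfun_sum => j; apply: polyfun_scale; exact: polyfun_mul.
Qed.

Lemma polyfun_house d n (x : d.+1.-tuple R) (f : d.+1.-tuple R -> R) :
  polyfun n f -> polyfun n (f \o house x).
Proof.
pose v := tcomb 1 x (-1) (north d).
apply: (@polyfun_comp _ _ _ _ (fun i j => (i == j)%:R - 2 * tnth v j / dot v v * tnth v i)).
move=> y i; rewrite tnth_tcomb -/v mul1r.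
under eq_bigr do rewrite mulrBl.
rewrite sumrB (bigD1 i)//= eqxx mul1r big1 ?addr0; last first.
  by move=> j; rewrite eq_sym => /negPf ->; rewrite mul0r.
congr (_ + _); rewrite {1}/dot mulr_sumr !mulr_suml -sumrN mulr_suml.
by rewrite -sumrN; apply: eq_bigr => j _; ring.
Qed.

Lemma measurable_polyfun N n (f : N.-tuple R -> R) : polyfun n f -> measurable_fun setT f.
Proof.
elim=> [m e|m g h _ IHg _ IHh|m i g _ IH]; first exact: measurable_cst.
- exact: measurable_funD.
- by apply: measurable_funM => //; exact: measurable_tnth.
Qed.

Lemma polyfun_bounded N n (f : N.-tuple R -> R) : polyfun n f ->
  exists C, forall x, cube 1 x -> `|f x| <= C.
Proof.
elim=> [m e|m g h _ [C1 H1] _ [C2 H2]|m i g _ [C H]].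
- by exists `|e|.
- exists (C1 + C2) => x x1; apply: le_trans (ler_normD _ _) _.
  by apply: lerD; [exact: H1|exact: H2].
- exists C => x x1; rewrite normrM; apply: le_trans (H _ x1).
  by rewrite ler_piMl.
Qed.

Lemma polyfun_prod N n (f : N.-tuple R -> R) (i : 'I_N) k :
  polyfun n f -> polyfun (k + n) (fun x => tnth x i ^+ k * f x).
Proof.
move=> pf; elim: k => [|k IH].
  by apply: (eq_polyfun _ pf) => x; rewrite expr0 mul1r.
by rewrite addSn; apply: (eq_polyfun _ (polyfun_mul i IH)) => x; rewrite exprS mulrA.
Qed.

Lemma polyfun_meval N n (P : mpoly.mpoly N R) : (mpoly.mmeasure mpoly.mdeg P <= n.+1)%N ->
  polyfun n (fun x => mpoly.meval (tnth x) P).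
Proof.
move=> Pn.
have pX (m : mpoly.multinom N) : polyfun (mpoly.mdeg m) (fun x => \prod_i tnth x i ^+ m i).
  rewrite mpoly.mdegE; elim: (index_enum _) => [|i s IH].
    rewrite big_nil; apply: (eq_polyfun _ (polyfun_cst _ 0 1)) => x.
    by rewrite big_nil.
  rewrite big_cons; apply: (eq_polyfun _ (polyfun_prod i (m i) IH)) => x.
  by rewrite big_cons.
pose F m (x : N.-tuple R) := if (mpoly.mdeg m <= n)%N
  then mpoly.mcoeff m P * \prod_i tnth x i ^+ (m : mpoly.multinom N) i else 0.
apply: (@eq_polyfun _ _ (fun x => \sum_(m <- mpoly.msupp P) F m x)).
  move=> x; rewrite mpoly.mevalE; apply: eq_big_seq => m /mpoly.msize_mdeg_lt mP.
  by rewrite /F ifT// -ltnS (leq_trans mP).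
apply: polyfun_sum => m; rewrite /F; case: (mpoly.mdeg m <= n)%N / idP => mn.
  by apply: polyfun_scale; exact: polyfun_le mn (pX m).
exact: polyfun_cst.
Qed.

Lemma polyfun_mpoly N n (f : N.-tuple R -> R) : polyfun n f ->
  exists2 P : mpoly.mpoly N R, (mpoly.mmeasure mpoly.mdeg P <= n.+1)%N &
    f = fun x => mpoly.meval (tnth x) P.
Proof.
elim=> [m c|m g h _ [P Pm ->] _ [Q Qm ->]|m i g _ [P Pm ->]].
- exists (mpoly.mpolyC N c); last by apply/funext => x; rewrite mpoly.mevalC.
  by rewrite mpoly.mmeasureC; case: eqP.
- exists (P + Q); last by apply/funext => x; rewrite mpoly.mevalD.
  by apply: leq_trans (mpoly.mmeasureD_le _ _ _) _; rewrite geq_max Pm.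
- exists (mpoly.mpolyX R (mpoly.mnm1 i) * P); last first.
    by apply/funext => x; rewrite mpoly.mevalM mpoly.mevalXU.
  have [->|P0] := eqVneq P 0; first by rewrite mulr0 mpoly.mmeasure0.
  rewrite mpoly.msizeM// ?mpoly.msizeX ?mpoly.mdeg1//.
  by rewrite -mpoly.msize_poly_eq0 mpoly.msizeX.
Qed.

Lemma polyfun_slice d n (f : d.+1.-tuple R -> R) t s : polyfun n f ->
  polyfun n (fun xi : d.-tuple R => f (consT (t, [tuple s * tnth xi i | i < d]))).
Proof.
elim=> [m c|m g h _ IHg _ IHh|m i g _ IH]; first exact: polyfun_cst.
- exact: polyfun_add.
- case: (unliftP ord0 i) => [j|] ->.
    apply: (eq_polyfun _ (polyfun_scale s (polyfun_mul j IH))) => xi.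
    by rewrite tnthS tnth_mktuple mulrA.
  apply: (eq_polyfun _ (polyfun_le (leqnSn m) (polyfun_scale t IH))) => xi.
  by rewrite tnth0.
Qed.

End polyfun.

(** * Averages over parallels are polynomials in the height *)

Section average.
Context {R : realType}.
Local Notation leb := (@lebesgue_measure R).
Local Notation L := (@lebesgue_tuple R).
Local Notation dir := (@direction R _).

Lemma direction_cube n (z : n.-tuple R) : cube 1 (dir z).
Proof.
move=> i; rewrite tnth_mktuple normrM normfV (ger0_norm (enorm_ge0 z)).
have [z0|z0] := eqVneq (enorm z) 0; first by rewrite z0 invr0 mulr0.
have zp : 0 < enorm z by rewrite lt_def z0 enorm_ge0.
rewrite ler_pdivrMr// mul1r -(@ler_pXn2r _ 2)// ?nnegrE ?enorm_ge0//.
rewrite sqr_enorm real_normK ?num_real// (bigD1 i)//= lerDl.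
by apply: sumr_ge0 => j _; exact: sqr_ge0.
Qed.

Variable d : nat.
Hypothesis d_gt0 : (0 < d)%N.
Local Notation kappa := (@slice_kernel R d).

Lemma integrable_kernel n (h : d.-tuple R -> R) : polyfun n h ->
  (L d).-integrable setT (fun z => (kappa z * h (dir z))%:E).
Proof.
move=> ph; have [C HC] := polyfun_bounded ph.
have mk := @measurable_slice_kernel R d.
have mh : measurable_fun setT (fun z => h (dir z)).
  exact: (measurableT_comp (measurable_polyfun ph) (@measurable_direction R d)).
apply: (@le_integrable _ _ _ _ _ measurableT _ (fun z => C%:E * (kappa z)%:E)%E).
- by apply/measurable_EFinP; exact: measurable_funM.
- move=> z _; have k0 := slice_kernel_ge0 d_gt0 z.
  rewrite -EFinM !abse_EFin lee_fin (normrM (kappa z)) (normrM C) [leLHS]mulrC.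
  rewrite ler_wpM2r//; apply: le_trans (ler_norm C); apply: HC; exact: direction_cube.
- apply: integrableZl => //; apply/integrableP; split; first exact/measurable_EFinP.
  under eq_integral do rewrite gee0_abs ?lee_fin ?slice_kernel_ge0//.
  by rewrite integral_slice_kernel// ltry.
Qed.

Definition avg (h : d.-tuple R -> R) : R := \int[L d]_z (kappa z * h (dir z)).

Lemma avgD n (g h : d.-tuple R -> R) : polyfun n g -> polyfun n h ->
  avg (fun xi => g xi + h xi) = avg g + avg h.
Proof.
move=> pg ph; rewrite /avg -RintegralD//; [|exact: integrable_kernel pg|exact: integrable_kernel ph].
by apply: eq_Rintegral => z _; rewrite mulrDr.
Qed.

Lemma avgZ n (c : R) (h : d.-tuple R -> R) : polyfun n h ->
  avg (fun xi => c * h xi) = c * avg h.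
Proof.
move=> ph; rewrite /avg -RintegralZl//; last exact: integrable_kernel ph.
by apply: eq_Rintegral => z _; rewrite mulrCA.
Qed.

Lemma avg_cst (c : R) : avg (fun=> c) = c.
Proof.
rewrite -[RHS]mulr1 -[in LHS](mulr1 c) (@avgZ 0 c (fun=> 1)); last exact: polyfun_cst.
congr (_ * _); rewrite /avg /Rintegral.
under eq_integral do rewrite mulr1.
by rewrite integral_slice_kernel.
Qed.

Lemma avg_odd n (h : d.-tuple R -> R) : polyfun n h ->
  (forall xi : d.-tuple R, h [tuple - tnth xi i | i < d] = - h xi) -> avg h = 0.
Proof.
move=> ph hN; pose neg (z : d.-tuple R) := [tuple - tnth z i | i < d].
have enormN z : enorm (neg z) = enorm z.
  by rewrite /enorm; under eq_bigr do rewrite tnth_mktuple sqrrN.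
have mneg : measurable_fun setT neg.
  apply/measurable_fun_tnthP => i.
  rewrite (_ : _ \o _ = fun z : d.-tuple R => - tnth z i); last first.
    by apply/funext => z /=; rewrite tnth_mktuple.
  by apply: measurableT_comp => //; exact: measurable_tnth.
have inv A : measurable A -> L d A = L d (neg @^-1` A).
  move=> mA; apply/esym/lebesgue_tuple_invariant => //.
  - by move=> z; apply: eq_from_tnth => i; rewrite !tnth_mktuple opprK.
  - by move=> a u b v; apply: eq_from_tnth => i; rewrite !(tnth_tcomb, tnth_mktuple); ring.
  - by apply/seteqP; split => z; rewrite /unit_ball/= enormN.
have mint : measurable_fun setT (fun z => (kappa z * h (dir z))%:E).
  by have /integrableP[] := integrable_kernel ph.
have E : avg h = - avg h.
  rewrite {1}/avg /Rintegral (integral_pullback mneg inv mint).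
  rewrite -[RHS]mulN1r /avg -RintegralZl//; last exact: integrable_kernel ph.
  congr fine; apply: eq_integral => z _; congr EFin.
  have -> : dir (neg z) = neg (dir z).
    by apply: eq_from_tnth => i; rewrite !tnth_mktuple enormN mulNr.
  by rewrite slice_kernelN hN; ring.
lra.
Qed.

Let half_pow (b : nat) (s t : R) : s ^+ 2 = 1 - t ^+ 2 -> ~~ odd b ->
  s ^+ b = (1 - t ^+ 2) ^+ b./2.
Proof. by move=> st ob; rewrite -st -exprM mul2n even_halfK. Qed.

(** Generalized for the induction: a coordinate peeled off [f] is either [t], which raises [a], or
    [s * xi_j], which raises [b] and passes [xi_j] to [m]. In the end odd [b] average to 0 by
    [xi -> - xi], while even [b] give [s^b = (1 - t^2)^(b/2)], a polynomial of the same degree [b]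
    in [t]. *)
Lemma avg_polynomial_gen n (f : d.+1.-tuple R -> R) : polyfun n f ->
  forall a b (m : d.-tuple R -> R), polyfun b m ->
  (forall xi : d.-tuple R, m [tuple - tnth xi i | i < d] = (-1) ^+ b * m xi) ->
  exists2 Q : {poly R}, (size Q <= (n + a + b).+1)%N & forall t s,
    s ^+ 2 = 1 - t ^+ 2 ->
    Q.[t] = avg (fun xi => t ^+ a * s ^+ b *
      (m xi * f (consT (t, [tuple s * tnth xi i | i < d])))).
Proof.
elim=> {n f} [n c|n g h pg IHg ph IHh|n i g pg IH] a b m pm mN.
- have [ob|ob] := boolP (odd b).
    exists 0; first by rewrite size_poly0.
    move=> t s _; rewrite horner0 (@avg_odd b)//.
      apply: polyfun_scale; apply: (eq_polyfun _ (polyfun_scale c pm)) => xi.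
      by rewrite mulrC.
    by move=> xi; rewrite mN -signr_odd ob expr1; ring.
  exists ((c * avg m) *: ('X^a * (1 - 'X^2) ^+ b./2)).
    apply: leq_trans (size_scale_leq _ _) _.
    apply: leq_trans (size_polyMleq _ _) _; rewrite size_polyXn /=.
    have s2 : (size (1 - 'X^2 : {poly R})).-1 = 2%N.
      by rewrite -opprB size_polyN size_XnsubC.
    have := size_poly_exp_leq (1 - 'X^2 : {poly R}) b./2.
    rewrite s2 mul2n even_halfK// => zb.
    apply: leq_trans (leq_add (leqnn a) zb) _.
    by rewrite addnS ltnS -addnA leq_addl.
  move=> t s st; rewrite !hornerE -(half_pow st ob).
  transitivity (avg (fun xi => (t ^+ a * s ^+ b * c) * m xi)).
    by rewrite (avgZ _ pm) /=; ring.
  by congr avg; apply/funext => xi; ring.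
- have [Q1 s1 H1] := IHg a b m pm mN; have [Q2 s2 H2] := IHh a b m pm mN.
  exists (Q1 + Q2).
    by apply: leq_trans (size_polyD _ _) _; rewrite geq_max s1.
  move=> t s st; rewrite hornerD (H1 t s st) (H2 t s st).
  have pg' := polyfun_scale (t ^+ a * s ^+ b) (polyfunM pm (polyfun_slice t s pg)).
  have ph' := polyfun_scale (t ^+ a * s ^+ b) (polyfunM pm (polyfun_slice t s ph)).
  by rewrite -(avgD pg' ph'); congr avg; apply/funext => xi; ring.
- case: (unliftP ord0 i) => [j|] ->.
    have pm' : polyfun b.+1 (fun xi => tnth xi j * m xi) by exact: polyfun_mul.
    have [|Q sQ HQ] := IH a b.+1 _ pm'.
      by move=> xi; rewrite tnth_mktuple mN exprS; ring.
    exists Q; first by rewrite (leq_trans sQ)// addnS !addSn.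
    move=> t s st; rewrite (HQ t s st); congr avg; apply/funext => xi.
    by rewrite tnthS tnth_mktuple exprS; ring.
  have [Q sQ HQ] := IH a.+1 b m pm mN.
  exists Q; first by rewrite (leq_trans sQ)// addnS !addSn.
  move=> t s st; rewrite (HQ t s st); congr avg; apply/funext => xi.
  by rewrite tnth0 exprS /=; ring.
Qed.

Lemma avg_polynomial n (f : d.+1.-tuple R -> R) : polyfun n f ->
  exists Q : {poly R}, [/\ (size Q <= n.+1)%N, Q.[1] = f (north d) &
    forall t s, s ^+ 2 = 1 - t ^+ 2 ->
      Q.[t] = avg (fun xi => f (consT (t, [tuple s * tnth xi i | i < d])))].
Proof.
move=> pf; have [||Q sQ HQ] := @avg_polynomial_gen n f pf 0 0 (fun=> 1).
- exact: polyfun_cst.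
- by move=> xi; rewrite mulr1.
have HQ' t s : s ^+ 2 = 1 - t ^+ 2 ->
    Q.[t] = avg (fun xi => f (consT (t, [tuple s * tnth xi i | i < d]))).
  by move=> st; rewrite (HQ t s st); congr avg; apply/funext => xi; rewrite !expr0 !mul1r.
exists Q; split => //; first by rewrite !addn0 in sQ.
(* At height 1 the parallel has radius 0 and shrinks to the pole. *)
rewrite (HQ' 1 0); last by rewrite expr1n subrr expr0n.
rewrite -[RHS]avg_cst; congr avg; apply/funext => xi; congr f.
apply: eq_from_tnth => i; case: (unliftP ord0 i) => [j|] ->.
  by rewrite tnthS !tnth_mktuple mul0r eq_sym (negPf (neq_lift _ _)).
by rewrite tnth0 tnth_mktuple eqxx.
Qed.

End average.

Section surface_average.
Context {R : realType}.
Local Notation leb := (@lebesgue_measure R).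
Local Notation L := (@lebesgue_tuple R).
Local Notation dir := (@direction R _).
Variable d : nat.
Hypothesis d_gt0 : (0 < d)%N.
Local Notation kappa := (@slice_kernel R d).

Lemma sphere_slice (x : d.+1.-tuple R) : sphere x ->
  x = consT (tnth x ord0, [tuple Num.sqrt (1 - tnth x ord0 ^+ 2) *
        tnth (dir [tuple of behead x]) i | i < d]).
Proof.
move=> /sphere_dot x1; set y := [tuple of behead x].
have yE i : tnth y i = tnth x (lift ord0 i).
  by rewrite /y tnth_behead; congr tnth; apply: val_inj; rewrite /= inordK// ltnS.
have e : Num.sqrt (1 - tnth x ord0 ^+ 2) = enorm y.
  rewrite enormE; congr Num.sqrt; rewrite -x1 /dot big_ord_recl expr2 addrC addKr.
  by apply: eq_bigr => i _; rewrite yE.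
rewrite e; apply: eq_from_tnth => i; case: (unliftP ord0 i) => [j|] ->; rewrite ?tnth0//.
rewrite tnthS !tnth_mktuple -yE.
have [y0|y0] := eqVneq (enorm y) 0; last by rewrite mulrCA divff// mulr1.
by rewrite y0 mul0r; apply/eqP; rewrite -normr_le0; apply: enorm_eq0.
Qed.

Lemma slice_cube (t : R) (xi : d.-tuple R) : -1 < t < 1 -> cube 1 xi ->
  cube 1 (consT (t, [tuple Num.sqrt (1 - t ^+ 2) * tnth xi i | i < d])).
Proof.
move=> t1 xi1 i; case: (unliftP ord0 i) => [j|] ->.
  rewrite tnthS tnth_mktuple normrM ger0_norm ?sqrtr_ge0//.
  rewrite -[leRHS]mulr1; apply: ler_pM => //.
  by rewrite -[leRHS]sqrtr1 ler_sqrt// gerBl sqr_ge0.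
by case/andP: t1 => t1 t2; rewrite tnth0 ler_norml !ltW.
Qed.

(** Fubini in slice coordinates, the inner integral being the average of [f] over a parallel. Since
    [f] is bounded, integrability of [g] suffices; this matters because [g] will be [G_n - F] with
    [F] merely integrable. *)
Lemma surface_average_north n (f : d.+1.-tuple R -> R) : polyfun n f ->
  exists Q : {poly R}, [/\ (size Q <= n.+1)%N, Q.[1] = f (north d) &
    forall g : R -> R, (wdm d).-integrable setT (EFin \o g) ->
    (\int[@surface R d]_x (f x * g (tnth x ord0))%:E =
     \int[wdm d]_t (Q.[t] * g t)%:E)%E].
Proof.
move=> pf; have [Q [sQ Q1 HQ]] := avg_polynomial d_gt0 pf.
exists Q; split => // g ig.
have mg : measurable_fun setT g by case/integrableP : ig => /measurable_EFinP.
have mf := measurable_polyfun pf.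
have mk := @measurable_slice_kernel R d.
have mwdo := @measurable_wdo R d.
pose pt (p : R * d.-tuple R) := consT (p.1, [tuple Num.sqrt (1 - p.1 ^+ 2) * tnth p.2 i | i < d]).
have mpt : measurable_fun setT pt.
  apply: (measurableT_comp (@measurable_consT R d)); apply: measurable_fun_pair => //.
  apply/measurable_fun_tnthP => i.
  rewrite (_ : _ \o _ = fun p : R * d.-tuple R => Num.sqrt (1 - p.1 ^+ 2) * tnth p.2 i); last first.
    by apply/funext => p /=; rewrite tnth_mktuple.
  apply: measurable_funM; last exact: (measurableT_comp (measurable_tnth _)).
  apply: (@measurableT_comp _ _ _ _ _ _ (@Num.sqrt R)).
    by apply: continuous_measurable_fun; exact: sqrt_continuous.
  by apply: measurable_funB => //; exact: measurable_funX.
pose F (p : R * d.-tuple R) : \bar R := (f (pt p) * g p.1)%:E.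
have mF : measurable_fun setT F.
  apply/measurable_EFinP/measurable_funM; first exact: measurableT_comp.
  exact: measurableT_comp.
have mh : measurable_fun setT (fun x : d.+1.-tuple R => tnth x ord0) by exact: measurable_tnth.
have mdb : measurable_fun setT (fun x : d.+1.-tuple R => dir [tuple of behead x]).
  apply: (measurableT_comp (@measurable_direction R d)); exact: measurable_behead.
(* A point is recovered from its height and direction only on the sphere, which has full measure. *)
transitivity (\int[@surface R d]_x F (tnth x ord0, dir [tuple of behead x]))%E.
  apply: ae_eq_integral => //.
  - by apply/measurable_EFinP/measurable_funM => //; exact: measurableT_comp.
  - by apply: (measurableT_comp mF); exact: measurable_fun_pair.
  - have := @ae_surface_sphere R d; apply: filterS => x xS _.
    by rewrite /F /pt/= -sphere_slice.
rewrite (integral_slice d_gt0 mF).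
have mdir2 : measurable_fun setT (fun p : R * d.-tuple R => dir p.2).
  exact: (measurableT_comp (@measurable_direction R d)).
pose K (p : R * d.-tuple R) : \bar R := (F (p.1, dir p.2) * (wdo d p.1 * kappa p.2)%:E)%E.
have mK : measurable_fun setT K.
  apply: emeasurable_funM.
    by apply: (measurableT_comp mF); exact: measurable_fun_pair.
  apply/measurable_EFinP/measurable_funM; first exact: (measurableT_comp mwdo).
  exact: (measurableT_comp mk).
have [C HC] := polyfun_bounded pf.
have C0 : 0 <= `|C| by [].
have iK : (leb \x L d)%E.-integrable setT K.
  apply/integrable12ltyP => //.
  apply: (@le_lt_trans _ _ (\int[leb]_t (`|C|%:E * (`|g t|%:E * (wdo d t)%:E)))%E).
    apply: ge0_le_integral => //.
    - by move=> t _; exact: integral_ge0.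
    - apply: (@measurable_fun_fubini_tonelli_F _ _ _ _ _ (L d) (abse \o K)).
        exact: measurableT_comp.
      by move=> p; exact: abse_ge0.
    - apply/measurable_EFinP; apply: measurable_funM => //.
      by apply: measurable_funM => //; exact: measurableT_comp.
    move=> t _; apply: (@le_trans _ _ (\int[L d]_z (`|C|%:E * (`|g t|%:E * (wdo d t)%:E) * (kappa z)%:E))%E).
      apply: ge0_le_integral => //.
      + by apply: measurableT_comp => //; apply: (measurableT_comp mK); exact: pair1_measurable.
      + by apply/measurable_EFinP; exact: measurable_funM.
      move=> z _; rewrite /K /F -!EFinM abse_EFin lee_fin/=.
      have w0 := wdo_ge0 d_gt0 t; have k0 := slice_kernel_ge0 d_gt0 z.
      move: (kappa z) k0 => k k0.
      rewrite normrM (ger0_norm (mulr_ge0 w0 k0)) !mulrA ler_wpM2r//.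
      rewrite normrM /wdo; case: ifPn => [t1|_]; last by rewrite !mulr0.
      rewrite ler_wpM2r ?wd_ge0// ler_wpM2r//.
      apply: le_trans (ler_norm C); apply: HC; apply: slice_cube => //.
      exact: direction_cube.
    rewrite ge0_integralZl//.
    - by rewrite integral_slice_kernel// mule1.
    - exact/measurable_EFinP.
    - by move=> z _; rewrite lee_fin slice_kernel_ge0.
    - by rewrite !mule_ge0// lee_fin// wdo_ge0.
  rewrite ge0_integralZl_EFin//.
  - rewrite lte_mul_pinfty//.
    rewrite -(integral_wdm d_gt0 (f := fun t => `|g t|%:E)); last first.
      by apply/measurable_EFinP; exact: measurableT_comp.
    by case/integrableP : ig.
  - by move=> t _; rewrite mule_ge0// lee_fin wdo_ge0.
  - apply/measurable_EFinP; apply: measurable_funM => //.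
    exact: measurableT_comp.
rewrite -(integral12_prod_meas1 iK) integral_wdm//; last first.
  apply/measurable_EFinP; apply: measurable_funM => //.
  by apply: continuous_measurable_fun; exact: continuous_horner.
apply: eq_integral => t _.
have [t1|t1] := boolP (-1 < t < 1); last first.
  rewrite /wdo (negPf t1) mule0 [LHS]integral0_eq// => z _.
  by rewrite /K /wdo/= (negPf t1) mul0r mule0.
have v0 : 0 < 1 - t ^+ 2 by nra.
rewrite (HQ t (Num.sqrt (1 - t ^+ 2))); last by rewrite sqr_sqrtr// ltW.
have pfs := polyfun_slice t (Num.sqrt (1 - t ^+ 2)) pf.
have ik := integrable_kernel d_gt0 pfs.
set h := fun xi : d.-tuple R => f _ in pfs ik *.
transitivity ((\int[L d]_z (kappa z * h (dir z))%:E) * (g t * wdo d t)%:E)%E; last first.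
  by rewrite -[X in (X * _)%E]fineK ?(integrable_fin_num _ ik)// -!EFinM mulrA.
rewrite -integralZr//; apply: eq_integral => z _.
by rewrite /K /F -!EFinM /h /pt/=; congr EFin; ring.
Qed.

Lemma surface_average n (f : d.+1.-tuple R -> R) (x0 : d.+1.-tuple R) :
  polyfun n f -> sphere x0 ->
  exists Q : {poly R}, [/\ (size Q <= n.+1)%N, Q.[1] = f x0 &
    forall g : R -> R, (wdm d).-integrable setT (EFin \o g) ->
    (\int[@surface R d]_x (f x * g (dot x0 x))%:E =
     \int[wdm d]_t (Q.[t] * g t)%:E)%E].
Proof.
move=> pf xS; have [Q [sQ Q1 HQ]] := surface_average_north (polyfun_house x0 pf).
exists Q; split => //; first by rewrite Q1/= house_north.
move=> g ig; rewrite -HQ//.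
have mg : measurable_fun setT g by case/integrableP : ig => /measurable_EFinP.
have mh := @measurable_house R d x0.
have mdot : measurable_fun setT (dot x0).
  apply: measurable_sum => i; apply: measurable_funM => //; exact: measurable_tnth.
have mfg : measurable_fun setT (fun x => (f x * g (dot x0 x))%:E).
  apply/measurable_EFinP/measurable_funM; first exact: measurable_polyfun pf.
  exact: measurableT_comp.
rewrite (@integral_pullback _ _ _ _ _ (@surface R d) (@surface R d) (house x0) mh _ _ mfg).
  by apply: eq_integral => x _; rewrite /= -house_tnth0// houseK.
by move=> A mA; exact/esym/surface_house.
Qed.

End surface_average.

(** * Moments of the weight and Jacobi polynomials *)

Section moments.
Context {R : realType}.
Local Notation leb := (@lebesgue_measure R).
Variable d : nat.
Hypothesis d_gt0 : (0 < d)%N.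

Lemma integrable_wdm (g : R -> R) (C : R) : measurable_fun setT g ->
  (forall t, -1 < t < 1 -> `|g t| <= C) -> (wdm d).-integrable setT (EFin \o g).
Proof.
move=> mg gC; apply/integrableP; split; first exact/measurable_EFinP.
have ma : measurable_fun setT (fun t => `|(g t)%:E|%E) by apply/measurable_EFinP; exact: measurableT_comp.
rewrite (integral_wdm d_gt0 ma).
apply: (@le_lt_trans _ _ (\int[leb]_t (cst `|C|%:E t * (wdo d t)%:E))%E).
  have mw := @measurable_wdo R d.
  apply: ge0_le_integral => //.
  - by move=> t _; rewrite mule_ge0// lee_fin wdo_ge0.
  - by apply: emeasurable_funM => //; exact/measurable_EFinP.
  - by apply: emeasurable_funM => //; exact/measurable_EFinP.
  - move=> t _; rewrite /wdo; case: ifPn => [t1|_]; last by rewrite !mule0.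
    rewrite lee_wpmul2r ?lee_fin ?wd_ge0//=.
    by apply: le_trans (ler_norm C); exact: gC.
rewrite -(integral_wdm d_gt0 (measurable_cst _)) (integral_cst _ measurableT).
by rewrite [X in (_ * X)%E](wdm_setT d_gt0) mule1 ltry.
Qed.

Lemma wd_gt0 (t : R) : -1 < t < 1 -> 0 < wd d t.
Proof.
move=> t1; rewrite /wd mulr_gt0 ?wd_const_gt0// powR_gt0//; nra.
Qed.

Lemma wdm_null (N : set R) : measurable N -> wdm d N = 0%E ->
  leb (N `&` `]-1, 1[%classic) = 0%E.
Proof.
move=> mN N0; have mw := @measurable_wdo R d.
have m1 : measurable_fun setT (fun t => (\1_N t)%:E * (wdo d t)%:E)%E.
  apply: emeasurable_funM; last exact/measurable_EFinP.
  by apply/measurable_EFinP; exact: measurable_indic.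
have : (\int[leb]_t `|(\1_N t)%:E * (wdo d t)%:E| = 0)%E.
  rewrite -[RHS]N0 -[in RHS](setIT N) -(integral_indic (wdm d) measurableT mN).
  rewrite (integral_wdm d_gt0); last by apply/measurable_EFinP; exact: measurable_indic.
  by apply: eq_integral => t _; rewrite gee0_abs// mule_ge0 ?lee_fin ?wdo_ge0.
move/(ae_eq_integral_abs leb measurableT m1) => [M [mM M0 NM]].
apply/eqP; rewrite -measure_le0 -[leRHS]M0; apply: le_measure; rewrite ?inE//.
  exact: measurableI.
move=> t [Nt]; rewrite /= in_itv/= => t1; apply: NM => /= /(_ I).
rewrite /wdo t1 indicE mem_set// mul1e => -[] /eqP; apply/negP.
by rewrite gt_eqF// wd_gt0.
Qed.

(** The weight is positive on ]-1, 1[, so null sets contain no interval there. Endpoints are allowed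
    for [t] because the value of a polynomial at 1 has to be compared with an essential supremum. *)
Lemma wdm_ae_open (A : set R) (t : R) : open A -> A t -> -1 <= t <= 1 ->
  ~ {ae wdm d, forall x, ~ A x}.
Proof.
move=> oA At t1 [N [mN N0 AN]].
have /nbhs_ballP[e /= e0 eA] := oA t At.
(* Contracting towards 0 moves an endpoint inside ]-1, 1[; the bound [e / 2] keeps [u] in the ball
   and the bound 1/2 keeps the factor positive. *)
pose u := (1 - Num.min (e / 2) 2^-1) * t; set de := Num.min _ _ in u.
have de0 : 0 < de by rewrite lt_min divr_gt0//= invr_gt0.
have de1 : de <= 2^-1 by rewrite ge_min lexx orbT.
have dee : de <= e / 2 by rewrite ge_min lexx.
have u1 : -1 < u < 1 by case/andP: t1 => t1 t2; apply/andP; split; rewrite /u; nra.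
have Au : A u.
  apply: eA; rewrite /ball/= /u mulrBl mul1r opprB addrCA subrr addr0 normrM gtr0_norm//.
  have : `|t| <= 1 by rewrite ler_norml.
  move=> ht; apply: (@le_lt_trans _ _ de); first by rewrite ler_piMr// ltW.
  by apply: le_lt_trans dee _; rewrite ltr_pdivrMr// mulr_natr mulr2n ltrDl.
have oB : open (A `&` `]-1, 1[%classic) by apply: openI => //; exact: interval_open.
have /nbhs_ballP[r /= r0 rB] : nbhs u (A `&` `]-1, 1[%classic).
  by apply: oB; split => //; rewrite /= in_itv.
have : (leb (ball u r) <= leb (N `&` `](-1)%R, 1%R[%classic))%E.
  apply: le_measure; rewrite ?inE; [exact: measurable_ball|exact: measurableI|].
  by move=> x /rB[Ax x1]; split => //; apply: AN => /=; exact.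
rewrite (wdm_null mN N0) (lebesgue_measure_ball _ (ltW r0)) lee_fin => h.
by move: r0; rewrite ltNge; have -> : r <= 0 by lra.
Qed.

Definition mom (P : {poly R}) : R := \int[wdm d]_t P.[t].

Lemma horner_bounded (P : {poly R}) :
  exists C, forall t, -1 <= t <= 1 -> `|P.[t]| <= C.
Proof.
exists (\sum_(i < size P) `|P`_i|) => t t1; rewrite horner_coef.
apply: le_trans (ler_norm_sum _ _ _) _; apply: ler_sum => i _.
rewrite normrM ler_piMr// normrX exprn_ile1// ler_norml//.
Qed.

Lemma measurable_horner (P : {poly R}) : measurable_fun setT (horner P).
Proof. by apply: continuous_measurable_fun; exact: continuous_horner. Qed.

Lemma integrable_horner (P : {poly R}) : (wdm d).-integrable setT (EFin \o horner P).
Proof.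
have [C HC] := horner_bounded P.
apply: (@integrable_wdm _ C); first exact: measurable_horner.
by move=> t /andP[t1 t2]; apply: HC; rewrite !ltW.
Qed.

Lemma EFin_mom (P : {poly R}) : ((mom P)%:E = \int[wdm d]_t (P.[t])%:E)%E.
Proof. by rewrite /mom /Rintegral fineK//; exact: integrable_fin_num (integrable_horner P). Qed.

Lemma momD (P Q : {poly R}) : mom (P + Q) = mom P + mom Q.
Proof.
rewrite /mom -RintegralD//; [|exact: integrable_horner|exact: integrable_horner].
by apply: eq_Rintegral => t _; rewrite hornerD.
Qed.

Lemma momZ c (P : {poly R}) : mom (c *: P) = c * mom P.
Proof.
rewrite /mom -RintegralZl//; last exact: integrable_horner.
by apply: eq_Rintegral => t _; rewrite hornerZ.
Qed.

Lemma mom0 : mom 0 = 0.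
Proof. by rewrite -(scale0r 0) momZ mul0r. Qed.

Lemma momN (P : {poly R}) : mom (- P) = - mom P.
Proof. by rewrite -scaleN1r momZ mulN1r. Qed.

Lemma mom_sum (I : Type) (s : seq I) (P : I -> {poly R}) :
  mom (\sum_(i <- s) P i) = \sum_(i <- s) mom (P i).
Proof. by elim: s => [|i s IH]; rewrite ?big_nil ?mom0// !big_cons momD IH. Qed.

Lemma wdm_ae_horner (P : {poly R}) : {ae wdm d, forall t, P.[t] = 0} -> P = 0.
Proof.
move=> ae0; apply: contrapT => /eqP P0.
have [k kP] : exists k : nat, P.[(k.+2%:R)^-1] != 0.
  apply: contrapT => /forallNP h; move/eqP: P0; apply.
  apply: (@roots_geq_poly_eq0 _ _ [seq (k.+2%:R)^-1 | k <- iota 0 (size P)]).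
  - by apply/allP => _ /mapP[k _ ->]; rewrite rootE; apply/negPn/negP; exact: h.
  - rewrite map_inj_uniq ?iota_uniq// => i j /invr_inj/eqP.
    by rewrite eqr_nat => /eqP[].
  - by rewrite size_map size_iota.
have oP : open [set t | P.[t] != 0].
  rewrite (_ : [set t | _] = horner P @^-1` [set x | x != 0]) //.
  apply: open_comp => [x _|]; first exact: continuous_horner.
  exact: open_neq.
apply: (@wdm_ae_open [set t | P.[t] != 0] _ oP kP).
  have k0 : 0 < (k.+2%:R : R)^-1 by rewrite invr_gt0.
  apply/andP; split; first by apply: le_trans (ltW k0); rewrite lerN10.
  by rewrite invf_le1 ?ltr0n// ler1n.
by apply: filterS ae0 => t t0 /=; rewrite t0 eqxx.
Qed.

Lemma mom_sqr_gt0 (P : {poly R}) : P != 0 -> 0 < mom (P * P).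
Proof.
move=> P0; rewrite lt_def; apply/andP; split; last first.
  by apply: Rintegral_ge0 => t _; rewrite hornerM -expr2 sqr_ge0.
apply/eqP => e.
have mPP := measurable_horner (P * P).
have : (\int[wdm d]_t `|((P * P).[t])%:E| = 0)%E.
  rewrite -[RHS](congr1 EFin e) EFin_mom; apply: eq_integral => t _.
  by rewrite gee0_abs// lee_fin hornerM -expr2 sqr_ge0.
have mPP' : measurable_fun setT (EFin \o horner (P * P)) by exact/measurable_EFinP.
move/(ae_eq_integral_abs (wdm d) measurableT mPP') => ae0.
move/eqP: P0; apply; apply: wdm_ae_horner; apply: filterS ae0 => t /(_ I) [] /eqP.
by rewrite hornerM mulf_eq0 orbb => /eqP.
Qed.

End moments.

(** * Integration by parts for the weight *)

Section parts.
Context {R : realType}.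
Local Notation leb := (@lebesgue_measure R).
Variable d : nat.
Hypothesis d_gt0 : (0 < d)%N.

Lemma continuous_sqrt1B : continuous (fun x : R => Num.sqrt (1 - x ^+ 2)).
Proof.
move=> t; apply: (@cvg_comp _ _ _ (fun x : R => 1 - x ^+ 2)); last exact: sqrt_continuous.
by apply: cvgB; [exact: cvg_cst|exact: exprn_continuous].
Qed.

(** Up to a constant, polynomial times weight is the derivative of [(1 - t^2)^(d/2) Q(t)], which
    vanishes at both endpoints. As the weight is unbounded for [d = 1], the fundamental theorem is
    applied on [[- r k, r k]] and the limit is taken by dominated convergence. *)
Lemma mom_parts (Q : {poly R}) :
  mom d ((1 - 'X^2) * Q^`() - d%:R *: ('X * Q)) = 0.
Proof.
set P : {poly R} := _ - _.
pose s : R -> R := fun t => Num.sqrt (1 - t ^+ 2).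
pose w : R -> R := fun t => s t ^+ d.+1 * dstereo t.
pose f : R -> R := fun t => w t * P.[t].
pose H : R -> R := fun t => s t ^+ d * Q.[t].
have w_out (t : R) : ~~ (-1 < t < 1) -> w t = 0.
  by move=> t1; rewrite /w dstereo_out// mulr0.
have cw (t : R) : -1 < t < 1 -> {for t, continuous w}.
  move=> t1; apply: cvgM; last exact: continuous_dstereo.
  apply: (@cvg_comp _ _ _ s (fun x => x ^+ d.+1)); last exact: exprn_continuous.
  exact: continuous_sqrt1B.
have cf (t : R) : -1 < t < 1 -> {for t, continuous f}.
  by move=> t1; apply: cvgM; [exact: cw|exact: continuous_horner].
have dH (t : R) : -1 < t < 1 -> is_derive t (1 : R) H (f t).
  move=> t1; have v0 : 0 < 1 - t ^+ 2 by nra.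
  have s0 : s t != 0 by rewrite sqrtr_eq0 -ltNge.
  have ds := is_deriveX d (is_derive_sqrt1B t1).
  have h := is_deriveM ds (is_derive_poly Q t).
  have HE : H = (s ^+ d * horner Q : R -> R) by apply/funext => x; rewrite /H !fctE.
  rewrite HE; apply: (is_derive_eq h); rewrite /GRing.scale/= ?fctE -/(s t) /f /w /dstereo -/(s t).
  have s2 : s t ^+ 2 = 1 - t ^+ 2 by rewrite sqr_sqrtr// ltW.
  have -> : P.[t] = s t ^+ 2 * Q^`().[t] - d%:R * (t * Q.[t]).
    by rewrite /P s2 !hornerE.
  move: d_gt0; case: (d) => // e _ /=; rewrite !exprS; field.
  exact: s0.
have mw : measurable_fun setT w.
  apply: measurable_funM; last exact: measurable_dstereo.
  by apply: measurable_funX; apply: continuous_measurable_fun; exact: continuous_sqrt1B.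
have mf : measurable_fun setT f by apply: measurable_funM => //; exact: measurable_horner.
have c0 := wd_const_gt0 (R := R) d_gt0.
have fE t : P.[t] * wdo d t = wd_const d * f t by rewrite wdo_sqrt /f /w; ring.
have iPw : leb.-integrable setT (fun t => (P.[t] * wdo d t)%:E).
  apply/integrableP; split.
    apply/measurable_EFinP; apply: measurable_funM; first exact: measurable_horner.
    exact: measurable_wdo.
  have /integrableP[_] := integrable_horner d_gt0 P.
  rewrite (integral_wdm d_gt0 (f := fun t => `|(P.[t])%:E|%E)); last first.
    by apply/measurable_EFinP; apply: measurableT_comp => //; exact: measurable_horner.
  congr (_ < _)%E; apply: eq_integral => t _.
  by rewrite !abse_EFin -EFinM normrM (ger0_norm (wdo_ge0 d_gt0 t)).
have ifl : leb.-integrable setT (EFin \o f).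
  apply: eq_integrable (integrableZl measurableT (wd_const d)^-1 iPw) => // t _.
  by rewrite -EFinM /= fE mulrA mulVf ?mul1r// gt_eqF.
suff f0 : (\int[leb]_t (f t)%:E = 0)%E.
  apply: EFin_inj; rewrite EFin_mom// (integral_wdm d_gt0); last first.
    by apply/measurable_EFinP; exact: measurable_horner.
  under eq_integral do rewrite -EFinM fE EFinM.
  by rewrite integralZl// f0 mule0.
(* With [k.+2] the radius is positive already for [k = 0]. *)
pose r (k : nat) : R := 1 - (k.+2%:R)^-1.
have r0 k : 0 < r k by rewrite subr_gt0 invf_lt1// ltr1n.
have r1 k : r k < 1 by rewrite ltrBlDr ltrDl invr_gt0.
have rcvg : r k @[k --> \oo] --> (1 : R).
  rewrite -[X in _ --> X]subr0; apply: cvgB; first exact: cvg_cst.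
  by have := @cvg_harmonic R; rewrite -(cvg_shiftS _).
pose fk (k : nat) := (EFin \o f) \_ `[- r k, r k].
have mEf : measurable_fun setT (EFin \o f) by exact/measurable_EFinP.
have mfk k : measurable_fun setT (fk k).
  by apply/(measurable_restrictT _ _).1 => //; exact: measurable_funTS.
have fkf : {ae leb, forall t, setT t -> fk ^~ t @ \oo --> (f t)%:E}.
  apply/nearW => t _; have [t1|t1] := boolP (-1 < t < 1); last first.
    have ft0 : f t = 0 by rewrite /f w_out// mul0r.
    rewrite ft0 (_ : fk ^~ t = cst 0%E); first exact: cvg_cst.
    by apply/funext => k; rewrite /fk patchE /= ft0; case: ifP.
  have tr : \forall k \near \oo, `|t| < r k.
    by apply: (cvgr_gt 1 rcvg); rewrite ltr_norml.
  apply: cvg_near_cst; near=> k; rewrite /fk patchE mem_setE in_itv/= ifT//.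
  rewrite -ler_norml ltW//; near: k; exact: tr.
have ig : leb.-integrable setT (fun t => `|(f t)%:E|%E).
  exact: integrable_abse.
have fkg : {ae leb, forall t k, setT t -> (`|fk k t| <= `|(f t)%:E|)%E}.
  apply/nearW => t k _; rewrite /fk patchE; case: ifP => // _.
  by rewrite abse0.
have [_ _ fkcvg] := @dominated_convergence _ _ _ leb setT measurableT fk _ _ mfk mEf fkf ig fkg.
have Hc : continuous H.
  move=> t; apply: cvgM; last exact: continuous_horner.
  apply: (@cvg_comp _ _ _ s (fun x => x ^+ d)); last exact: exprn_continuous.
  exact: continuous_sqrt1B.
have fkE k : (\int[leb]_t fk k t = (H (r k) - H (- r k))%:E)%E.
  rewrite -[LHS]integral_mkcond; apply: integral_derive.
  - by rewrite (lt_trans _ (r0 k))// oppr_lt0.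
  - move=> x; rewrite in_itv/= => /andP[x1 x2]; apply: dH.
    by rewrite (lt_le_trans _ x1) ?(le_lt_trans x2)// ltrN2.
  - move=> x; rewrite in_itv/= => /andP[x1 x2]; apply: cf.
    by rewrite (lt_le_trans _ x1) ?(le_lt_trans x2)// ltrN2.
have H1 : H 1 = 0 by rewrite /H /s expr1n subrr sqrtr0 expr0n gtn_eqF// mul0r.
have HN1 : H (- 1) = 0 by rewrite /H /s sqrrN expr1n subrr sqrtr0 expr0n gtn_eqF// mul0r.
have Hcvg : (H (r k) - H (- r k))%:E @[k --> \oo] --> (0%E : \bar R).
  have -> : 0%E = (H 1 - H (- 1))%:E :> \bar R by rewrite H1 HN1 subrr.
  apply: cvg_EFin; first exact: nearW.
  apply: cvgB; first exact: (@continuous_cvg _ _ _ _ _ r H _ (Hc 1) rcvg).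
  exact: (@continuous_cvg _ _ _ _ _ (fun k => - r k) H _ (Hc (- 1)) (cvgN rcvg)).
have E : (fun k => (H (r k) - H (- r k))%:E) = (fun k => \int[leb]_t fk k t)%E.
  by apply/funext => k; rewrite -fkE.
rewrite E in Hcvg; exact: (cvg_unique _ fkcvg Hcvg).
Unshelve. all: by end_near. Qed.

End parts.

(** * Rising factorials and finite differences *)

Section rising.
Context {R : realType}.

Let bump0S i : bump 0 i = i.+1. Proof. by []. Qed.

Definition rising (r : nat) (x : R) := \prod_(i < r) (x + i%:R).

Lemma rising_diff r (x : R) : rising r.+1 (x + 1) - rising r.+1 x = r.+1%:R * rising r (x + 1).
Proof.
rewrite /rising big_ord_recr big_ord_recl/= addr0.
under [X in _ - _ * X]eq_bigr => i _ do rewrite bump0S -natr1 [_ + 1]addrC addrA.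
by rewrite -natr1; ring.
Qed.

Lemma risingD r k (x : R) : rising (k + r) x = rising k x * rising r (x + k%:R).
Proof.
rewrite /rising big_split_ord/=; congr (_ * _).
by apply: eq_bigr => i _; rewrite natrD addrA.
Qed.

Lemma rising_gt0 r (x : R) : 0 < x -> 0 < rising r x.
Proof. by move=> x0; apply: prodr_gt0 => i _; rewrite ltr_wpDr. Qed.

(** Up to sign this is the [n]-th finite difference of a polynomial of degree [r < n]. Pascal's rule
    extracts one difference, which lowers the degree by [rising_diff]. *)
Lemma alternating_rising n r (x : R) : (r < n)%N ->
  \sum_(k < n.+1) (-1) ^+ k * 'C(n, k)%:R * rising r (x + k%:R) = 0.
Proof.
elim: n r x => [//|n IH] r x rn.
pose S m y := \sum_(k < m.+1) (-1) ^+ k * 'C(m, k)%:R * rising r (y + k%:R).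
have SS : S n.+1 x = S n x - S n (x + 1).
  rewrite /S big_ord_recl/= [X in _ = X - _]big_ord_recl/=.
  rewrite !bin0 -addrA; congr (_ + _).
  under eq_bigr => i _ do rewrite bump0S binS natrD mulrDr mulrDl.
  rewrite big_split/=; congr (_ + _).
    rewrite big_ord_recr/= bin_small// mulr0 mul0r addr0.
    by apply: eq_bigr => i _; rewrite bump0S.
  rewrite -sumrN; apply: eq_bigr => i _.
  by rewrite exprS -natr1 (addrC _ 1) addrA; ring.
rewrite -/(S n.+1 x) SS /S; case: r rn @S SS => [|r] rn S SS.
  rewrite -sumrB; apply: big1 => i _.
  by rewrite /rising !big_ord0 subrr.
rewrite -[LHS]opprB -sumrB; apply/eqP; rewrite oppr_eq0; apply/eqP.
under eq_bigr => k _ do rewrite -mulrBr (addrAC x) rising_diff mulrCA (addrAC x _ 1).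
by rewrite -mulr_sumr IH ?mulr0.
Qed.

End rising.

(** * Jacobi polynomials and evaluation at 1 *)

Section jacobi_orthogonality.
Context {R : realType}.
Variable d : nat.
Hypothesis d_gt0 : (0 < d)%N.
Local Notation M := (@mom R d).

Let p : {poly R} := 1 - 'X.
Let q : {poly R} := 1 + 'X.
Let mu k j := M (p ^+ k * q ^+ j).

Let deriv_p k : p * (p ^+ k)^`() = - (k%:R *: p ^+ k).
Proof.
rewrite deriv_exp /p derivB derivC derivX sub0r; case: k => [|k].
  by rewrite mulr0n mulr0 scale0r oppr0.
by rewrite exprS -mulr_natl -mul_polyC rmorph_nat/=; ring.
Qed.

Let deriv_q k : q * (q ^+ k)^`() = k%:R *: q ^+ k.
Proof.
rewrite deriv_exp /q derivD derivC derivX add0r; case: k => [|k].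
  by rewrite mulr0n mulr0 scale0r.
by rewrite exprS -mulr_natl -mul_polyC rmorph_nat/=; ring.
Qed.

(** The [mu k j] are beta integrals. Two linear relations between neighbours give the recursion:
    [p + q = 2], and integration by parts for [p^k q^j]. *)
Let mu_rec k j : (k%:R + j%:R + d%:R) * mu k.+1 j = (2 * k%:R + d%:R) * mu k j.
Proof.
have split : mu k.+1 j + mu k j.+1 = 2 * mu k j.
  rewrite -momD// -momZ//; congr (mom _ _).
  by rewrite !exprS -mul_polyC rmorph_nat /p /q; ring.
have parts : (j%:R + d%:R / 2) * mu k.+1 j = (k%:R + d%:R / 2) * mu k j.+1.
  apply/eqP; rewrite -subr_eq0 -!momZ// -momN// -momD//; apply/eqP.
  rewrite -(mom_parts d_gt0 (p ^+ k * q ^+ j)); congr (mom _ _).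
  rewrite derivM.
  have -> : (1 - 'X^2) = p * q by rewrite /p /q; ring.
  have -> : p * q * ((p ^+ k)^`() * q ^+ j + p ^+ k * (q ^+ j)^`()) =
    (p * (p ^+ k)^`()) * (q * q ^+ j) + (p * p ^+ k) * (q * (q ^+ j)^`()) by ring.
  rewrite deriv_p deriv_q -!mul_polyC !polyCD !exprS.
  have -> : d%:R%:P = 2 * (d%:R / 2)%:P :> {poly R}.
    have two : (2 : R)%:P = 2 :> {poly R} by rewrite -[2]/(2%:R) rmorph_nat.
    by rewrite -two -polyCM; congr polyC; field.
  by rewrite /p /q; ring.
have : mu k j.+1 = 2 * mu k j - mu k.+1 j by rewrite -split; ring.
by move: parts => /[swap] -> e; apply/eqP; rewrite -subr_eq0; apply/eqP; lra.
Qed.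

(** The recursion is started at [mu 1 j] because every later moment carries the extra factor [p] of
    the Jacobi weight [(1 - t) w_d]. *)
Let muE k j : mu k.+1 j * rising k (j.+1%:R + d%:R) =
  mu 1 j * (2 ^+ k * rising k (d%:R / 2 + 1)).
Proof.
elim: k => [|k IH]; first by rewrite /rising !big_ord0 expr0 !mulr1.
rewrite /rising !big_ord_recr/= -/(rising k _) -/(rising k (_ + 1)).
have r := mu_rec k.+1 j.
have e : (j.+1%:R + d%:R + k%:R) = (k.+1%:R + j%:R + d%:R) :> R by rewrite -!natr1; ring.
rewrite e [LHS]mulrCA [_ * (_ + _)]mulrC r exprS.
transitivity ((2 * (k%:R + 1) + d%:R) * (mu k.+1 j * rising k (j.+1%:R + d%:R))).
  by rewrite -natr1; ring.
by rewrite IH; field.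
Qed.

Local Notation J n := (jacobi (d%:R / 2) ((d%:R - 2) / 2) n : {poly R}).

(** Against powers of [1 + t] every term of the Jacobi sum is an explicit beta integral. Its
    quotient [rising k (N + r) / rising k N] equals [rising r (N + k) / rising r N], polynomial in
    [k] of degree [r = n - j - 1], so the alternating sum is an [n]-th difference that vanishes. *)
Let jacobi_orth_basis n j : (j < n)%N -> M (J n * (p * q ^+ j)) = 0.
Proof.
move=> jn; rewrite /jacobi -scalerAl momZ// mulr_suml mom_sum//.
apply/eqP; rewrite mulf_eq0; apply/orP; right; apply/eqP.
set N : R := j.+1%:R + d%:R; have N0 : 0 < N by rewrite addr_gt0// ltr0n.
set r := (n - j.+1)%N.
have rn : (r < n)%N by rewrite /r; lia.
have NrE : N + r%:R = n%:R + d%:R.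
  by rewrite /N addrAC -(natrD _ j.+1 r) /r subnKC.
have Rr := rising_gt0 r N0.
pose A : R := mu 1 j * \prod_(i < n) (d%:R / 2 + i.+1%:R) / rising r N.
transitivity (A * \sum_(k < n.+1) (-1) ^+ k * 'C(n, k)%:R * rising r (N + k%:R)); last first.
  by rewrite alternating_rising// mulr0.
rewrite mulr_sumr; apply: eq_bigr => k _.
have Rk := rising_gt0 k N0.
have -> : (2^-1 *: ('X - 1)) ^+ k = (- 2^-1) ^+ k *: p ^+ k :> {poly R}.
  by rewrite exprZn /p -[('X - 1)]opprB -[- (1 - 'X)]scaleN1r exprZn scalerA -exprMn mulrN1.
rewrite scalerA -scalerAl momZ// mulrA -exprSr -/(mu k.+1 j).
have -> : mu k.+1 j = mu 1 j * (2 ^+ k * rising k (d%:R / 2 + 1)) / rising k N.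
  by rewrite -muE mulfK// gt_eqF.
have kn : (k <= n)%N by rewrite -ltnS.
have prodA : \prod_(i < n) (d%:R / 2 + i.+1%:R) =
    rising k (d%:R / 2 + 1) * \prod_(k.+1 <= i < n.+1) (d%:R / 2 + i%:R) :> R.
  rewrite -(big_mkord predT (fun i => d%:R / 2 + i.+1%:R)).
  rewrite (@big_cat_nat _ _ _ k)//= big_mkord; congr (_ * _).
    by apply: eq_bigr => i _; rewrite -natr1; ring.
  by rewrite big_add1.
have prodB : \prod_(i < k) (n%:R + d%:R / 2 + (d%:R - 2) / 2 + i.+1%:R) =
    rising k (N + r%:R) :> R.
  by apply: eq_bigr => i _; rewrite NrE -natr1; field.
have ratio : rising k (N + r%:R) = rising k N * rising r (N + k%:R) / rising r N.
  by rewrite -risingD addnC risingD mulrAC divff ?mul1r// gt_eqF.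
rewrite /A prodA prodB ratio (exprNn 2^-1) exprVn.
have two : (2 : R) ^+ k != 0 by rewrite expf_neq0.
field.
by rewrite two !gt_eqF.
Qed.

Lemma jacobi_orth n (P : {poly R}) : (size P <= n)%N -> M (J n * ((1 - 'X) * P)) = 0.
Proof.
move=> Pn; pose P' := P \Po ('X - 1).
have sP' : size P' = size P.
  by rewrite /P' size_comp_poly2// -[1]/(1%:P) size_XsubC.
have -> : P = \sum_(i < size P') P'`_i *: q ^+ i.
  rewrite -[RHS]comp_polyE /P' -comp_polyA comp_polyB comp_polyX.
  by rewrite -[1]/(1%:P) comp_polyC /q (addrC 1%:P) addrK comp_polyXr.
rewrite mulr_sumr mulr_sumr mom_sum//; apply: big1 => i _.
rewrite -!scalerAr momZ// jacobi_orth_basis ?mulr0//.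
by apply: leq_trans (ltn_ord i) _; rewrite sP'.
Qed.

Lemma jacobi1_gt0 n : 0 < (J n).[1].
Proof.
rewrite /jacobi hornerZ horner_sum mulr_gt0 ?invr_gt0 ?ltr0n ?fact_gt0//.
have d2 : 0 < d%:R / 2 :> R by rewrite divr_gt0 ?ltr0n.
rewrite big_ord_recl/= [X in _ + X]big1 ?addr0.
  rewrite hornerZ expr0 hornerC mulr1 bin0 big_ord0 !mul1r.
  by apply: prodr_gt0 => i _; rewrite ltr_wpDr.
move=> i _; rewrite -[bump 0 i]/(i.+1) hornerZ horner_exp hornerZ.
by rewrite hornerD hornerX hornerN hornerC subrr mulr0 exprS mul0r mulr0.
Qed.

Local Notation RJ n := (njacobi (d%:R / 2) ((d%:R - 2) / 2) n : {poly R}).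

Lemma njacobi1 n : (RJ n).[1] = 1.
Proof. by rewrite /njacobi hornerZ mulVf// gt_eqF// jacobi1_gt0. Qed.

Lemma size_jacobi n : (size (J n) <= n.+1)%N.
Proof.
rewrite /jacobi (leq_trans (size_scale_leq _ _))//.
apply: (leq_trans (size_sum _ _ _)); apply/bigmax_leqP => k _.
rewrite (leq_trans (size_scale_leq _ _))// (leq_trans (size_poly_exp_leq _ _))//.
rewrite ltnS; have : (size (2^-1 *: ('X - 1) : {poly R}) <= 2)%N.
  by rewrite (leq_trans (size_scale_leq _ _))// -[1]/(1%:P) size_XsubC.
by case: (size _) => [|[|[|//]]] _ /=; rewrite ?mul0n ?mul1n// -ltnS.
Qed.

Lemma size_njacobi n : (size (RJ n) <= n.+1)%N.
Proof. by rewrite (leq_trans (size_scale_leq _ _))// size_jacobi. Qed.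

(** [P - P.[1]] is divisible by [1 - 'X], and the quotient has degree less than [n]. Only the
    constant [M (RJ n)] separates [RJ n] from the reproducing kernel; [basis_size] identifies it. *)
Lemma mom_njacobi n (P : {poly R}) : (size P <= n.+1)%N -> M (P * RJ n) = P.[1] * M (RJ n).
Proof.
move=> Pn; have : root (P - P.[1]%:P) 1 by rewrite rootE hornerD hornerN hornerC subrr.
move=> /factor_theorem[Q PQ].
have -> : P * RJ n = P.[1] *: RJ n + - ((J n).[1]^-1 *: (J n * ((1 - 'X) * Q))).
  have -> : P = P.[1]%:P + Q * ('X - 1%:P) by rewrite -PQ addrC subrK.
  rewrite /njacobi hornerD hornerM hornerC hornerD hornerN hornerX hornerC subrr mulr0 addr0.
  rewrite -!mul_polyC; ring.
rewrite momD// momN// !momZ// jacobi_orth ?mulr0 ?oppr0 ?addr0//.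
have [->|Q0] := eqVneq Q 0; first by rewrite size_poly0.
have : (size (P - P.[1]%:P)%R <= n.+1)%N.
  rewrite (leq_trans (size_polyD _ _))// geq_max Pn size_polyN.
  by rewrite (leq_trans (size_polyC_leq1 _)).
by rewrite PQ size_Mmonic ?monicXsubC// size_XsubC addn2.
Qed.

Lemma mom_njacobi_gt0 n : 0 < M (RJ n).
Proof.
have := mom_njacobi (size_njacobi n); rewrite njacobi1 mul1r => <-.
apply: mom_sqr_gt0 => //; apply/eqP => R0; have := njacobi1 n.
by rewrite R0 horner0 => /eqP; rewrite eq_sym oner_eq0.
Qed.

End jacobi_orthogonality.

(** * The dimension of the space of spherical polynomials *)

Section basis.
Context {T : Type} {R : realType}.

Definition spanned_by (V : set (T -> R)) k (e : 'I_k -> T -> R) :=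
  V = [set f | exists c : 'I_k -> R, f = fun x => \sum_(i < k) c i * e i x].

(* A spanning family of minimal size is independent. *)
Lemma basis_of_spanning (V : set (T -> R)) k (e : 'I_k -> T -> R) :
  spanned_by V e -> exists k' (e' : 'I_k' -> T -> R), is_basis V e'.
Proof.
move=> Ve; pose S m := `[< exists e' : 'I_m -> T -> R, spanned_by V e' >].
have exS : exists m, S m by exists k; apply/asboolP; exists e.
case: (ex_minnP exS) => m /asboolP[f Vf] minm; exists m, f; split => // c c0 i.
apply: contrapT => /eqP ci; have m0 : (0 < m)%N by apply: leq_ltn_trans (ltn_ord i).
case: m f Vf minm c c0 i ci {m0} => [f _ _ _ _ [] //|m f Vf minm c c0 i ci].
suff : S m by move/minm; rewrite ltnn.
apply/asboolP; exists (fun j => f (lift i j)); rewrite /spanned_by Vf.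
have fi x : f i x = \sum_(j < m) (- (c i)^-1 * c (lift i j)) * f (lift i j) x.
  have := c0 x; rewrite (bigD1_ord i)//= => /eqP; rewrite addr_eq0 => /eqP e0.
  apply: (mulfI ci); rewrite e0 mulr_sumr -sumrN; apply: eq_bigr => j _.
  by rewrite mulNr mulNr mulrN mulrA mulrA mulfV// mul1r.
apply/seteqP; split => g [b ->].
  exists (fun j => b (lift i j) - b i * ((c i)^-1 * c (lift i j))).
  apply/funext => x; rewrite (bigD1_ord i)//= fi mulr_sumr -big_split/=.
  by apply: eq_bigr => j _; ring.
exists (fun j => if unlift i j is Some j' then b j' else 0).
apply/funext => x; rewrite (bigD1_ord i)//= unlift_none mul0r add0r.
by apply: eq_bigr => j _; rewrite liftK.
Qed.

End basis.

(** * The dimension as the trace of the reproducing kernel *)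

Section dimension_formula.
Context {R : realType}.
Variables (d n : nat).

(** The monomials of degree at most [n] span, but [|x|^2 = 1] makes them dependent on the sphere as
    soon as [n >= 2]; hence a basis is extracted instead of exhibited. *)
Lemma sphere_poly_basis : exists k (e : 'I_k -> d.+1.-tuple R -> R),
  is_basis (@sphere_poly R d n) e.
Proof.
pose I := mpoly.bmultinom d.+1 n.+1.
pose e (i : 'I_#|{: I}|) : d.+1.-tuple R -> R :=
  patch (cst 0) (@sphere R d) (fun x => mpoly.meval (tnth x) (mpoly.mpolyX R (mpoly.bmnm (enum_val i)))).
apply: (@basis_of_spanning _ _ _ _ e); apply/seteqP; split => f.
  move=> [P [Pn ->]]; exists (fun i => mpoly.mcoeff (mpoly.bmnm (enum_val i)) P).
  apply/funext => x; rewrite patchE; case: ifPn => xS; last first.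
    by rewrite big1// => i _; rewrite /e patchE (negPf xS) mulr0.
  rewrite {1}(mpoly.mpolywE Pn) raddf_sum/= (reindex (fun i : 'I_#|{: I}| => enum_val i))/=; last first.
    by exists enum_rank => i _; rewrite ?enum_rankK ?enum_valK.
  by apply: eq_bigr => i _; rewrite mpoly.mevalZ /e patchE xS.
move=> [c ->]; exists (\sum_i c i *: mpoly.mpolyX R (mpoly.bmnm (enum_val i))); split.
  apply: leq_trans (mpoly.mmeasure_sum _ _ _ _) _; apply/bigmax_leqP => i _.
  apply: leq_trans (mpoly.msizeZ_le _ _) _; rewrite mpoly.msizeX.
  exact: mpoly.bmdeg.
apply/funext => x; rewrite patchE; case: ifPn => xS; last first.
  by rewrite big1// => i _; rewrite /e patchE (negPf xS) mulr0.
rewrite raddf_sum/=; apply: eq_bigr => i _.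
by rewrite mpoly.mevalZ /e patchE xS.
Qed.

Hypothesis d_gt0 : (0 < d)%N.

Lemma integrable_surface (h : d.+1.-tuple R -> R) (C : R) : measurable_fun setT h ->
  (forall x, sphere x -> `|h x| <= C) -> (@surface R d).-integrable setT (EFin \o h).
Proof.
move=> mh hC; apply/integrableP; split; first exact/measurable_EFinP.
apply: (@le_lt_trans _ _ (\int[@surface R d]_x (cst `|C|%:E x))%E).
  apply: ae_ge0_le_integral => //.
  - by apply: measurableT_comp => //; exact/measurable_EFinP.
  - by move=> x _; rewrite lee_fin.
  - have := @ae_surface_sphere R d; apply: filterS => x xS _ /=.
    by rewrite lee_fin (le_trans (hC x xS))// ler_norm.
by rewrite (integral_cst _ measurableT) [X in (_ * X)%E]surface_setT mule1 ltry.
Qed.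

Lemma sphere_cube (x : d.+1.-tuple R) : sphere x -> cube 1 x.
Proof. by move=> xS; apply: unit_ball_sub_cube; rewrite /unit_ball/= xS. Qed.

Lemma integrable_polyfunM a b (f g : d.+1.-tuple R -> R) : polyfun a f -> polyfun b g ->
  (@surface R d).-integrable setT (fun x => (f x * g x)%:E).
Proof.
move=> pf pg; have pfg := polyfunM pf pg; have [C HC] := polyfun_bounded pfg.
apply: (@integrable_surface _ C); first exact: measurable_polyfun pfg.
by move=> x /sphere_cube; exact: HC.
Qed.

Local Notation RJ := (njacobi (d%:R / 2) ((d%:R - 2) / 2) n : {poly R}).

Section with_basis.
Variables (k : nat) (e : 'I_k -> d.+1.-tuple R -> R).
Hypothesis be : is_basis (@sphere_poly R d n) e.

Let eP i : exists2 f : d.+1.-tuple R -> R, polyfun n f &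
  e i = patch (cst 0) (@sphere R d) f.
Proof.
have : sphere_poly n (e i).
  rewrite be.2; exists (fun j => (j == i)%:R); apply/funext => x.
  rewrite (bigD1 i)//= eqxx mul1r big1 ?addr0// => j /negPf ->.
  by rewrite mul0r.
by move=> [P [Pn ->]]; exists (fun x => mpoly.meval (tnth x) P) => //; exact: polyfun_meval.
Qed.

(** Each factor [dot x y] is opened into coordinates, whose [x] part is absorbed by [g] and whose
    [y] part goes to the coefficients. The total degree in [x] stays [n], so the basis applies once
    no factor is left. The auxiliary [g] is there for the induction; only [g = 1] is used
    afterwards. *)
Let dot_expand l : (l <= n)%N -> forall g, polyfun (n - l) g ->
  exists2 c : 'I_k -> d.+1.-tuple R -> R, (forall i, polyfun l (c i)) &
    forall x y, sphere x -> g x * dot x y ^+ l = \sum_(i < k) e i x * c i y.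
Proof.
elim: l => [_ g pg|l IH ln g pg].
  rewrite subn0 in pg; have [P Pn gE] := polyfun_mpoly pg.
  have : sphere_poly n (patch (cst 0) (@sphere R d) g) by exists P; rewrite gE.
  rewrite be.2 => -[c cE]; exists (fun i _ => c i) => [i|x y xS]; first exact: polyfun_cst.
  have := congr1 (fun f => f x) cE; rewrite patchE mem_set// expr0 mulr1 => ->.
  by apply: eq_bigr => i _; rewrite mulrC.
have h j : exists c : 'I_k -> d.+1.-tuple R -> R, (forall i, polyfun l (c i)) /\
    forall x y, sphere x -> (tnth x j * g x) * dot x y ^+ l = \sum_(i < k) e i x * c i y.
  have [|c c1 c2] := IH (ltnW ln) (fun x => tnth x j * g x); last by exists c.
  by rewrite -subSS subSn//; exact: polyfun_mul.
have [c cP] := choice h.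
exists (fun i y => \sum_(j < d.+1) tnth y j * c j i y) => [i|x y xS].
  by apply: polyfun_sum => j; apply: polyfun_mul; exact: (cP j).1.
rewrite exprS {1}/dot mulrA mulr_sumr mulr_suml.
under [RHS]eq_bigr do rewrite mulr_sumr.
rewrite exchange_big/=; apply: eq_bigr => j _.
have := (cP j).2 x y xS => E.
transitivity (tnth y j * (tnth x j * g x * dot x y ^+ l)); first by ring.
by rewrite E mulr_sumr; apply: eq_bigr => i _; ring.
Qed.

(* Trace of the reproducing kernel [RJ (x . y) / mom RJ = \sum_i e_i x c_i y]:
   reproduction forces [\int e_m c_i = (m == i)], so integrating the diagonal
   [\sum_i e_i y c_i y = 1 / mom RJ] gives the dimension. *)
Lemma basis_size : k%:R * mom d RJ = 1.
Proof.
have M0 := @mom_njacobi_gt0 R d d_gt0 n; have M1 := lt0r_neq0 M0.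
pose K (t : R) := RJ.[t] / mom d RJ.
have hl (l : 'I_n.+1) : exists c : 'I_k -> d.+1.-tuple R -> R, (forall i, polyfun n (c i)) /\
    forall x y, sphere x -> dot x y ^+ l = \sum_(i < k) e i x * c i y.
  have ln : (l <= n)%N by rewrite -ltnS.
  have [c c1 c2] := dot_expand ln (polyfun_cst _ _ 1).
  exists c; split => [i|x y xS]; first exact: polyfun_le ln (c1 i).
  by rewrite -c2// mul1r.
have [c cP] := choice hl.
pose C i y := \sum_(l < n.+1) (RJ`_l / mom d RJ) * c l i y.
have pC i : polyfun n (C i).
  by apply: polyfun_sum => l; apply: polyfun_scale; exact: (cP l).1.
have KE x y : sphere x -> K (dot x y) = \sum_(i < k) e i x * C i y.
  move=> xS; rewrite /K (horner_coef_wide _ (size_njacobi _ _)) mulr_suml.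
  under [RHS]eq_bigr do rewrite mulr_sumr.
  rewrite exchange_big/=; apply: eq_bigr => l _.
  by rewrite (cP l).2// mulr_sumr mulr_suml; apply: eq_bigr => i _; ring.
have hf (i : 'I_k) : exists f : d.+1.-tuple R -> R,
    polyfun n f /\ e i = patch (cst 0) (@sphere R d) f.
  by have [f] := eP i; exists f.
have [f fP] := choice hf.
have ef i x : sphere x -> e i x = f i x.
  by move=> xS; rewrite (fP i).2 patchE mem_set.
pose A m i := \int[@surface R d]_y (f m y * C i y).
have iA m i := integrable_polyfunM (fP m).1 (pC i).
have Adelta m i : A m i = (m == i)%:R.
  have ind : forall x, \sum_(i < k) (A m i - (m == i)%:R) * e i x = 0.
    move=> x; have [xS|xS] := pselect (sphere x); last first.
      apply: big1 => j _; rewrite (fP j).2 patchE ifF ?mulr0//.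
      by apply/negP => /set_mem.
    under eq_bigr do rewrite mulrBl.
    rewrite sumrB [X in _ - X](bigD1 m)//= eqxx mul1r [X in _ - (_ + X)]big1; last first.
      by move=> j; rewrite eq_sym => /negPf ->; rewrite mul0r.
    rewrite addr0 ef//; apply/eqP; rewrite subr_eq0; apply/eqP.
    have [Q [sQ Q1 HQ]] := surface_average d_gt0 (fP m).1 xS.
    have iK : (wdm d).-integrable setT (EFin \o K).
      apply: eq_integrable (integrable_horner d_gt0 ((mom d RJ)^-1 *: RJ)) => // t _.
      by rewrite /= hornerZ mulrC.
    have := HQ K iK.
    have -> : (\int[wdm d]_t (Q.[t] * K t)%:E = (f m x)%:E)%E.
      rewrite -Q1 -[X in X%:E](mulfK M1) -mom_njacobi// mulrC -momZ// EFin_mom//.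
      by apply: eq_integral => t _; rewrite hornerZ hornerM /K; congr EFin; ring.
    move=> E; apply: EFin_inj; rewrite -E -sumEFin.
    transitivity (\int[@surface R d]_y (\sum_(i < k) (e i x)%:E * (f m y * C i y)%:E))%E.
      rewrite integral_sum//; last by move=> j; apply: integrableZl => //; exact: iA.
      apply: eq_bigr => j _; rewrite (integralZl measurableT (iA m j)).
      by rewrite /A /Rintegral mulrC EFinM fineK//; exact: integrable_fin_num (iA m j).
    apply: eq_integral => y _; rewrite KE// mulr_sumr -sumEFin.
    by apply: eq_bigr => j _; rewrite -EFinM; congr EFin; ring.
  by have /(_ i)/eqP := be.1 _ ind; rewrite subr_eq0 => /eqP.
have trace : (\sum_(i < k) (A i i)%:E = (K 1)%:E)%E.
  transitivity (\int[@surface R d]_y (\sum_(i < k) (f i y * C i y)%:E))%E.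
    rewrite integral_sum//; apply: eq_bigr => i _.
    by rewrite /A /Rintegral fineK//; exact: integrable_fin_num (iA i i).
  transitivity (\int[@surface R d]_y (cst (K 1)%:E y))%E; last first.
    by rewrite (integral_cst _ measurableT) [X in (_ * X)%E]surface_setT mule1.
  apply: ae_eq_integral => //.
  - apply: emeasurable_sum => i; exact: measurable_int (iA i i).
  - have := @ae_surface_sphere R d; apply: filterS => y yS _ /=.
    have /sphere_dot y1 := yS; rewrite sumEFin -[in RHS]y1 KE//; congr EFin.
    by apply: eq_bigr => i _; rewrite ef.
move: trace; rewrite sumEFin => -[].
under eq_bigr do rewrite Adelta eqxx.
by rewrite sumr_const card_ord /K njacobi1// mul1r => ->; rewrite mulVf.
Qed.

End with_basis.

(** The reproducing property at the pole. [basis_size] holds for every basis, in particular for one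
    of the size that [fdim] selects. *)
Lemma mom_Gpoly (P : {poly R}) : (size P <= n.+1)%N -> mom d (P * Gpoly d n) = P.[1].
Proof.
move=> Pn; rewrite /Gpoly -scalerAr momZ// mom_njacobi// mulrCA.
rewrite (_ : _ * mom d _ = 1) ?mulr1//.
have [k [e be]] := sphere_poly_basis.
have ex : exists k, [set k | exists e : 'I_k -> d.+1.-tuple R -> R, is_basis (@sphere_poly R d n) e] k.
  by exists k, e.
have [e' be'] := xgetPex 0%N ex; exact: basis_size be'.
Qed.

End dimension_formula.

(** * The extremal polynomial *)

Section duality_map.
Context {R : realType}.
Variable p : R.
Hypothesis p1 : 1 <= p.

Definition psi (x : R) : R := `|x| `^ (p - 1) * Num.sg x.

Lemma psiM (x : R) : psi x * x = `|x| `^ p.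
Proof.
have [->|x0] := eqVneq x 0.
  by rewrite mulr0 normr0 powR0// gt_eqF// (lt_le_trans _ p1).
rewrite /psi -mulrA (_ : Num.sg x * x = `|x|); last by rewrite normrEsg.
rewrite -{2}[`|x|]powRr1// -powRD ?subrK//.
by rewrite normr_eq0 x0 implybT.
Qed.

Lemma abs_psi (x : R) : x != 0 -> `|psi x| = `|x| `^ (p - 1).
Proof.
move=> x0; rewrite /psi normrM normr_sg x0 mulr1 ger0_norm// powR_ge0.
Qed.

(** Strict at [x = 0] when [p = 1], since then the right-hand side is 0 to the power 0, that is
    1. *)
Lemma abs_psi_le (x : R) : `|psi x| <= `|x| `^ (p - 1).
Proof.
have [->|x0] := eqVneq x 0; last by rewrite abs_psi.
by rewrite /psi sgr0 mulr0 normr0 powR_ge0.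
Qed.

(* Young's inequality: [`|x| `^ p] lies above its tangent at [a], of slope [p * psi a]. *)
Lemma psi_tangent (a b : R) : p * (psi a * b) <= `|b| `^ p + (p - 1) * `|a| `^ p.
Proof.
have p0 : 0 < p := lt_le_trans ltr01 p1.
apply: (@le_trans _ _ (p * (`|a| `^ (p - 1) * `|b|))).
  rewrite ler_pM2l//; apply: le_trans (ler_norm _) _.
  by rewrite normrM ler_wpM2r// abs_psi_le.
move: p1; rewrite le_eqVlt => /predU1P[p1'|p1'].
  by rewrite -p1' subrr powRr0 !mul1r mul0r addr0 powRr1.
have pm : p - 1 != 0 by rewrite subr_eq0 gt_eqF.
have := @conjugate_powR _ `|b| (`|a| `^ (p - 1)) p (p / (p - 1)).
rewrite normr_ge0 powR_ge0 => /(_ isT isT p0) h.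
have q0 : 0 < p / (p - 1) by rewrite divr_gt0// subr_gt0.
have pq : p^-1 + (p / (p - 1))^-1 = 1 by field; rewrite pm gt_eqF.
have := h q0 pq; rewrite -powRrM mulrCA divff// mulr1 => {}h.
rewrite -(ler_pM2l p0) [`|b| * _]mulrC in h.
apply: (le_trans h); rewrite le_eqVlt; apply/orP; left; apply/eqP; field.
by rewrite pm gt_eqF.
Qed.

(** Sum of the two tangent inequalities at the midpoint [c], where the linear terms combine to
    [2 * psi c * c]. *)
Lemma powR_midpoint (a b : R) : `|(a + b) / 2| `^ p <= (`|a| `^ p + `|b| `^ p) / 2.
Proof.
set c := (a + b) / 2.
have Ha := psi_tangent c a; have Hb := psi_tangent c b.
have E : psi c * a + psi c * b = 2 * `|c| `^ p.
  by rewrite -psiM -mulrDr /c; field.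
have E' : p * (psi c * a) + p * (psi c * b) = 2 * p * `|c| `^ p.
  by rewrite -mulrDr E; ring.
lra.
Qed.

Lemma measurable_psi : measurable_fun setT psi.
Proof.
apply: measurable_funM.
  exact: (measurableT_comp (measurable_powR (p - 1)) (@normr_measurable R setT)).
rewrite (_ : Num.sg = fun x : R => \1_(`]0, +oo[) x - \1_(`]-oo, 0[) x); last first.
  apply/funext => x; rewrite !indicE !mem_setE !in_itv/= andbT.
  by case: sgrP => x0; rewrite ?subr0 ?sub0r.
by apply: measurable_funB; exact: measurable_indic.
Qed.

Lemma continuous_sg (x : R) : x != 0 -> {for x, continuous (@Num.sg R)}.
Proof.
move=> x0; apply: cvg_trans (cvg_cst (Num.sg x)).
have sx y : Num.sg x * y > 0 -> Num.sg x = Num.sg y.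
  by case: (sgrP x) x0 => // x1 _; rewrite ?mul1r ?mulN1r ?oppr_gt0 => y1;
    rewrite ?(gtr0_sg y1) ?(ltr0_sg y1).
apply: near_eq_cvg.
have c : Num.sg x * y @[y --> x] --> Num.sg x * x.
  by apply: cvgM; [exact: cvg_cst|exact: cvg_id].
have h : \forall y \near x, 0 < Num.sg x * y.
  by apply: (cvgr_gt _ c); rewrite -normrEsg normr_gt0.
by apply: filterS h => y /sx.
exact: (nbhs_filter x).
Qed.

(** Zero is excluded because [psi] is the sign function when [p = 1]. *)
Lemma continuous_psi (x : R) : x != 0 -> {for x, continuous psi}.
Proof.
move=> x0; apply: cvgM; last exact: continuous_sg.
apply: (@continuous_comp _ _ _ (fun y : R => `|y|) (fun y => y `^ (p - 1))).
  exact: norm_continuous.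
apply: differentiable_continuous; apply/derivable1_diffP.
by apply: derivable_powR; rewrite in_itv/= andbT normr_gt0.
Qed.

Lemma powR_abs_ge (a b : R) : p * (psi a * (b - a)) <= `|b| `^ p - `|a| `^ p.
Proof.
have := psi_tangent a b; have := psiM a => e.
by rewrite mulrBr e mulrBr; lra.
Qed.

(** The tangents at [a] and at [b] bound the difference from the two sides, without any
    differentiability. *)
Lemma powR_abs_lip (M a b : R) : `|a| <= M -> `|b| <= M ->
  `| `|b| `^ p - `|a| `^ p | <= p * M `^ (p - 1) * `|b - a|.
Proof.
have p0 : 0 < p := lt_le_trans ltr01 p1.
have psi_le c u : `|c| <= M -> psi c * u <= M `^ (p - 1) * `|u|.
  move=> cM; apply: le_trans (ler_norm _) _; rewrite normrM ler_wpM2r//.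
  apply: le_trans (abs_psi_le c) _; apply: ge0_ler_powR => //; rewrite ?subr_ge0// nnegrE//.
  exact: le_trans cM.
move=> aM bM.
have := psi_le a (- (b - a)) aM; rewrite normrN -(ler_pM2l p0) => ha.
have := psi_le b (b - a) bM; rewrite -(ler_pM2l p0) => hb.
have ga := powR_abs_ge a b; have gb := powR_abs_ge b a.
rewrite -opprB in gb; move: ha hb ga gb; rewrite !mulrN !mulrA => ha hb ga gb.
by rewrite ler_norml; apply/andP; split; lra.
Qed.

Lemma powR_abs_continuous : continuous (fun x : R => `|x| `^ p).
Proof.
have p0 : 0 < p := lt_le_trans ltr01 p1.
move=> x; set K := p * (`|x| + 1) `^ (p - 1).
have K0 : 0 <= K by rewrite mulr_ge0 ?powR_ge0 ?ltW.
apply/cvgrPdist_le => e e0; near=> y.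
have yx : `|y| <= `|x| + 1.
  rewrite -[y](subrK x) addrC; apply: le_trans (ler_normD _ _) _; rewrite lerD2l distrC.
  by near: y; apply: cvgr_dist_le.
have xx : `|x| <= `|x| + 1 by rewrite lerDl.
apply: (le_trans (powR_abs_lip yx xx)).
have : `|x - y| <= e / (K + 1).
  by near: y; apply: cvgr_dist_le => //; rewrite divr_gt0// ltr_wpDl.
by rewrite ler_pdivlMr ?ltr_wpDl// => h; apply: le_trans h; rewrite mulrC ler_wpM2l// lerDl.
Unshelve. all: by end_near. Qed.

End duality_map.

(** * The weighted energy and its minimizers *)

Section extremal.
Context {R : realType}.
Local Notation leb := (@lebesgue_measure R).
Variable d : nat.
Hypothesis d_gt0 : (0 < d)%N.

Lemma ge0_integral_wdm_star (f : R -> R) : measurable_fun setT f ->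
    (forall t, 0 <= f t) ->
  (\int[wdm_star d]_t (f t)%:E = \int[wdm d]_t (f t * (1 - t))%:E)%E.
Proof.
move=> mf f0.
have mw := @measurable_wdo R d.
have m1 : measurable_fun setT (fun t : R => 1 - t) by exact: measurable_funB.
rewrite (integral_wdm d_gt0); last by apply/measurable_EFinP; exact: measurable_funM.
pose w t : R := wdo d t * (1 - t).
have w0 t : 0 <= w t.
  rewrite /w /wdo; case: ifPn => [/andP[_ t1]|_]; last by rewrite mul0r.
  by rewrite mulr_ge0 ?wd_ge0// subr_ge0 ltW.
have mwd : measurable_fun setT w by exact: measurable_funM.
transitivity (\int[leb]_t ((f t)%:E * (w t)%:E))%E; last first.
  by apply: eq_integral => t _; rewrite -!EFinM /w; congr EFin; ring.
apply: (@integral_transfer _ _ _ _ _ leb (wdm_star d) id w) => //.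
  move=> A mA; rewrite -[LHS]/(wintegral (wd_star d) A) /wintegral.
  have mws := @measurable_wd_star R d.
  rewrite setIC integral_mkcondr integral_itv_bndoo; last first.
    apply: (measurable_funS measurableT) => //.
    apply/(measurable_restrictT _ _).1 => //.
    by apply: measurable_funTS; exact/measurable_EFinP.
  rewrite [LHS]integral_mkcond; apply: eq_integral => t _; rewrite !patchE indicE.
  rewrite mem_setE in_itv/= /w /wdo; case: ifPn => _; last by rewrite mul0r mule0.
  by case: ifPn => _; rewrite ?mul1e ?mul0e.
exact/measurable_EFinP.
Qed.

Lemma eq_integral_wdm (f g : R -> \bar R) :
    measurable_fun setT f -> measurable_fun setT g ->
    (forall t, -1 < t < 1 -> f t = g t) ->
  (\int[wdm d]_t f t = \int[wdm d]_t g t)%E.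
Proof.
move=> mf mg fg; rewrite (integral_wdm d_gt0 mf) (integral_wdm d_gt0 mg).
apply: eq_integral => t _; rewrite /wdo; case: ifPn => [/fg ->//|_].
by rewrite !mule0.
Qed.

Lemma le_Rintegral_wdm (f g : R -> R) :
    (wdm d).-integrable setT (EFin \o f) -> (wdm d).-integrable setT (EFin \o g) ->
    (forall t, -1 < t < 1 -> f t <= g t) ->
  \int[wdm d]_t f t <= \int[wdm d]_t g t.
Proof.
move=> If Ig fg; rewrite -subr_ge0 -(RintegralB measurableT Ig If).
have mh : measurable_fun setT (fun t => g t - f t).
  by apply: measurable_funB; apply/measurable_EFinP;
    [exact: measurable_int Ig|exact: measurable_int If].
rewrite /Rintegral (@eq_integral_wdm _ (fun t => `|g t - f t|%:E)).
- by rewrite fine_ge0// integral_ge0// => t _; rewrite lee_fin.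
- exact/measurable_EFinP.
- by apply/measurable_EFinP; exact: measurableT_comp.
- by move=> t t1; rewrite ger0_norm// subr_ge0 fg.
Qed.

Lemma wdm_ae_eq0 (f : R -> R) : (wdm d).-integrable setT (EFin \o f) ->
    (forall t, -1 < t < 1 -> 0 <= f t) -> \int[wdm d]_t f t = 0 ->
  {ae wdm d, forall t, f t = 0}.
Proof.
move=> If f0 e.
have mf : measurable_fun setT (EFin \o f) by exact: measurable_int If.
have mf' : measurable_fun setT f by exact/measurable_EFinP.
have : (\int[wdm d]_t `|(EFin \o f) t| = 0)%E.
  rewrite (@eq_integral_wdm _ (EFin \o f))//; last first.
  - by move=> t t1; rewrite gee0_abs//= lee_fin f0.
  - by apply: measurableT_comp.
  have If' := integrable_fin_num measurableT If.
  by rewrite -(fineK If'); congr EFin.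
move/(ae_eq_integral_abs (wdm d) measurableT mf); apply: filterS => t /(_ I) [].
by [].
Qed.

Variable p : R.
Hypothesis p1 : 1 <= p.
Let p0 : 0 < p := lt_le_trans ltr01 p1.

Definition energy (P : {poly R}) : R := \int[wdm d]_t (`|P.[t]| `^ p * (1 - t)).

Lemma measurable_powR_horner (P : {poly R}) :
  measurable_fun setT (fun t => `|P.[t]| `^ p).
Proof.
apply: (measurableT_comp (measurable_powR p)).
by apply: measurableT_comp => //; exact: measurable_horner.
Qed.

Lemma powR_horner_bounded (P : {poly R}) :
  exists C, forall t, -1 <= t <= 1 -> `|P.[t]| `^ p <= C.
Proof.
have [C HC] := horner_bounded P; exists (C `^ p) => t t1.
apply: ge0_ler_powR; rewrite ?nnegrE ?HC ?(ltW p0)//.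
exact: le_trans (HC _ t1).
Qed.

Lemma integrable_energy (P : {poly R}) :
  (wdm d).-integrable setT (fun t => (`|P.[t]| `^ p * (1 - t))%:E).
Proof.
have [C HC] := powR_horner_bounded P.
apply: (@integrable_wdm _ _ d_gt0 _ (C * 2)).
  by apply: measurable_funM; [exact: measurable_powR_horner|exact: measurable_funB].
move=> t /andP[t1 t2]; rewrite normrM ger0_norm ?powR_ge0//.
rewrite ler_pM ?powR_ge0//; first by apply: HC; rewrite !ltW.
by rewrite ger0_norm; lra.
Qed.

Lemma energy_ge0 (P : {poly R}) : 0 <= energy P.
Proof.
rewrite /energy /Rintegral.
have := @ge0_integral_wdm_star _ (measurable_powR_horner P) (fun t => powR_ge0 _ _).
by move=> <-; rewrite fine_ge0// integral_ge0// => t _; rewrite lee_fin powR_ge0.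
Qed.

Lemma energy_star (P : {poly R}) :
  (\int[wdm_star d]_t (`|P.[t]| `^ p)%:E = (energy P)%:E)%E.
Proof.
rewrite ge0_integral_wdm_star//; last exact: measurable_powR_horner.
by rewrite /energy /Rintegral fineK//; exact: integrable_fin_num (integrable_energy P).
Qed.

Lemma Lnorm_energy (P : {poly R}) :
  ('N[wdm_star d]_p%:E[EFin \o horner P] = (energy P `^ p^-1)%:E)%E.
Proof. by rewrite unlock /= energy_star poweR_EFin. Qed.

Lemma energyZ c (P : {poly R}) : energy (c *: P) = `|c| `^ p * energy P.
Proof.
rewrite /energy -RintegralZl//; last exact: integrable_energy.
by apply: eq_Rintegral => t _; rewrite hornerZ normrM powRM// mulrA.
Qed.

Lemma energy_gt0 (P : {poly R}) : P != 0 -> 0 < energy P.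
Proof.
move=> P0; rewrite lt_def energy_ge0 andbT; apply/eqP => e.
have PX : P * (1 - 'X) = 0.
  apply: (@wdm_ae_horner _ _ d_gt0).
  have := wdm_ae_eq0 (integrable_energy P) _ e; move=> /(_ _)/wrap[].
    by move=> t /andP[_ t1]; rewrite mulr_ge0 ?powR_ge0// subr_ge0 ltW.
  apply: filterS => t /eqP; rewrite hornerM mulf_eq0 => /predU1P[/powR_eq0_eq0/normr0_eq0 ->|/eqP t1].
    by rewrite mul0r.
  by rewrite !hornerE t1 mulr0.
move: PX => /eqP; rewrite mulf_eq0 (negPf P0)/= subr_eq0 => /eqP/(congr1 (horner^~ 0)).
by rewrite hornerX hornerC => /eqP; rewrite oner_eq0.
Qed.

Definition least_energy n (P : {poly R}) : Prop := [/\ P \is monic, size P = n.+1 &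
  forall Q, Q \is monic -> size Q = n.+1 -> energy P <= energy Q].

Lemma energy_powR_le (P Q : {poly R}) :
  (energy P `^ p^-1 <= energy Q `^ p^-1) = (energy P <= energy Q).
Proof.
move: (energy P) (energy Q) (energy_ge0 P) (energy_ge0 Q) => x y x0 y0.
have pV : 0 < p^-1 by rewrite invr_gt0.
apply/idP/idP => h; last by apply: (ge0_ler_powR (ltW pV)); rewrite ?nnegrE.
rewrite leNgt; apply/negP => h'; move: h; rewrite leNgt => /negP; apply.
by apply: (gt0_ltr_powR pV) => //; rewrite nnegrE.
Qed.

Lemma size_monicB n (P Q : {poly R}) : P \is monic -> Q \is monic ->
  size P = n.+1 -> size Q = n.+1 -> (size (P - Q)%R <= n)%N.
Proof.
move=> /monicP mP /monicP mQ sP sQ.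
apply/leq_sizeP => j; rewrite leq_eqVlt coefB => /predU1P[<-|nj].
  by move: mP mQ; rewrite /lead_coef sP sQ /= => -> ->; rewrite subrr.
by rewrite !nth_default ?subr0 ?sP ?sQ.
Qed.

(** As [Q] runs over degree less than [n], ['X^n - Q] runs over the monic polynomials of degree [n].
    For [n = 0] this would fail: [polys n.-1] would be the constants instead of the zero space. *)
Lemma least_deviatingP n (P : {poly R}) : (0 < n)%N ->
  least_deviating d n p%:E P <-> least_energy n P.
Proof.
move=> n0.
have Ldist_le Q : Q \is monic -> size Q = n.+1 ->
    (Ldist (wdm_star d) p%:E (fun t : R => (t ^+ n)%R) (polys n.-1) <= (energy Q `^ p^-1)%:E)%E.
  move=> mQ sQ; rewrite -Lnorm_energy; apply: ereal_inf_lbound.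
  exists (horner ('X^n - Q)).
    exists ('X^n - Q); split => //; rewrite prednK//.
    by apply: size_monicB; rewrite ?monicXn ?size_polyXn.
  congr Lnorm; apply/funext => t /=; congr EFin.
  by rewrite /= hornerD hornerN hornerXn opprB addrC subrK.
split=> -[mP sP e]; split; [exact: mP|exact: sP| |exact: mP|exact: sP|].
  have e' := eq_trans (esym (Lnorm_energy P)) e.
  by move=> Q mQ sQ; have := Ldist_le Q mQ sQ; rewrite -e' lee_fin energy_powR_le.
apply: (eq_trans (Lnorm_energy P)); apply/eqP; rewrite eq_le (Ldist_le _ mP sP) andbT.
apply: le_ereal_inf_tmp => _ [_ [Q [sQ ->]] <-].
rewrite (_ : EFin \o (_ \- _) = EFin \o horner ('X^n - Q)); last first.
  by apply/funext => t /=; rewrite !hornerE.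
rewrite prednK// in sQ.
have sN : (size (- Q)%R < size ('X^n : {poly R}))%N by rewrite size_polyN size_polyXn.
rewrite (Lnorm_energy ('X^n - Q)) lee_fin energy_powR_le; apply: e.
  by rewrite monicE lead_coefDl ?lead_coefXn.
by rewrite (size_polyDl sN) size_polyXn.
Qed.

End extremal.

(** * Existence of the extremal polynomial *)

Section existence.
Context {R : realType}.
Variable d : nat.
Hypothesis d_gt0 : (0 < d)%N.
Variable p : R.
Hypothesis p1 : 1 <= p.
Let p0 : 0 < p := lt_le_trans ltr01 p1.
Local Notation energy := (energy d p).

Lemma horner_rVpoly_le m (v : 'rV[R]_m.+1) t : -1 <= t <= 1 ->
  `|(rVpoly v).[t]| <= m.+1%:R * `|v|.
Proof.
move=> t1; rewrite (@horner_coef_wide _ m.+1) ?size_poly//.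
apply: le_trans (ler_norm_sum _ _ _) _.
rewrite mulr_natl -[X in _ *+ X]card_ord -sumr_const; apply: ler_sum => i _.
rewrite coef_rVpoly_ord normrM; apply: (@le_trans _ _ `|v 0 i|).
  by rewrite ler_piMr// normrX exprn_ile1// ler_norml.
by rewrite [leRHS]mx_normrE; exact: (le_bigmax _ (fun ij => `|v ij.1 ij.2|) (0, i)).
Qed.

Lemma continuous_energy m : continuous (fun v : 'rV[R]_m.+1 => energy (rVpoly v)).
Proof.
move=> v; set M := m.+1%:R * (`|v| + 1).
(* A Lipschitz constant on the ball of radius 1 about [v]: [M] bounds the polynomials on [-1, 1],
   [m.+1] compares values with coefficients, and 2 bounds [1 - t]. *)
set K := p * M `^ (p - 1) * m.+1%:R * 2.
have K0 : 0 <= K by rewrite !mulr_ge0 ?powR_ge0 ?ltW.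
have lip u : `|u| <= `|v| + 1 -> `|energy (rVpoly v) - energy (rVpoly u)| <= K * `|v - u|.
  move=> uv.
  have Iu := integrable_energy d_gt0 p1 (rVpoly u).
  have Iv := integrable_energy d_gt0 p1 (rVpoly v).
  rewrite /energy -RintegralB//.
  have Id : (wdm d).-integrable setT (EFin \o
      (fun t => `|(rVpoly v).[t]| `^ p * (1 - t) - `|(rVpoly u).[t]| `^ p * (1 - t))).
    by apply: eq_integrable (integrableB measurableT Iv Iu).
  apply: le_trans (le_normr_Rintegral measurableT Id) _.
  have -> : K * `|v - u| = \int[wdm d]_t (K * `|v - u|).
    rewrite Rintegral_cst// [X in fine X](wdm_setT d_gt0) mulr1//.
  apply: (le_Rintegral_wdm d_gt0) => //.
  - exact: integrable_norm Id.
  - by apply: (integrable_wdm d_gt0) => //.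
  move=> t /andP[t1 t2]; rewrite -mulrBl normrM.
  have tt : -1 <= t <= 1 by rewrite !ltW.
  have vM : `|(rVpoly v).[t]| <= M.
    by apply: le_trans (horner_rVpoly_le v tt) _; rewrite ler_pM2l// lerDl.
  have uM : `|(rVpoly u).[t]| <= M.
    by apply: le_trans (horner_rVpoly_le u tt) _; rewrite ler_pM2l.
  have := powR_abs_lip p1 uM vM.
  have <- : (rVpoly (v - u)).[t] = (rVpoly v).[t] - (rVpoly u).[t].
    by rewrite linearB/= hornerD hornerN.
  move=> h; have t3 : `|1 - t| <= 2 by rewrite ger0_norm; lra.
  apply: (le_trans (ler_pM _ _ h t3)) => //.
  rewrite /K -[X in _ <= X]mulrA [2 * _]mulrC mulrA ler_wpM2r//.
  rewrite -[X in _ <= X]mulrA ler_wpM2l ?mulr_ge0 ?powR_ge0 ?(ltW p0)//.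
  exact: horner_rVpoly_le.
apply/(@cvgrPdist_le _ _ _ (nbhs v) (nbhs_filter v)) => e e0.
near=> u; apply: (le_trans (lip u _)).
  rewrite -[u](subrK v) addrC; apply: le_trans (ler_normD _ _) _; rewrite lerD2l distrC.
  near: u; apply: cvgr_dist_le => //.
have : `|v - u| <= e / (K + 1).
  near: u; apply: cvgr_dist_le => //; rewrite divr_gt0// ltr_wpDl//.
rewrite ler_pdivlMr ?ltr_wpDl// => h; apply: le_trans h; rewrite mulrC ler_wpM2l// lerDl//.
Unshelve. all: by end_near. Qed.

Let ratio n (v : 'rV[R]_n.+1) := `|v 0 ord_max| `^ p / energy (rVpoly v).

Let ratioZ n a (v : 'rV[R]_n.+1) : a != 0 -> ratio (a *: v) = ratio v.
Proof.
move=> a0; rewrite /ratio linearZ/= (energyZ d_gt0 p1) mxE normrM powRM// invfM mulrACA.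
by rewrite divff ?mul1r// gt_eqF// powR_gt0// normr_gt0.
Qed.

Let ratio_monic n (Q : {poly R}) : Q \is monic -> size Q = n.+1 ->
  ratio (poly_rV Q : 'rV_n.+1) = (energy Q)^-1.
Proof.
move=> /monicP mQ sQ; rewrite /ratio poly_rV_K ?sQ// mxE.
by move: mQ; rewrite /lead_coef sQ/= => ->; rewrite normr1 powR1 mul1r.
Qed.

(* Compactness of the unit sphere of coefficient vectors: the ratio of a power of the
   leading coefficient to the energy is homogeneous of degree 0. *)
Lemma least_energy_exists n : exists P, least_energy d p n P.
Proof.
pose A := [set v : 'rV[R]_n.+1 | `|v| = 1].
have monic_neq0 (Q : {poly R}) : Q \is monic -> size Q = n.+1 -> (poly_rV Q : 'rV_n.+1) != 0.
  move=> mQ sQ; apply/eqP => /(congr1 rVpoly); rewrite poly_rV_K ?sQ// linear0 => /eqP.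
  by apply/negP; exact: monic_neq0.
have An (v : 'rV[R]_n.+1) : v != 0 -> A (`|v|^-1 *: v).
  by move=> v0; rewrite /A/= normrZ normfV normr_id mulVf// normr_eq0.
have mX : 'X^n \is @monic R by exact: monicXn.
have sX : size ('X^n : {poly R}) = n.+1 by rewrite size_polyXn.
have A0 : A !=set0 by eexists; apply: An; exact: (monic_neq0 _ mX sX).
have cA : compact A.
  apply: bounded_closed_compact.
    by exists 1; split => // x x1 v /= ->; exact: ltW.
  apply: (@closed_comp _ _ (fun v : 'rV[R]_n.+1 => `|v|) [set 1]).
    by move=> v _; exact: norm_continuous.
  exact: closed_eq.
have rA : {within A, continuous (@ratio n)}.
  apply: continuous_in_subspaceT => v; rewrite inE/A/= => v1.
  apply: cvgM; first exact: (nbhs_filter v).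
    have hc := @coord_continuous R 1 n.+1 0 ord_max v.
    exact: (cvg_comp _ _ hc (@powR_abs_continuous _ _ p1 (v 0 ord_max))).
  apply: cvgV; [exact: (nbhs_filter v)| |exact: continuous_energy].
  rewrite gt_eqF// (energy_gt0 d_gt0 p1)//; apply/eqP => h; move/eqP: v1.
  by rewrite -[v]rVpolyK h linear0 normr0 eq_sym oner_eq0.
have [c] := EVT_max_rV A0 cA rA; rewrite inE => c1 max_c.
have max_monic (Q : {poly R}) : Q \is monic -> size Q = n.+1 -> (energy Q)^-1 <= ratio c.
  move=> mQ sQ; have Q0 := monic_neq0 _ mQ sQ.
  have N0 : `|(poly_rV Q : 'rV_n.+1)|^-1 != 0 by rewrite invr_eq0 normr_eq0.
  rewrite -(ratio_monic mQ sQ) -(ratioZ (poly_rV Q) N0).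
  by apply: max_c; rewrite inE; exact: An.
have egt0 (Q : {poly R}) : Q \is monic -> 0 < energy Q.
  by move=> mQ; apply: (energy_gt0 d_gt0 p1); exact: poly.monic_neq0.
(* The maximal ratio is at least that of ['X^n], which is positive, so the maximizer has degree
   exactly [n] and can be made monic. *)
have cn0 : c 0 ord_max != 0.
  apply/eqP => cn; have := max_monic _ mX sX.
  rewrite /ratio cn normr0 powR0 ?gt_eqF// mul0r leNgt invr_gt0.
  by rewrite egt0.
pose P := (c 0 ord_max)^-1 *: rVpoly c.
have Pn : P`_n = 1.
  by rewrite coefZ -[n in LHS]/(nat_of_ord (@ord_max n)) coef_rVpoly_ord mulVf.
have sP : size P = n.+1.
  apply/eqP; rewrite eqn_leq; apply/andP; split.
    by apply: leq_trans (size_scale_leq _ _) _; exact: size_poly.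
  by rewrite ltnNge; apply/negP => h; move/eqP: Pn; rewrite nth_default// eq_sym oner_eq0.
have mP : P \is monic by rewrite monicE lead_coefE sP Pn.
exists P; split; [exact: mP|exact: sP|move=> Q mQ sQ].
have := max_monic _ mQ sQ.
rewrite -(ratioZ c (invr_neq0 cn0)) -[_ *: c]rVpolyK linearZ/= -/P (ratio_monic mP sP).
move: (egt0 _ mP) (egt0 _ mQ); move: (energy P) (energy Q) => x y x0 y0.
by rewrite lef_pV2 ?posrE.
Qed.

End existence.

(** * Orthogonality and uniqueness of the extremal polynomial *)

Section orthogonality.
Context {R : realType}.
Local Notation leb := (@lebesgue_measure R).

Lemma poly_finite_roots (P : {poly R}) : P != 0 ->
  exists s : seq R, forall t, P.[t] = 0 -> t \in s.
Proof.
have [m] := ubnP (size P); elim: m P => // m IH P; rewrite ltnS => sP P0.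
have [[a /factor_theorem[Q PQ]]|/forallNP h] := pselect (exists a, root P a); last first.
  by exists [::] => t /eqP/h.
have Q0 : Q != 0 by apply: contraNneq P0 => Q0; rewrite PQ Q0 mul0r.
have [|s Hs] := IH Q _ Q0.
  by apply: leq_trans sP; rewrite PQ size_Mmonic ?monicXsubC// size_XsubC addn2.
exists (a :: s) => t; rewrite PQ hornerM hornerXsubC inE => /eqP.
by rewrite mulf_eq0 subr_eq0 => /orP[/eqP/Hs ->|->//]; rewrite orbT.
Qed.

(* The sign changes of [P] in the interval ]-1, 1[, listed once each. *)
Lemma poly_sign_changes (P : {poly R}) : P != 0 ->
  exists s : seq R, exists e : R, [/\ uniq s, all (fun a => (-1 < a < 1) && root P a) s, e != 0 &
    forall t, -1 < t < 1 -> 0 <= e * (P.[t] * (\prod_(a <- s) ('X - a%:P)).[t])].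
Proof.
have [m] := ubnP (size P); elim: m P => // m IH P; rewrite ltnS => sP P0.
have [[a [a1 /factor_theorem[Q PQ]]]|/forallNP h] :=
    pselect (exists a, -1 < a < 1 /\ root P a); last first.
  have h' a : -1 < a < 1 -> P.[a] != 0 by move=> a1; apply/negP => Pa; exact: (h a).
  (* Without roots in ]-1, 1[ the sign is that of [P.[0]], by the intermediate value theorem. *)
  exists [::], P.[0]; split => //; first by apply: h'; rewrite oppr_lt0 !ltr01.
  move=> t t1; rewrite big_nil hornerC mulr1 leNgt; apply/negP => neg.
  have ivt (u v : R) : -1 < u < 1 -> -1 < v < 1 -> u <= v -> P.[u] * P.[v] < 0 -> False.
    move=> /andP[u1 _] /andP[_ v1] uv uv0.
    have [Q [x /andP[ux xv] Qx] QP] : exists2 Q, exists2 x, u <= x <= v & root Q x &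
        forall x, root Q x = root P x.
      have [Pu|Pu] := ltP P.[u] 0.
        by exists P => //; apply: poly_ivt => //; rewrite (ltW Pu)/=; nra.
      exists (- P); last by move=> x; rewrite rootN.
      by apply: poly_ivt => //; rewrite !hornerN oppr_le0 Pu oppr_ge0/=; nra.
    have : -1 < x < 1 by rewrite (lt_le_trans u1 ux) (le_lt_trans xv v1).
    by move=> /h'; rewrite -rootE -QP Qx.
  have z1 : -1 < (0 : R) < 1 by rewrite oppr_lt0 !ltr01.
  have [t0|t0] := leP 0 t; first exact: (ivt 0 t).
  by apply: (ivt t 0) => //; rewrite 1?ltW// mulrC.
have Q0 : Q != 0 by apply: contraNneq P0 => Q0; rewrite PQ Q0 mul0r.
have [|s [e [us rs e0 Hs]]] := IH Q _ Q0.
  by apply: leq_trans sP; rewrite PQ size_Mmonic ?monicXsubC// size_XsubC addn2.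
have rP : all (fun a => (-1 < a < 1) && root P a) s.
  apply/allP => x /(allP rs) /andP[-> /rootP Qx]; apply/rootP.
  by rewrite PQ hornerM Qx mul0r.
have ra : root P a by apply/factor_theorem; exists Q.
(* Multiplicities count modulo 2: if [a] is a sign change of [Q], its factor is taken out of the
   product and completes [Q] to [P]; otherwise [a] is added and the square [(t - a)^2] appears. *)
have [as_|nas] := boolP (a \in s).
  exists (rem a s), e; split => //; first exact: rem_uniq.
    by apply/allP => x /mem_rem /(allP rP).
  move=> t t1; have := Hs t t1.
  by rewrite (perm_big _ (perm_to_rem as_)) big_cons PQ !hornerM -mulrA.
exists (a :: s), e; split => //=; [by rewrite nas|by rewrite a1 ra|].
move=> t t1; have := Hs t t1; rewrite big_cons PQ !hornerM => h.
rewrite hornerXsubC; set x := Q.[t] in h *; set y := _.[t] in h *.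
rewrite (_ : e * _ = e * (x * y) * (t - a) ^+ 2); last by ring.
by rewrite mulr_ge0 ?sqr_ge0.
Qed.

Variable d : nat.
Hypothesis d_gt0 : (0 < d)%N.

Lemma wdm_indic (N : set R) : measurable N ->
  wdm d N = (\int[leb]_t ((\1_N t)%:E * (wdo d t)%:E))%E.
Proof.
move=> mN; rewrite -[in LHS](setIT N) -(integral_indic (wdm d) measurableT mN).
by rewrite (integral_wdm d_gt0)//; apply/measurable_EFinP; exact: measurable_indic.
Qed.

Lemma wdm_ae_itv : {ae wdm d, forall t : R, -1 < t < 1}.
Proof.
exists (~` `]-1, 1[%classic); split; first exact/measurableC.
  rewrite wdm_indic; last exact/measurableC.
  apply: integral0_eq => t _; rewrite /wdo indicE; case: ifPn => t1; last by rewrite mule0.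
  by rewrite memNset ?mul0e//= in_itv/= => /(_ t1).
by move=> t /=; rewrite in_itv.
Qed.

Lemma wdm_abs_cont (N : set R) : measurable N -> leb N = 0%E -> wdm d N = 0%E.
Proof.
move=> mN N0; rewrite (wdm_indic mN).
have mw := @measurable_wdo R d.
rewrite (@ae_eq_integral _ _ _ leb _ (cst 0%E)) ?integral0//.
  apply: emeasurable_funM; last exact/measurable_EFinP.
  by apply/measurable_EFinP; exact: measurable_indic.
exists N; split => // t /= h; apply: contrapT => tN; apply: h => _.
by rewrite indicE memNset// mul0e.
Qed.

Lemma Rintegral_wdm_ge0 (f : R -> R) : (wdm d).-integrable setT (EFin \o f) ->
  (forall t, -1 < t < 1 -> 0 <= f t) -> 0 <= \int[wdm d]_t f t.
Proof.
move=> If f0; have := le_Rintegral_wdm d_gt0 (integrable0 (wdm d) setT) If f0.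
by rewrite [X in X <= _]/Rintegral integral0.
Qed.

Lemma wdm_ae_root (P : {poly R}) : P != 0 -> {ae wdm d, forall t, P.[t] != 0}.
Proof.
move=> P0; have [s Hs] := poly_finite_roots P0.
exists [set` s]; split.
- exact/countable_measurable/finite_set_countable/finite_seq.
- apply: wdm_abs_cont; first exact/countable_measurable/finite_set_countable/finite_seq.
  by apply: countable_lebesgue_measure0; apply: finite_set_countable; exact: finite_seq.
- by move=> t /= /negP; rewrite negbK => /eqP/Hs.
Qed.

Variable p : R.
Hypothesis p1 : 1 <= p.
Let p0 : 0 < p := lt_le_trans ltr01 p1.
Local Notation energy := (energy d p).
Local Notation psi := (psi p).

Lemma psi_homothety (x : R) : exists2 c, 0 <= c & psi x = c * x.
Proof.
exists (`|x| `^ (p - 1) / `|x|); first by rewrite mulr_ge0 ?powR_ge0 ?invr_ge0.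
have [->|x0] := eqVneq x 0; first by rewrite /psi sgr0 !mulr0.
by rewrite /psi -mulrA; congr (_ * _); rewrite [X in _ * X]numEsg mulrCA mulVf ?mulr1 ?normr_eq0.
Qed.

Lemma psi_eq0 (x : R) : psi x = 0 -> x = 0.
Proof. by move=> h; have := psiM p1 x; rewrite h mul0r => /esym/powR_eq0_eq0/normr0_eq0. Qed.

Lemma psi_horner_bounded (P : {poly R}) :
  exists C, forall t, -1 <= t <= 1 -> `|psi P.[t]| <= C.
Proof.
have [C HC] := horner_bounded P; exists (C `^ (p - 1)) => t t1.
apply: le_trans (abs_psi_le _ _) _; apply: ge0_ler_powR; rewrite ?subr_ge0// ?nnegrE ?HC//.
exact: le_trans (HC _ t1).
Qed.

Lemma measurable_psi_horner (P : {poly R}) : measurable_fun setT (fun t => psi P.[t]).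
Proof. by apply: (measurableT_comp (measurable_psi p)); exact: measurable_horner. Qed.

Lemma integrable_psi (P Q : {poly R}) :
  (wdm d).-integrable setT (EFin \o (fun t => psi P.[t] * Q.[t])).
Proof.
have [C HC] := psi_horner_bounded P; have [D HD] := horner_bounded Q.
apply: (@integrable_wdm _ _ d_gt0 _ (C * D)).
  by apply: measurable_funM; [exact: measurable_psi_horner|exact: measurable_horner].
move=> t /andP[t1 t2]; rewrite normrM.
by rewrite ler_pM//; [apply: HC|apply: HD]; rewrite !ltW.
Qed.

Lemma energyB (P Q : {poly R}) :
  energy P - energy Q = \int[wdm d]_t ((`|P.[t]| `^ p - `|Q.[t]| `^ p) * (1 - t)).
Proof.
have IP := integrable_energy d_gt0 p1 P.
have IQ := integrable_energy d_gt0 p1 Q.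
by rewrite /energy -RintegralB//; apply: eq_Rintegral => t _; rewrite mulrBl.
Qed.

Lemma integrable_energyB (P Q : {poly R}) :
  (wdm d).-integrable setT
    (EFin \o (fun t => (`|P.[t]| `^ p - `|Q.[t]| `^ p) * (1 - t))).
Proof.
have IP := integrable_energy d_gt0 p1 P.
have IQ := integrable_energy d_gt0 p1 Q.
apply: eq_integrable (integrableB measurableT IP IQ) => // t _ /=.
by rewrite -EFinB -mulrBl.
Qed.

(** The tangent is taken at the competitor [P + e r]: there it bounds the energy increase,
    nonnegative by minimality, from above. The tangent at [P] would bound it from below, which says
    nothing. *)
Lemma least_energy_variation n (P r : {poly R}) (e : R) : least_energy d p n P ->
    (size r <= n)%N -> 0 < e ->
  0 <= \int[wdm d]_t (psi (P + e *: r).[t] * (r * (1 - 'X)).[t]).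
Proof.
move=> [mP sP minP] sr e0.
have sr' : (size (e *: r)%R < size P)%N.
  by rewrite sP ltnS; apply: leq_trans (size_scale_leq _ _) sr.
have mE : P + e *: r \is monic by rewrite monicE lead_coefDl//; apply/eqP/monicP.
have sE : size (P + e *: r) = n.+1 by rewrite size_polyDl.
rewrite -(pmulr_rge0 _ (mulr_gt0 p0 e0)) -RintegralZl//; last exact: integrable_psi.
have := minP _ mE sE; rewrite -subr_ge0 energyB => h; apply: le_trans h _.
apply: (le_Rintegral_wdm d_gt0).
- exact: integrable_energyB.
- by have := integrableZl measurableT (p * e) (integrable_psi (P + e *: r) (r * (1 - 'X))).
move=> t /andP[_ t1]; have := powR_abs_ge p1 (P + e *: r).[t] P.[t].
have t10 : 0 <= 1 - t by rewrite subr_ge0 ltW.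
move/(ler_wpM2r t10); rewrite -subr_ge0 => h; rewrite -subr_ge0; apply: le_trans h _.
rewrite le_eqVlt; apply/orP; left; apply/eqP.
have -> : (r * (1 - 'X)).[t] = r.[t] * (1 - t) by rewrite hornerM !hornerE.
have -> : P.[t] - (P + e *: r).[t] = - (e * r.[t]) by rewrite hornerD hornerZ opprD addrA subrr sub0r.
by move: (psi _) => y; ring.
Qed.

(** Limit of the variation inequality along [e = 1 / (k + 1)]. The integrand converges off the zeros
    of [P], a finite and hence null set, which covers the jump of [psi] for [p = 1]. *)
Lemma least_energy_orthogonal_ge0 n (P r : {poly R}) : least_energy d p n P ->
    (size r <= n)%N ->
  0 <= \int[wdm d]_t (psi P.[t] * (r * (1 - 'X)).[t]).
Proof.
move=> leP sr; have [mP sP _] := leP.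
have P0 : P != 0 by exact: monic_neq0.
pose f_ k t := (psi (P + k.+1%:R^-1 *: r).[t] * (r * (1 - 'X)).[t])%:E.
pose f t := (psi P.[t] * (r * (1 - 'X)).[t])%:E.
have [C HC] := horner_bounded P; have [D HD] := horner_bounded r.
have [D' HD'] := horner_bounded (r * (1 - 'X)).
(* A dominating constant: [C + D] bounds all the perturbed polynomials on [-1, 1] since the steps
   are at most 1, and [D'] bounds the test factor. *)
pose M := (C + D) `^ (p - 1) * D'.
have [_ _ cv] : [/\ (wdm d).-integrable setT f,
    [sequence \int[wdm d]_(x in setT) (`|f_ n x - f x|)]_n @ \oo --> 0%E &
    [sequence \int[wdm d]_(x in setT) (f_ n x)]_n @ \oo --> (\int[wdm d]_(x in setT) (f x))%E]%E.
  apply: (@dominated_convergence _ _ _ (wdm d) setT measurableT f_ f (cst M%:E)).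
  - by move=> k; exact: measurable_int (integrable_psi _ _).
  - exact: measurable_int (integrable_psi _ _).
  - apply: filterS (wdm_ae_root P0) => t Pt _.
    have cv : psi (P + k.+1%:R^-1 *: r).[t] * (r * (1 - 'X)).[t] @[k --> \oo] -->
        psi P.[t] * (r * (1 - 'X)).[t].
      apply: cvgM; last exact: cvg_cst.
      have c1 : (P + k.+1%:R^-1 *: r).[t] @[k --> \oo] --> P.[t].
        have -> : (fun k => (P + k.+1%:R^-1 *: r).[t]) = fun k => P.[t] + harmonic k * r.[t].
          by apply/funext => k; rewrite hornerD hornerZ.
        have c : (P.[t] + harmonic k * r.[t]) @[k --> \oo] --> P.[t] + 0 * r.[t].
          apply: cvgD; first exact: cvg_cst.
          by apply: cvgM; [exact: cvg_harmonic|exact: cvg_cst].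
        by rewrite mul0r addr0 in c.
      exact: (cvg_comp _ _ c1 (@continuous_psi _ p _ Pt)).
    by apply: (cvg_EFin _ cv); exact: nearW.
  - apply: (@integrable_wdm _ _ d_gt0 (cst M) `|M|) => //.
  - apply: filterS wdm_ae_itv => t /andP[t1 t2] k _.
    have tt : -1 <= t <= 1 by rewrite !ltW.
    rewrite lee_fin normrM ler_pM// ?HD'//.
    apply: le_trans (abs_psi_le _ _) _; apply: ge0_ler_powR; rewrite ?subr_ge0// ?nnegrE.
      by rewrite addr_ge0// ?(le_trans _ (HC _ tt)) ?(le_trans _ (HD _ tt)).
    rewrite hornerD hornerZ; apply: le_trans (ler_normD _ _) _; rewrite lerD ?HC//.
    rewrite normrM; apply: le_trans (HD _ tt); rewrite ler_piMl//.
    by rewrite normfV ger0_norm// invf_le1 ?ltr0n// ler1n.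
rewrite /Rintegral fine_ge0//; apply: (cvge_ge _ cv).
near=> k; rewrite /=.
have k0 : 0 < (k.+1%:R^-1 : R) by rewrite invr_gt0.
have := least_energy_variation leP sr k0.
have If := integrable_psi (P + k.+1%:R^-1 *: r) (r * (1 - 'X)).
by rewrite -lee_fin /Rintegral fineK ?(integrable_fin_num measurableT If).
Unshelve. all: by end_near. Qed.

Lemma least_energy_orthogonal n (P r : {poly R}) : least_energy d p n P ->
  (size r <= n)%N -> \int[wdm d]_t (psi P.[t] * (r * (1 - 'X)).[t]) = 0.
Proof.
move=> leP sr; apply/eqP; rewrite eq_le (least_energy_orthogonal_ge0 leP sr) andbT.
have sr' : (size (- r)%R <= n)%N by rewrite size_polyN.
have := least_energy_orthogonal_ge0 leP sr'.
have Ir := integrable_psi P (r * (1 - 'X)).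
rewrite (_ : (\int[wdm d]_t _) = - \int[wdm d]_t (psi P.[t] * (r * (1 - 'X)).[t])) ?oppr_ge0//.
rewrite -[RHS]mulN1r -RintegralZl//; apply: eq_Rintegral => t _.
by rewrite mulNr hornerN mulrN mulN1r.
Qed.

(** Writing [Q - Q.[1]] as a multiple of [1 - 'X] turns orthogonality for the weight [(1 - t) w_d]
    into evaluation at 1 for the weight [w_d]. *)
Lemma least_energy_reproducing n (P Q : {poly R}) : least_energy d p n P ->
    (size Q <= n.+1)%N ->
  \int[wdm d]_t (psi P.[t] * Q.[t]) = Q.[1] * \int[wdm d]_t psi P.[t].
Proof.
move=> leP sQ.
have /factor_theorem[q Qq] : root (Q - Q.[1]%:P) 1 by rewrite rootE !hornerE subrr.
have sq : (size (- q)%R <= n)%N.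
  rewrite size_polyN; have [->|q0] := eqVneq q 0; first by rewrite size_poly0.
  rewrite -ltnS; apply: (@leq_trans (size (Q - Q.[1]%:P))).
    by rewrite Qq size_Mmonic ?monicXsubC// size_XsubC addn2.
  apply: leq_trans (size_polyD _ _) _; rewrite size_polyN geq_max sQ.
  exact: leq_trans (size_polyC_leq1 _) _.
have I1 := integrable_psi P (- q * (1 - 'X)).
have I2 := integrable_psi P Q.[1]%:P.
rewrite -[RHS]add0r -[X in _ = X + _](least_energy_orthogonal leP sq).
transitivity (\int[wdm d]_t (psi P.[t] * (- q * (1 - 'X)).[t] + psi P.[t] * (Q.[1]%:P).[t])).
  apply: eq_Rintegral => t _; rewrite -mulrDr -hornerD mulNr -mulrN opprB -Qq subrK//.
rewrite RintegralD//; congr (_ + _).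
rewrite -RintegralZl//; first by apply: eq_Rintegral => t _; rewrite hornerC mulrC.
apply: eq_integrable (integrable_psi P 1) => // t _ /=.
by rewrite hornerC mulr1.
Qed.

Lemma wdm_ae_itv_forall (f : R -> R) : continuous f ->
  {ae wdm d, forall t, f t = 0} -> forall t, -1 < t < 1 -> f t = 0.
Proof.
move=> cf f0 t /andP[t1 t2]; apply: contrapT => /eqP ft.
have oA : open [set t | f t != 0].
  rewrite (_ : [set t | _] = f @^-1` [set x | x != 0]) //.
  by apply: open_comp => [x _|]; [exact: cf|exact: open_neq].
apply: (@wdm_ae_open _ _ d_gt0 [set t | f t != 0] t oA ft); first by rewrite !ltW.
by apply: filterS f0 => x /= ->; rewrite eqxx.
Qed.

Lemma least_energy_unique n (P1 P2 : {poly R}) :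
  least_energy d p n P1 -> least_energy d p n P2 -> P1 = P2.
Proof.
move=> [m1 s1 min1] [m2 s2 min2].
pose P := 2^-1 *: (P1 + P2).
have Pn : P`_n = 1.
  rewrite coefZ coefD; move/monicP: m1; move/monicP: m2.
  by rewrite !lead_coefE s1 s2 /= => -> ->; rewrite -(@natrD R 1 1) mulVf// pnatr_eq0.
have sP : size P = n.+1.
  apply/eqP; rewrite eqn_leq; apply/andP; split.
    apply: leq_trans (size_scale_leq _ _) _; apply: leq_trans (size_polyD _ _) _.
    by rewrite s1 s2 maxnn.
  by rewrite ltnNge; apply/negP => h; move/eqP: Pn; rewrite nth_default// eq_sym oner_eq0.
have mP : P \is monic by rewrite monicE lead_coefE sP Pn.
have e12 : energy P1 = energy P2.
  move: (min1 _ m2 s2) (min2 _ m1 s1); move: (energy P1) (energy P2) => x y xy yx.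
  by apply: le_anti; rewrite xy yx.
have Pt t : P.[t] = (P1.[t] + P2.[t]) / 2 by rewrite hornerZ hornerD mulrC.
(* The weighted defect in the midpoint inequality. It is nonnegative on ]-1, 1[, and minimality
   makes its integral at most 0. *)
pose h t := (2^-1 * (`|P1.[t]| `^ p - `|P.[t]| `^ p) +
  2^-1 * (`|P2.[t]| `^ p - `|P.[t]| `^ p)) * (1 - t).
have hE : h = fun t => 2^-1 * ((`|P1.[t]| `^ p - `|P.[t]| `^ p) * (1 - t)) +
   2^-1 * ((`|P2.[t]| `^ p - `|P.[t]| `^ p) * (1 - t)).
  by apply/funext => t; rewrite /h mulrDl !mulrA.
have I1 : (wdm d).-integrable setT
    (EFin \o (fun t => 2^-1 * ((`|P1.[t]| `^ p - `|P.[t]| `^ p) * (1 - t)))).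
  exact: (integrableZl measurableT 2^-1 (integrable_energyB P1 P)).
have I2 : (wdm d).-integrable setT
    (EFin \o (fun t => 2^-1 * ((`|P2.[t]| `^ p - `|P.[t]| `^ p) * (1 - t)))).
  exact: (integrableZl measurableT 2^-1 (integrable_energyB P2 P)).
have Ih : (wdm d).-integrable setT (EFin \o h).
  by rewrite hE; exact: (integrableD measurableT I1 I2).
have h0 t : -1 < t < 1 -> 0 <= h t.
  move=> /andP[_ t1]; have := powR_midpoint p1 P1.[t] P2.[t]; rewrite -Pt /h.
  move: (`|P.[t]| `^ p) (`|P1.[t]| `^ p) (`|P2.[t]| `^ p) => x y z xyz.
  by clear -xyz t1; apply: mulr_ge0; [lra|rewrite subr_ge0; exact: ltW].
have inth : \int[wdm d]_t h t = energy P1 - energy P.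
  rewrite hE (RintegralD measurableT I1 I2).
  rewrite (RintegralZl 2^-1 measurableT (integrable_energyB P1 P)).
  rewrite (RintegralZl 2^-1 measurableT (integrable_energyB P2 P)) -!energyB -e12.
  by move: (energy P1) (energy P) => x y; field.
have inth0 : \int[wdm d]_t h t = 0.
  have hge : 0 <= \int[wdm d]_t h t.
    exact: Rintegral_wdm_ge0 Ih h0.
  apply: le_anti; rewrite hge andbT inth.
  by have := min1 _ mP sP; move: (energy P1) (energy P) => x y; rewrite subr_le0.
have leP : least_energy d p n P.
  have eP : energy P1 = energy P.
    by move: inth; rewrite inth0; move: (energy P1) (energy P) => x y /esym/subr0_eq.
  split; [exact: mP|exact: sP|move=> Q mQ sQ].
  by rewrite -eP; exact: (min1 Q mQ sQ).
have P0 : P != 0 by exact: monic_neq0.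
(* The defect is needed at the zeros of [P], a null set, so vanishing almost everywhere has to be
   upgraded by continuity. *)
have ch : continuous h.
  move=> t; apply: cvgM; last by apply: cvgB; [exact: cvg_cst|exact: cvg_id].
  have cH Q : (`|Q.[x]| `^ p) @[x --> t] --> (`|Q.[t]| `^ p).
    exact: (cvg_comp _ _ (@continuous_horner _ Q t) (@powR_abs_continuous _ _ p1 Q.[t])).
  by apply: cvgD; (apply: cvgM; [exact: cvg_cst|apply: cvgB; exact: cH]).
have h00 := wdm_ae_itv_forall ch (wdm_ae_eq0 d_gt0 Ih h0 inth0).
have root0 t : -1 < t < 1 -> root P t -> root (P1 - P2) t.
  move=> t1 /rootP Pt0; have := h00 t t1; rewrite /h Pt0 normr0 powR0 ?gt_eqF//.
  have t2 : 1 - t != 0 by case/andP: t1 => _ t1; rewrite subr_eq0 gt_eqF.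
  move=> /eqP; rewrite mulf_eq0 (negPf t2) orbF !subr0 -mulrDr mulf_eq0 invr_eq0 pnatr_eq0/=.
  rewrite paddr_eq0 ?powR_ge0// => /andP[/eqP/powR_eq0_eq0/normr0_eq0 e1 /eqP/powR_eq0_eq0/normr0_eq0 e2].
  by apply/rootP; rewrite hornerD hornerN e1 e2 subrr.
have [s [e [us /allP rs e0 Hs]]] := poly_sign_changes P0.
have [sn|sn] := leqP n (size s).
  (* [P1 - P2] has degree less than [n] because both are monic, yet vanishes at the [n] or more
     points of [s]. *)
  apply: subr0_eq; apply: (@roots_geq_poly_eq0 _ _ s); [|exact: us|].
    by apply/allP => x /rs /andP[x1 Px]; exact: root0.
  by apply: leq_trans sn; exact: (size_monicB m1 m2 s1 s2).
(* With fewer than [n] sign changes [r] is an admissible test polynomial, and [psi P * r] keeps one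
   sign on ]-1, 1[; orthogonality would force [P * r * (1 - 'X)] to be 0. *)
pose r := \prod_(a <- s) ('X - a%:P).
have sr : (size r <= n)%N by rewrite size_prod_XsubC.
have r0 : r != 0 by apply: monic_neq0; exact: monic_prod_XsubC.
pose g t := e * (psi P.[t] * (r * (1 - 'X)).[t]).
have Ig : (wdm d).-integrable setT (EFin \o g).
  by have := integrableZl measurableT e (integrable_psi P (r * (1 - 'X))).
have g0 t : -1 < t < 1 -> 0 <= g t.
  move=> t1; rewrite /g hornerM; have [c c0 ->] := psi_homothety P.[t].
  rewrite (_ : e * _ = c * (e * (P.[t] * r.[t])) * (1 - 'X).[t]); last by ring.
  apply: mulr_ge0; first exact: (mulr_ge0 c0 (Hs t t1)).
  by case/andP: t1 => _ t1; rewrite !hornerE subr_ge0 ltW.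
have intg : \int[wdm d]_t g t = 0.
  rewrite (RintegralZl e measurableT (integrable_psi P (r * (1 - 'X)))).
  by rewrite (least_energy_orthogonal leP sr) mulr0.
have : P * (r * (1 - 'X)) = 0.
  apply: (wdm_ae_horner d_gt0); apply: filterS (wdm_ae_eq0 d_gt0 Ig g0 intg) => t.
  rewrite [in X in _ -> X]hornerM /g; move: P.[t] (r * (1 - 'X)).[t] => x y /eqP.
  rewrite mulf_eq0 (negPf e0)/= mulf_eq0 => /orP[/eqP/psi_eq0 ->|/eqP ->];
    by rewrite ?mul0r ?mulr0.
have X0 : 1 - 'X != 0 :> {poly R}.
  by rewrite -opprB oppr_eq0 -polyC1 polyXsubC_eq0.
by move/eqP; rewrite !mulf_eq0 (negPf P0) (negPf r0) (negPf X0).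
Qed.

End orthogonality.

(** * Duality *)

Section norms.
Local Open Scope ereal_scope.
Context disp (T : measurableType disp) (R : realType).
Variable mu : {measure set T -> \bar R}.

Lemma Lnorm_ae_eq (q : \bar R) (f g : T -> R) : measurable_fun setT f ->
  measurable_fun setT g -> {ae mu, forall x, f x = g x} ->
  'N[mu]_q[EFin \o f] = 'N[mu]_q[EFin \o g].
Proof.
move=> mf mg fg; rewrite unlock.
have fg' : {ae mu, forall x, `|(EFin \o f) x| = `|(EFin \o g) x|}.
  by apply: filterS fg => x /= ->.
have mr (h : T -> R) r : measurable_fun setT h -> measurable_fun setT (fun x => `|(h x)%:E| `^ r).
  move=> mh; apply: (@measurableT_comp _ _ _ _ _ _ (fun x : \bar R => x `^ r)).
    exact: measurable_poweR.
  by apply: measurableT_comp => //; exact/measurable_EFinP.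
case: q => [r| |].
- congr poweR; apply: ae_eq_integral;
    [exact: measurableT|exact: mr mf|exact: mr mg|].
  by apply: filterS fg => x /= ->.
- by case: ifPn => // _; exact: eq_ess_sup.
- by case: ifPn => // _; exact: eq_ess_inf.
Qed.

Lemma Lnorm_oo_le (f : T -> R) (y : \bar R) : 0 < mu setT ->
  (forall x, `|f x|%:E <= y) -> 'N[mu]_+oo[EFin \o f] <= y.
Proof. by move=> mu0 fy; rewrite unlock mu0; apply/ess_supP; exact: nearW. Qed.

Lemma conjugate_cases (p : R) (q : \bar R) : (1 <= p)%R -> p%:E^-1 + q^-1 = 1 ->
  (p = 1%R /\ q = +oo) \/
  exists r : R, [/\ q = r%:E, (1 < p)%R, (0 < r)%R & (p^-1 + r^-1 = 1)%R].
Proof.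
move=> p1; have p0 := lt_le_trans ltr01 p1.
have pz : p%:E != 0 by rewrite eqe gt_eqF.
move/(hoelder_conjugateP _ (ltNyr p) pz) => ->.
move: p1; rewrite le_eqVlt => /predU1P[<-|p1].
  by left; rewrite hoelder_conjugate1.
right; exists (p / (p - 1))%R; split => //.
- by rewrite /hoelder_conjugate/= (negPf pz) -EFinB inver subr_eq0 gt_eqF.
- by rewrite divr_gt0// subr_gt0.
- by field; rewrite subr_eq0 !gt_eqF.
Qed.

(** The case [p = 1] is the almost everywhere bound of [g] by its essential supremum, which may be
    infinite. *)
Lemma hoelder_normalized (p : R) (q : \bar R) (f g : T -> R) : (1 <= p)%R ->
    p%:E^-1 + q^-1 = 1 -> 0 < mu setT ->
    measurable_fun setT f -> measurable_fun setT g -> 'N[mu]_p%:E[EFin \o f] = 1 ->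
  \int[mu]_x `|(f x * g x)%:E| <= 'N[mu]_q[EFin \o g].
Proof.
move=> p1 pq mu0 mf mg fp.
have [[p1' ->]|[r [-> p1' r0 pr]]] := conjugate_cases p1 pq; last first.
  have := hoelder mu mf mg (lt_trans ltr01 p1') r0 pr.
  by rewrite Lnorm1 fp mul1e.
move: fp; rewrite p1' Lnorm1 => fp.
have Ngt := Lnorm_ge0 mu +oo (EFin \o g).
have : {ae mu, forall x, `|(EFin \o g) x| <= 'N[mu]_+oo[EFin \o g]}.
  by rewrite unlock mu0; exact: ess_sup_ge.
case: ('N[mu]_+oo[EFin \o g]) Ngt => [r|_ _|]//; last by rewrite leey.
rewrite lee_fin => r0 gr.
rewrite -[leRHS]mul1e -fp -ge0_integralZr//; last first.
  by apply: measurableT_comp => //; exact/measurable_EFinP.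
apply: ae_ge0_le_integral => //.
- by apply: measurableT_comp => //; apply/measurable_EFinP; exact: measurable_funM.
- by move=> x _; rewrite mule_ge0.
- apply: emeasurable_funM => //; apply: measurableT_comp => //; exact/measurable_EFinP.
by apply: filterS gr => x gx _; rewrite EFinM abseM lee_wpmul2l.
Qed.

End norms.

(** * Upper bound for the Nikolskii constant *)

Section upper_bound.
Context {R : realType}.
Local Notation leb := (@lebesgue_measure R).
Variables (d n : nat).
Hypothesis d_gt0 : (0 < d)%N.

Lemma integrable_wdmM (F g : R -> R) (C : R) :
    (wdm d).-integrable setT (EFin \o F) -> measurable_fun setT g ->
    (forall t, -1 < t < 1 -> `|g t| <= C) ->
  (wdm d).-integrable setT (EFin \o (fun t => F t * g t)).
Proof.
move=> IF mg gC; have mF : measurable_fun setT F.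
  by apply/measurable_EFinP; exact: measurable_int IF.
have IC : (wdm d).-integrable setT (fun t => (C%:E * (F t)%:E)%E) by exact: integrableZl.
apply/integrableP; split; first by apply/measurable_EFinP; exact: measurable_funM.
case/integrableP : IC => mC; apply: le_lt_trans; apply: ae_ge0_le_integral => //.
- by apply: measurableT_comp => //; apply/measurable_EFinP; exact: measurable_funM.
- exact: measurableT_comp.
apply: filterS (wdm_ae_itv d_gt0) => t t1 _; rewrite -EFinM lee_fin !normrM mulrC.
by rewrite ler_wpM2r//; apply: le_trans (ler_norm C); exact: gC.
Qed.

Lemma integrable_wdm_horner (F : R -> R) (Q : {poly R}) :
    (wdm d).-integrable setT (EFin \o F) ->
  (wdm d).-integrable setT (EFin \o (fun t => F t * Q.[t])).
Proof.
move=> IF; have [C HC] := horner_bounded Q; apply: (@integrable_wdmM _ _ C) => //.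
  exact: measurable_horner.
by move=> t /andP[t1 t2]; apply: HC; rewrite !ltW.
Qed.

Lemma perp_poly (F : R -> R) (Q : {poly R}) : @perp R d n F -> (size Q <= n.+1)%N ->
  \int[wdm d]_t (F t * Q.[t]) = 0.
Proof.
move=> [/Lfun1_integrable IF F0] sQ.
have Fj j : (j <= n)%N -> \int[wdm d]_t (F t * t ^+ j) = 0.
  by move=> jn; rewrite /Rintegral F0.
suff H m : (m <= n.+1)%N -> \int[wdm d]_t (F t * (\poly_(i < m) Q`_i).[t]) = 0.
  have -> : Q = \poly_(i < n.+1) Q`_i.
    apply/polyP => i; rewrite coef_poly; case: ltnP => // ni; rewrite nth_default//.
    exact: leq_trans ni.
  exact: H.
elim: m => [|m IH] mn.
  transitivity (\int[wdm d]_t (cst 0 t : R)); last by rewrite Rintegral_cst// mul0r.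
  by apply: eq_Rintegral => t _; rewrite horner_poly big_ord0 mulr0.
have I1 := integrable_wdm_horner (\poly_(i < m) Q`_i) IF.
have I2 := integrable_wdm_horner (Q`_m *: 'X^m) IF.
have I3 := integrable_wdm_horner 'X^m IF.
transitivity (\int[wdm d]_t (F t * (\poly_(i < m) Q`_i).[t] + F t * (Q`_m *: 'X^m).[t])).
  apply: eq_Rintegral => t _; rewrite -mulrDr; congr (_ * _).
  by rewrite !horner_poly big_ord_recr/= !hornerE.
rewrite (RintegralD measurableT I1 I2) (IH (ltnW mn)) add0r.
transitivity (\int[wdm d]_t (Q`_m * (F t * ('X^m).[t]))).
  by apply: eq_Rintegral => t _; rewrite hornerZ mulrCA.
rewrite (RintegralZl _ measurableT I3).
rewrite -[RHS](mulr0 Q`_m) -(Fj m mn); congr (_ * _).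
by apply: eq_Rintegral => t _; rewrite hornerXn.
Qed.

Lemma measurable_dot (x : d.+1.-tuple R) : measurable_fun setT (dot x).
Proof.
apply: measurable_sum => i; apply: measurable_funM; first exact: measurable_cst.
exact: measurable_tnth.
Qed.

Variables (p : R) (q : \bar R).
Hypothesis p1 : 1 <= p.
Hypothesis hpq : ((p%:E)^-1 + q^-1 = 1)%E.

Lemma nikolskii_point_le (h : d.+1.-tuple R -> R) (F : R -> R) (x : d.+1.-tuple R) :
    polyfun n h -> ('N[@surface R d]_p%:E[EFin \o h] = 1)%E -> @perp R d n F ->
    sphere x ->
  (`|h x|%:E <= 'N[wdm d]_q[EFin \o (horner (Gpoly d n) \- F)%R])%E.
Proof.
move=> ph Nh perpF xS.
have mh := measurable_polyfun ph.
have IF : (wdm d).-integrable setT (EFin \o F) by apply/Lfun1_integrable; case: perpF.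
have IG := integrable_horner d_gt0 (@Gpoly R d n).
set g := (horner (Gpoly d n) \- F).
have Ig : (wdm d).-integrable setT (EFin \o g) by exact: (integrableB measurableT IG IF).
have mg : measurable_fun setT g by apply/measurable_EFinP; exact: measurable_int Ig.
have qNy : q != -oo%E.
  by have [[_ ->]|[r [-> _ _ _]]] := conjugate_cases p1 hpq.
have [Q [sQ Q1 HQ]] := surface_average d_gt0 ph xS.
have e : (\int[@surface R d]_y (h y * g (dot x y))%:E = (h x)%:E)%E.
  rewrite HQ// -Q1.
  have IQG := integrable_wdm_horner Q IG; have IQF := integrable_wdm_horner Q IF.
  have QE : \int[wdm d]_t (Q.[t] * g t) = Q.[1].
    transitivity (\int[wdm d]_t ((Gpoly d n).[t] * Q.[t] - F t * Q.[t])).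
      by apply: eq_Rintegral => t _; rewrite /g/= mulrBr mulrC [Q.[t] * F t]mulrC.
    rewrite (RintegralB measurableT IQG IQF) (perp_poly perpF sQ) subr0.
    rewrite -(mom_Gpoly d_gt0 sQ) /mom; apply: eq_Rintegral => t _.
    by rewrite hornerM mulrC.
  rewrite -QE /Rintegral fineK//; apply: (integrable_fin_num measurableT).
  have := integrable_wdm_horner Q Ig; apply: eq_integrable => // t _ /=.
  by rewrite mulrC.
have mdx := @measurable_dot x.
rewrite -[(_%:E)%E]/(`|(h x)%:E|)%E -e.
have mgx : measurable_fun setT (fun y => g (dot x y)) by exact: measurableT_comp mg mdx.
apply: (@le_trans _ _ (\int[@surface R d]_y `|(h y * g (dot x y))%:E|)%E).
  by apply: le_abse_integral => //; apply/measurable_EFinP; exact: measurable_funM.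
(* The map [dot x] carries the surface measure to [wdm], so the norm on the interval is that of
   [y -> g (x . y)] on the sphere. *)
rewrite (@Lnorm_pullback _ _ _ _ R (@surface R d) (wdm d) (dot x) mdx _ q g mg qNy).
  apply: (hoelder_normalized p1 hpq) => //.
  by rewrite [X in (_ < X)%E](@surface_setT R d) lte01.
by move=> A mA; apply/esym; exact: surface_dot.
Qed.

Lemma measurable_sphere_patch (h : d.+1.-tuple R -> R) : measurable_fun setT h ->
  measurable_fun setT (patch (cst 0) (@sphere R d) h).
Proof.
move=> mh; apply/(measurable_restrictT _ _).1; first exact: measurable_sphere.
exact: measurable_funTS.
Qed.

Lemma Lnorm_sphere_patch (r : \bar R) (h : d.+1.-tuple R -> R) : measurable_fun setT h ->
  ('N[@surface R d]_r[EFin \o patch (cst 0%R) (@sphere R d) h] =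
   'N[@surface R d]_r[EFin \o h])%E.
Proof.
move=> mh; apply: Lnorm_ae_eq => //; first exact: measurable_sphere_patch.
by apply: filterS (@ae_surface_sphere R d) => x xS; rewrite patchE mem_set.
Qed.

Lemma nikolskii_le : (nikolskii d n p%:E <=
  Ldist (wdm d) q (horner (Gpoly d n)) (perp_in d n q))%E.
Proof.
apply: ge_ereal_sup => _ [f [[P [Pn ->]] Nf] <-].
apply: le_ereal_inf_tmp => _ [F [pF _] <-].
have ph := polyfun_meval Pn; have mh := measurable_polyfun ph.
rewrite (Lnorm_sphere_patch _ mh) in Nf.
apply: Lnorm_oo_le => [|x /=]; first by rewrite [X in (_ < X)%E](@surface_setT R d) lte01.
rewrite patchE; case: ifPn => [|_]; last by rewrite normr0 Lnorm_ge0.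
by rewrite inE => xS; exact: (nikolskii_point_le ph Nf pF xS).
Qed.

End upper_bound.

(** * Lower bound and the minimizer *)

Section lower_bound.
Context {R : realType}.
Variables (d n : nat).
Hypothesis d_gt0 : (0 < d)%N.

Lemma polyfun_height (Q : {poly R}) (i : 'I_d.+1) : (size Q <= n.+1)%N ->
  polyfun n (fun x : d.+1.-tuple R => Q.[tnth x i]).
Proof.
move=> sQ.
apply: (@eq_polyfun _ _ _ (fun x => \sum_(j < n.+1) Q`_j * (tnth x i ^+ j * 1))).
  by move=> x; rewrite (horner_coef_wide _ sQ); apply: eq_bigr => j _; rewrite mulr1.
apply: polyfun_sum => j; apply: polyfun_scale.
apply: (@polyfun_le _ _ (j + 0)); first by rewrite addn0 -ltnS.
by apply: polyfun_prod; exact: polyfun_cst.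
Qed.

(** By continuity a larger value would persist on an open set, which is not null for the weight even
    if [t] is an endpoint; [t = 1] is the case of interest. *)
Lemma Lnorm_oo_ge (Q : {poly R}) (t : R) : -1 <= t <= 1 ->
  (`|Q.[t]|%:E <= 'N[wdm d]_+oo[EFin \o horner Q])%E.
Proof.
move=> t1; rewrite leNgt; apply/negP => lt.
have : {ae wdm d, forall x, (`|(EFin \o horner Q) x| <= 'N[wdm d]_+oo[EFin \o horner Q])%E}.
  rewrite unlock [X in (_ < X)%E](wdm_setT d_gt0) lte01; exact: ess_sup_ge.
have := Lnorm_ge0 (wdm d) +oo%E (EFin \o horner Q); move: lt.
case: ('N[wdm d]_+oo[EFin \o horner Q])%E => [r|//|//]; rewrite !lte_fin => rt r0 h.
have oA : open [set x | r < `|Q.[x]|].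
  rewrite (_ : [set x | _] = (fun x => `|Q.[x]|) @^-1` [set y | r < y])//.
  apply: open_comp => [x _|]; last exact: open_gt.
  apply: cvg_norm; exact: continuous_horner.
apply: (wdm_ae_open d_gt0 oA rt t1); apply: filterS h => x /=.
by rewrite lee_fin leNgt => /negP.
Qed.

Variable p : R.
Hypothesis p1 : 1 <= p.
Let p0 : 0 < p := lt_le_trans ltr01 p1.

(** In contrast with [energy] there is no factor [1 - t]: [P] is extremal for [w_d^*] but is
    normalized in [L^p(w_d)]. *)
Definition power_sum (P : {poly R}) : R := \int[wdm d]_t `|P.[t]| `^ p.

Lemma integrable_powR_horner (P : {poly R}) :
  (wdm d).-integrable setT (EFin \o (fun t => `|P.[t]| `^ p)).
Proof.
have [C HC] := powR_horner_bounded p1 P.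
apply: (integrable_wdm d_gt0 (measurable_powR_horner p P) (C := C)) => t /andP[t1 t2].
by rewrite ger0_norm ?powR_ge0// HC// !ltW.
Qed.

Lemma power_sum_ge0 (P : {poly R}) : 0 <= power_sum P.
Proof. by apply: Rintegral_ge0 => t _; exact: powR_ge0. Qed.

Lemma power_sum_gt0 (P : {poly R}) : P != 0 -> 0 < power_sum P.
Proof.
move=> P0; rewrite lt_def power_sum_ge0 andbT; apply: contraNneq P0 => N0; apply/eqP.
apply: (wdm_ae_horner d_gt0).
have := wdm_ae_eq0 d_gt0 (integrable_powR_horner P) (fun t _ => powR_ge0 _ _) N0.
by apply: filterS => t /powR_eq0_eq0/normr0_eq0.
Qed.

Lemma EFin_power_sum (P : {poly R}) :
  (\int[wdm d]_t (`|P.[t]| `^ p)%:E = (power_sum P)%:E)%E.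
Proof.
by rewrite /power_sum /Rintegral fineK//; exact: integrable_fin_num (integrable_powR_horner P).
Qed.

Lemma Lnorm_power_sum (P : {poly R}) :
  ('N[wdm d]_p%:E[EFin \o horner P] = (power_sum P `^ p^-1)%:E)%E.
Proof. by rewrite unlock /= EFin_power_sum poweR_EFin. Qed.

Lemma nikolskii_ge (P : {poly R}) : P != 0 -> (size P <= n.+1)%N ->
  ((`|P.[1]| / power_sum P `^ p^-1)%:E <= @nikolskii R d n p%:E)%E.
Proof.
move=> P0 sP; have N0 := power_sum_gt0 P0.
set c := (power_sum P `^ p^-1)^-1.
have c0 : 0 < c by rewrite invr_gt0 powR_gt0.
pose Q := c *: P.
have sQ : (size Q <= n.+1)%N by apply: leq_trans (size_scale_leq _ _) sP.
have ph := polyfun_height ord0 sQ.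
have [M Mn hM] := polyfun_mpoly ph; have mh := measurable_polyfun ph.
have mQ := measurable_horner Q.
have m0 : measurable_fun setT (fun x : d.+1.-tuple R => tnth x ord0) by exact: measurable_tnth.
have nuE A : measurable A -> wdm d A = @surface R d ((fun x => tnth x ord0) @^-1` A).
  by move=> mA; rewrite surface_height.
have NE r : r != -oo%E ->
    ('N[@surface R d]_r[EFin \o patch (cst 0%R) (@sphere R d) (fun x => Q.[tnth x ord0])%R] =
     'N[wdm d]_r[EFin \o horner Q])%E.
  move=> rN; rewrite (Lnorm_sphere_patch _ mh).
  by rewrite (@Lnorm_pullback _ _ _ _ R (@surface R d) (wdm d) _ m0 nuE r (horner Q) mQ rN).
apply: (@le_trans _ _ ('N[wdm d]_+oo[EFin \o horner Q])%E).
  have -> : `|P.[1]| / power_sum P `^ p^-1 = `|Q.[1]|.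
    by rewrite hornerZ normrM gtr0_norm// mulrC.
  by apply: Lnorm_oo_ge; apply/andP; split; lra.
apply: ereal_sup_ubound; exists (patch (cst 0) (@sphere R d) (fun x => Q.[tnth x ord0])); last exact: NE.
split; first by exists M; split; [exact: Mn|rewrite hM].
rewrite NE// Lnorm_power_sum; congr EFin.
have -> : power_sum Q = c `^ p * power_sum P.
  rewrite /power_sum -(RintegralZl _ measurableT (integrable_powR_horner P)).
  apply: eq_Rintegral => t _; rewrite hornerZ normrM gtr0_norm// powRM//.
  exact: ltW.
rewrite powRM ?powR_ge0 ?power_sum_ge0// -powRrM divff ?gt_eqF// powRr1 ?ltW//.
by rewrite mulVf// gt_eqF// powR_gt0.
Qed.

Section dual.
Variables (q : \bar R) (P : {poly R}).
Hypothesis hpq : ((p%:E)^-1 + q^-1 = 1)%E.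
Hypothesis leP : least_energy d p n P.

Let P0 : P != 0. Proof. by have [mP _ _] := leP; exact: monic_neq0. Qed.
Let N0 : 0 < power_sum P := power_sum_gt0 P0.

Definition dual_kernel (t : R) : R := P.[1] * psi p P.[t] / power_sum P.

Lemma FstarE (t : R) : Fstar d n p P t = (Gpoly d n).[t] - dual_kernel t.
Proof.
rewrite /Fstar /dual_kernel /psi Lnorm_power_sum /= -powRrM mulVf ?gt_eqF// powRr1 ?ltW//.
by rewrite mulrA.
Qed.

Lemma measurable_dual_kernel : measurable_fun setT dual_kernel.
Proof.
rewrite (_ : dual_kernel = (fun t => P.[1] * psi p P.[t] * (power_sum P)^-1))//.
apply: measurable_funM => //; apply: measurable_funM => //.
exact: measurable_psi_horner.
Qed.

Lemma dual_kernel_bounded : exists C, forall t, -1 < t < 1 -> `|dual_kernel t| <= C.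
Proof.
have [C HC] := psi_horner_bounded p1 P.
exists (`|P.[1]| * C / power_sum P) => t /andP[t1 t2].
rewrite /dual_kernel 2!normrM normfV (gtr0_norm N0) ler_wpM2r ?invr_ge0 ?(ltW N0)//.
by rewrite ler_wpM2l// HC// !ltW.
Qed.

(** The case [Q = P] of [least_energy_reproducing] says that [power_sum P] is [P.[1]] times the
    integral of [psi P], which is exactly the normalization of the kernel. *)
Lemma dual_kernel_reproducing (Q : {poly R}) : (size Q <= n.+1)%N ->
  \int[wdm d]_t (dual_kernel t * Q.[t]) = Q.[1].
Proof.
move=> sQ; have [_ sP _] := leP.
pose S := \int[wdm d]_t psi p P.[t].
have NE : power_sum P = P.[1] * S.
  rewrite -(least_energy_reproducing d_gt0 p1 leP) ?sP//.
  by apply: eq_Rintegral => t _; rewrite psiM.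
have IQ := integrable_psi d_gt0 p1 P Q.
transitivity (\int[wdm d]_t (P.[1] / power_sum P * (psi p P.[t] * Q.[t]))).
  by apply: eq_Rintegral => t _; rewrite /dual_kernel; ring.
rewrite (RintegralZl _ measurableT IQ) (least_energy_reproducing d_gt0 p1 leP sQ) -/S.
rewrite mulrCA mulrAC -NE divff ?mulr1// gt_eqF//.
Qed.

(** For [1 < p] the relation [(p - 1) * r = p] makes the [r]-th power of the kernel a multiple of
    [|P|^p]; for [p = 1] it is enough that [|psi| <= 1]. Only the upper bound is proved, since the
    final chain of inequalities yields equality. *)
Lemma Lnorm_dual_kernel_le :
  ('N[wdm d]_q[EFin \o dual_kernel] <= (`|P.[1]| / power_sum P `^ p^-1)%:E)%E.
Proof.
have [[p1' ->]|[r [-> p1' r0 pr]]] := conjugate_cases p1 hpq.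
  apply: Lnorm_oo_le => [|t]; first by rewrite [X in (_ < X)%E](wdm_setT d_gt0) lte01.
  rewrite lee_fin /dual_kernel 2!normrM normfV (gtr0_norm N0).
  rewrite p1' invr1 powRr1 ?power_sum_ge0// ler_wpM2r ?invr_ge0 ?power_sum_ge0//.
  by rewrite ler_piMr//; apply: le_trans (abs_psi_le _ _) _; rewrite subrr powRr0.
rewrite unlock/=; set c := `|P.[1]| / power_sum P.
have c0 : 0 <= c by rewrite mulr_ge0 ?invr_ge0 ?power_sum_ge0.
have rV : r^-1 = 1 - p^-1 by rewrite -pr addrAC subrr add0r.
have E t : `|dual_kernel t| `^ r = c `^ r * `|P.[t]| `^ p.
  rewrite /dual_kernel 2!normrM normfV (gtr0_norm N0) mulrAC powRM//; congr (_ * _).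
  have [->|Pt] := eqVneq P.[t] 0.
    by rewrite /psi sgr0 mulr0 !normr0 !powR0// gt_eqF.
  rewrite abs_psi// -powRrM; congr powR.
  rewrite -[r]invrK rV; field; rewrite subr_eq0 [_ == 1]gt_eqF//= gt_eqF//.
have -> : (\int[wdm d]_t (`|dual_kernel t| `^ r)%:E = (c `^ r * power_sum P)%:E)%E.
  have mP : measurable_fun setT (fun t => (`|P.[t]| `^ p)%:E).
    by apply/measurable_EFinP; exact: measurable_powR_horner.
  have cr0 : (0 <= (c `^ r)%:E)%E by rewrite lee_fin powR_ge0.
  rewrite EFinM -EFin_power_sum -(ge0_integralZl _ measurableT mP _ cr0); last first.
    by move=> t _; rewrite lee_fin powR_ge0.
  by apply: eq_integral => t _; rewrite E EFinM.
rewrite poweR_EFin lee_fin powRM ?powR_ge0 ?power_sum_ge0// -powRrM divff ?gt_eqF//.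
rewrite powRr1// rV powRD; last by rewrite (gt_eqF N0) implybT.
rewrite powRr1 ?power_sum_ge0// powRN /c mulrA divfK ?gt_eqF//.
Qed.

Lemma moments_Fstar_eq0 j : (j <= n)%N -> (\int[wdm d]_t (Fstar d n p P t * t ^+ j)%:E = 0)%E.
Proof.
move=> jn; have sX : (size ('X^j : {poly R}) <= n.+1)%N by rewrite size_polyXn.
have [C HC] := dual_kernel_bounded.
have ID : (wdm d).-integrable setT (EFin \o dual_kernel).
  exact: (integrable_wdm d_gt0 measurable_dual_kernel HC).
have I1 := integrable_horner d_gt0 ('X^j * @Gpoly R d n).
have I2 := integrable_wdm_horner d_gt0 'X^j ID.
transitivity (\int[wdm d]_t (('X^j * Gpoly d n).[t] - dual_kernel t * ('X^j).[t])%:E)%E.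
  by apply: eq_integral => t _; rewrite FstarE hornerM hornerXn mulrBl [t ^+ j * _]mulrC.
have Ifin := integrable_fin_num measurableT (integrableB measurableT I1 I2).
have := RintegralB measurableT I1 I2.
rewrite (dual_kernel_reproducing sX) -[X in _ = X - _]/(mom d _) (mom_Gpoly d_gt0 sX) subrr.
by move=> h; exact: (eq_trans (esym (fineK Ifin)) (congr1 EFin h)).
Qed.

Lemma Fstar_bounded : exists C, forall t, -1 < t < 1 -> `|Fstar d n p P t| <= C.
Proof.
have [C HC] := dual_kernel_bounded; have [D HD] := horner_bounded (@Gpoly R d n).
exists (D + C) => t t1; rewrite FstarE; apply: le_trans (ler_normB _ _) _.
by apply: lerD; [apply: HD; case/andP: t1 => t1 t2; rewrite !ltW|exact: HC].
Qed.

Lemma measurable_Fstar : measurable_fun setT (Fstar d n p P).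
Proof.
rewrite (_ : Fstar d n p P = fun t => (Gpoly d n).[t] - dual_kernel t); last first.
  by apply/funext => t; rewrite FstarE.
apply: measurable_funB; [exact: measurable_horner|exact: measurable_dual_kernel].
Qed.

Lemma Fstar_perp : perp_in d n q (Fstar d n p P).
Proof.
have [C HC] := Fstar_bounded; have mF := measurable_Fstar.
split; last first.
  rewrite /= inE; apply/andP; split; rewrite inE//=.
  have [[_ ->]|[r [-> _ r0 _]]] := conjugate_cases p1 hpq.
    apply: (@le_lt_trans _ _ C%:E); last exact: ltry.
    rewrite unlock [X in (_ < X)%E](wdm_setT d_gt0) lte01; apply/ess_supP.
    by apply: filterS (wdm_ae_itv d_gt0) => t t1; rewrite /= lee_fin HC.
  rewrite /finite_norm unlock/=; apply: poweR_lty.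
  have mr : measurable_fun setT (fun t => `|Fstar d n p P t| `^ r).
    by apply: (measurableT_comp (measurable_powR r)); exact: measurableT_comp.
  have Ir : (wdm d).-integrable setT (EFin \o (fun t => `|Fstar d n p P t| `^ r)).
    apply: (integrable_wdm d_gt0 mr (C := C `^ r)) => t t1.
    rewrite ger0_norm ?powR_ge0//; apply: (ge0_ler_powR (ltW r0)); rewrite ?nnegrE ?HC//.
    exact: le_trans (HC t t1).
  by rewrite ltey_eq; apply/orP; left; exact: (integrable_fin_num measurableT Ir).
split; last exact: moments_Fstar_eq0.
by apply/Lfun1_integrable; exact: (integrable_wdm d_gt0 mF HC).
Qed.

Lemma Lnorm_residual_le :
  ('N[wdm d]_q[EFin \o (horner (Gpoly d n) \- Fstar d n p P)%R] <=
   (`|P.[1]| / power_sum P `^ p^-1)%:E)%E.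
Proof.
rewrite (_ : (_ \- _) = dual_kernel); first exact: Lnorm_dual_kernel_le.
by apply/funext => t; rewrite /= FstarE opprB addrC subrK.
Qed.

End dual.
End lower_bound.

Theorem theorem4p1 (R : realType) (d n : nat) (p : R) (q : \bar R)
    (hd : (0 < d)%N) (hn : (0 < n)%N) (hp : 1 <= p)
    (hpq : ((p%:E)^-1 + q^-1 = 1)%E) :
  nikolskii d n p%:E = Ldist (wdm d) q (horner (Gpoly d n)) (perp_in d n q) /\
  exists P : {poly R},
    [/\ unique (least_deviating d n p%:E) P,
        perp_in d n q (Fstar d n p P) &
        ('N[wdm d]_q[EFin \o (horner (Gpoly d n) \- Fstar d n p P)%R])%E
          = Ldist (wdm d) q (horner (Gpoly d n)) (perp_in d n q)].
Proof.
have [P leP] := least_energy_exists hd hp n.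
have [mP sP _] := leP.
have up := nikolskii_le n hd hp hpq.
have pF := Fstar_perp hd hp hpq leP.
have res := Lnorm_residual_le hd hp hpq leP.
have low : (_ <= nikolskii d n p%:E)%E :=
  nikolskii_ge hd hp (monic_neq0 mP) (eq_leq sP).
have dist : (Ldist (wdm d) q (horner (Gpoly d n)) (perp_in d n q) <=
    'N[wdm d]_q[EFin \o (horner (Gpoly d n) \- Fstar d n p P)%R])%E.
  by apply: ereal_inf_lbound; exists (Fstar d n p P).
(* The chain closes up: Nikolskii constant, distance, norm of the residual, [|P(1)| / ||P||],
   Nikolskii constant, each at most the next. This gives at once duality and optimality of
   [Fstar]. *)
have e : nikolskii d n p%:E = Ldist (wdm d) q (horner (Gpoly d n)) (perp_in d n q).
  apply/eqP; rewrite eq_le up/=; apply: (le_trans dist); exact: (le_trans res low).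
split; first exact: e.
exists P; split; [split| |].
- exact/(least_deviatingP hd hp P hn).
- move=> Q /(least_deviatingP hd hp Q hn) leQ.
  exact: (least_energy_unique hd hp leP leQ).
- exact: pF.
- by apply/eqP; rewrite eq_le dist andbT; apply: (le_trans res); rewrite -e.
Qed.
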